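(* Let $\mathbf W=(W_1,W_2)$ be a standard planar Brownian motion started at the origin, and let $\mathsf r$ be the inradius of the convex hull of $\{\mathbf W(s):s\in[0,1]\}$. Then $$2.7\cdot10^{-6}\le \mathrm{Var}(\mathsf r)\le 0.315520 .$$
   Context: Standard planar Brownian motion: $\mathbf W(t)=(W_1(t),W_2(t))$ with $W_1,W_2$ independent standard one-dimensional Brownian motions started at $0$. The inradius of a compact convex set in $\mathbb R^2$ is the radius of the largest disk contained in it. *)

(* Defs.v *)
From HB Require Import structures.
From mathcomp Require Import all_boot all_order all_algebra.
From mathcomp Require Import all_classical all_reals all_analysis.

Set Implicit Arguments.
Unset Strict Implicit.
Unset Printing Implicit Defensive.

Import Order.TTheory GRing.Theory Num.Theory.
Import numFieldNormedType.Exports.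

Local Open Scope classical_set_scope.
Local Open Scope ring_scope.

Section process.
Context d (T : measurableType d) (R : realType) (P : probability T R).

(* Each A i may be setT, so the product rule also covers all subfamilies. *)
Definition mutually_independent (n : nat) (X : 'I_n -> T -> R) : Prop :=
  forall A : 'I_n -> set R, (forall i, measurable (A i)) ->
    P (\bigcap_i X i @^-1` A i) = (\prod_(i < n) P (X i @^-1` A i))%E.

(* Only the times t >= 0 matter; the values of a process at t < 0 are junk. *)
Definition process_sigma_algebra (X : R -> T -> R) : set (set T) :=
  <<s \bigcup_(t in `[0, +oo[) preimage_set_system setT (X t) measurable >>.

Definition independent_processes (X Y : R -> T -> R) : Prop :=
  forall A B, process_sigma_algebra X A -> process_sigma_algebra Y B ->
    P (A `&` B) = (P A * P B)%E.

(* The second parameter of normal_prob is the standard deviation; it has to be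
   nonzero, hence the strict inequality s < t. *)
Record brownian_motion (B : R -> T -> R) : Prop := {
  bm_measurable : forall t : R, 0 <= t -> measurable_fun setT (B t) ;
  bm_start : forall w, B 0 w = 0 ;
  bm_independent_increments : forall (n : nat) (t : nat -> R),
    0 <= t 0%N -> nondecreasing_seq t ->
    mutually_independent (fun i : 'I_n => B (t i.+1) \- B (t i)) ;
  bm_gaussian_increments : forall (s t : R) (U : set R),
    0 <= s -> s < t -> measurable U ->
    P ((B t \- B s) @^-1` U) = normal_prob 0 (Num.sqrt (t - s)) U ;
  bm_continuous : forall w, {within `[0, +oo[, continuous (fun t => B t w)}
}.

Record planar_brownian_motion (W : R -> T -> 'rV[R]_2) : Prop := {
  pbm_fst : brownian_motion (fun t w => W t w 0 0) ;
  pbm_snd : brownian_motion (fun t w => W t w 0 1) ;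
  pbm_independent : independent_processes
    (fun t w => W t w 0 0) (fun t w => W t w 0 1)
}.

End process.

Section geometry.
Context (R : realType).

Definition convex_hull (A : set 'rV[R]_2) : set 'rV[R]_2 :=
  smallest (@convex_set R 'rV[R]_2) A.

(* The library norm on 'rV[R]_2 is the sup norm, so that ball and closed_ball
   are squares; the Euclidean disk is spelled out instead. *)
Definition disk (c : 'rV[R]_2) (rho : R) : set 'rV[R]_2 :=
  [set x | \sum_(i < 2) (x 0 i - c 0 i) ^+ 2 <= rho ^+ 2].

(* For K compact, convex and nonempty, the supremum is a maximum. Points are
   disks of radius 0, so a degenerate K has inradius 0. *)
Definition inradius (K : set 'rV[R]_2) : R :=
  sup [set rho | 0 <= rho /\ exists c, disk c rho `<=` K].

End geometry.

(* Main.v *)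
Require Import Defs.
From HB Require Import structures.
From mathcomp Require Import all_boot all_order all_algebra.
From mathcomp Require Import all_classical all_reals all_analysis.
From mathcomp Require Import measurable_realfun.
From mathcomp Require Import ring lra zify.

(** The path is sampled at the times j / M. The inradius F of the hull of this
    skeleton is at most r, and it tends to r because the path is uniformly
    continuous and the inradius is Lipschitz ([inradius_dilation]). So it is
    enough to bound second moments E (F - m) ^ 2 uniformly in M: the upper
    bound passes to the limit by Fatou's lemma, the lower one by dominated
    convergence. For a skeleton everything is a statement on a finite sequence
    of independent centered normal variables, the increments.

    The upper bound. The variance is at most E (F - c) ^ 2, here with c = 0.46.
    Twice the inradius is at most the range of the first coordinate, and
    reflections show that this range exceeds a level at most eight times as
    often as the endpoint does ([walk_range_tail]). This bounds the part of
    (F - c) ^ 2 above c ^ 2 by a Gaussian integral, and the result is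
    c ^ 2 + exp (- a ^ 2 / 2) / a with a = 4 c ([skel_second_moment]).

    The lower bound. It is shown that E (F - m) ^ 2 >= 2.7 / 10 ^ 6 for every m,
    in particular for the mean.

    If m <= 0.24, the triangle with vertices 0, W(1/2) and W(1) is used. Its
    legs are long and nearly perpendicular with probability at least
    3.45 / 10 ^ 4, and then F >= 0.33
    ([inradius_legs], [small_center_second_moment]).

    If m >= 0.24, the time interval is cut into 512 blocks. The increment of
    each coordinate over each block is multiplied by lambda = 127 / 128, while
    the bridges between the ends of the blocks are kept. Rotating each block in
    such a way that its normalized sum becomes a coordinate shows that this map
    replaces the law by one with density l, a product of densities of
    one-dimensional scalings ([integral_shrink_all]), and E l ^ 2 - 1 < 0.1416.
    Let E be the event that all bridges of both coordinates stay below
    0.15 / sqrt 2 in absolute value. It has probability at least 0.94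
    ([narrow_bridges_prob]) and is invariant under the map, as the bridges are.
    On E the new path is within (1 - lambda) 0.15 of the path dilated by lambda,
    so that the map takes F to at most lambda F + (1 - lambda) 0.15
    ([inradius_shrink_all]): the inradius decreases noticeably under a change of
    density that is close to 1, which forces it to fluctuate. Precisely, the
    integral of (F - m) (lambda - l) over E is at least
    (1 - lambda) (m - 0.15) P(E), and the inequality of Cauchy and Schwarz
    bounds E (F - m) ^ 2 from below ([tilted_second_moment]). *)

Set Implicit Arguments.
Unset Strict Implicit.
Unset Printing Implicit Defensive.

Import Order.TTheory GRing.Theory Num.Theory.
Import numFieldNormedType.Exports.

Local Open Scope classical_set_scope.
Local Open Scope ring_scope.

(** * Separation in the plane *)
Section planar_geometry.
Context (R : realType).
Implicit Types (A K : set 'rV[R]_2) (x y c : 'rV[R]_2).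

(** The slopes of the points of the cone below a ray of the cone are at most
    the slopes of those above it, as a combination of two points violating
    this would be a nonpositive multiple of the ray; the separating functional
    has a slope in between. *)
Lemma cone_support (C : R -> R -> Prop) :
  (forall a b a' b', C a b -> C a' b' -> C (a + a') (b + b')) ->
  (forall t a b, 0 < t -> C a b -> C (t * a) (t * b)) ->
  ~ C 0 0 ->
  exists u v : R, 0 < u ^+ 2 + v ^+ 2 /\ forall a b, C a b -> 0 <= u * a + v * b.
Proof.
move=> Cadd Cscale C0.
have [[a0 [b0 C00]]|Cempty] := pselect (exists a b, C a b); last first.
  exists 1, 0; split; first by rewrite expr1n expr0n addr0.
  by move=> a b Cab; case: Cempty; exists a, b.
have s0 : 0 < a0 ^+ 2 + b0 ^+ 2.
  rewrite lt_neqAle addr_ge0 ?sqr_ge0// andbT eq_sym paddr_eq0 ?sqr_ge0//.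
  rewrite !sqrf_eq0; apply/negP => /andP[/eqP a00 /eqP b00].
  by apply: C0; move: C00; rewrite a00 b00.
pose X a b := a * a0 + b * b0.
pose Y a b := a0 * b - b0 * a.
have axis a b : C a b -> Y a b = 0 -> 0 < X a b.
  move=> Cab Yab; rewrite ltNge; apply/negP => Xab; apply: C0.
  have ea : a = X a b / (a0 ^+ 2 + b0 ^+ 2) * a0.
    apply: (@mulIf _ (a0 ^+ 2 + b0 ^+ 2)); first by rewrite gt_eqF.
    rewrite mulrAC divfK ?gt_eqF// /X.
    by move: Yab; rewrite /Y => /eqP; rewrite subr_eq0 => /eqP Yab; ring: Yab.
  have eb : b = X a b / (a0 ^+ 2 + b0 ^+ 2) * b0.
    apply: (@mulIf _ (a0 ^+ 2 + b0 ^+ 2)); first by rewrite gt_eqF.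
    rewrite mulrAC divfK ?gt_eqF// /X.
    by move: Yab; rewrite /Y => /eqP; rewrite subr_eq0 => /eqP Yab; ring: Yab.
  move: Xab; rewrite le_eqVlt => /orP[/eqP Xab|Xab].
    by rewrite Xab !mul0r in ea eb; rewrite -{1}ea -eb.
  have t0 : 0 < - (X a b / (a0 ^+ 2 + b0 ^+ 2)).
    by rewrite -mulNr divr_gt0// oppr_gt0.
  move: ea eb t0; move: (X a b / _) => t ea eb t0.
  have := Cadd _ _ _ _ Cab (Cscale _ _ _ t0 C00).
  by rewrite ea eb !mulNr !subrr.
have [[p [q [Cpq Ypq]]]|noup] := pselect (exists a b, C a b /\ 0 < Y a b); last first.
  exists b0, (- a0); split; first by rewrite sqrrN addrC.
  move=> a b Cab; rewrite leNgt; apply/negP => h; apply: noup.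
  by exists a, b; split => //; rewrite /Y; lra.
have [[p' [q' [Cpq' Ypq']]]|nodown] := pselect (exists a b, C a b /\ Y a b < 0); last first.
  exists (- b0), a0; split; first by rewrite sqrrN addrC.
  move=> a b Cab; rewrite leNgt; apply/negP => h; apply: nodown.
  by exists a, b; split => //; rewrite /Y; lra.
have slopes a b a' b' : C a b -> Y a b < 0 -> C a' b' -> 0 < Y a' b' ->
    X a b / Y a b <= X a' b' / Y a' b'.
  move=> Cab Yab Cab' Yab'.
  have /axis : C (- Y a b * a' + Y a' b' * a) (- Y a b * b' + Y a' b' * b).
    by apply: Cadd; apply: Cscale => //; rewrite oppr_gt0.
  have -> : Y (- Y a b * a' + Y a' b' * a) (- Y a b * b' + Y a' b' * b) = 0.
    by rewrite /Y; ring.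
  have -> : X (- Y a b * a' + Y a' b' * a) (- Y a b * b' + Y a' b' * b) =
            - Y a b * X a' b' + Y a' b' * X a b by rewrite /X; ring.
  move=> /(_ erefl) h.
  rewrite ler_pdivlMr// mulrAC ler_ndivrMr//; lra.
pose S := [set z | exists a b, [/\ C a b, Y a b < 0 & z = X a b / Y a b]].
have supS : has_sup S.
  split; first by exists (X p' q' / Y p' q'), p', q'.
  by exists (X p q / Y p q) => _ [a [b [Cab Yab ->]]]; exact: slopes.
pose t := sup S.
exists (a0 + t * b0), (b0 - t * a0); split.
  have -> : (a0 + t * b0) ^+ 2 + (b0 - t * a0) ^+ 2 =
            (a0 ^+ 2 + b0 ^+ 2) * (1 + t ^+ 2) by ring.
  by rewrite mulr_gt0// ltr_pwDl// sqr_ge0.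
move=> a b Cab.
have -> : (a0 + t * b0) * a + (b0 - t * a0) * b = X a b - t * Y a b.
  by rewrite /X /Y; ring.
rewrite subr_ge0; case: (ltgtP (Y a b) 0) => Yab.
- by rewrite -ler_ndivrMr//; apply: (sup_upper_bound supS); exists a, b.
- rewrite -ler_pdivlMr//; apply: sup_le_ub; first by case: supS.
  by move=> _ [a' [b' [Cab' Yab' ->]]]; exact: slopes.
- by rewrite Yab mulr0 ltW// axis.
Qed.

Lemma convex_setP K : convex_set K <->
  forall x y t, 0 <= t <= 1 -> K x -> K y -> K (t *: x + (1 - t) *: y).
Proof.
split => [cK x y t /andP[t0 t1] Kx Ky|cK x y t].
  have := cK x y (Itv01 t0 t1); rewrite !inE => /(_ Kx Ky).
  by [].
rewrite !inE => Kx Ky; have := cK x y t%:num.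
by apply => //; rewrite ge0 le1.
Qed.

(** The cone is the one spanned by the differences between x and the points of
    K; it misses 0 because x is not in K. *)
Lemma convex_separation K x : convex_set K -> ~ K x ->
  exists u v : R, 0 < u ^+ 2 + v ^+ 2 /\
    forall y, K y -> u * y 0 0 + v * y 0 1 <= u * x 0 0 + v * x 0 1.
Proof.
move=> /convex_setP cK Kx.
pose C a b := exists t y, [/\ 0 < t, K y, a = t * (x 0 0 - y 0 0) &
                              b = t * (x 0 1 - y 0 1)].
have [|t a b t0 [t' [y [t'0 Ky -> ->]]]||u [v [uv h]]] := @cone_support C.
- move=> _ _ _ _ [t [y [t0 Ky -> ->]]] [t' [y' [t'0 Ky' -> ->]]].
  have tt : 0 < t + t' by rewrite addr_gt0.
  have tt0 : t + t' != 0 by rewrite gt_eqF.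
  exists (t + t'), (t / (t + t') *: y + (1 - t / (t + t')) *: y'); split => //.
  + apply: cK => //; apply/andP; split; first by rewrite divr_ge0// ltW.
    rewrite ler_pdivrMr// mul1r; lra.
  + by rewrite !mxE; field.
  + by rewrite !mxE; field.
- by exists (t * t'), y; split; rewrite ?mulr_gt0// mulrA.
- move=> [t [y [t0 Ky e0 e1]]]; apply: Kx.
  have {}e0 : x 0 0 = y 0 0.
    by apply/eqP; rewrite -subr_eq0; move/esym/eqP: e0; rewrite mulf_eq0 gt_eqF.
  have {}e1 : x 0 1 = y 0 1.
    by apply/eqP; rewrite -subr_eq0; move/esym/eqP: e1; rewrite mulf_eq0 gt_eqF.
  suff -> : x = y by [].
  apply/rowP => j; case: j => [[|[|//]] hj].
    by rewrite (_ : Ordinal hj = 0)//; exact/val_inj.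
  by rewrite (_ : Ordinal hj = 1)//; exact/val_inj.
exists u, v; split => // y Ky.
have /h : C (x 0 0 - y 0 0) (x 0 1 - y 0 1) by exists 1, y; rewrite !mul1r; split.
lra.
Qed.

End planar_geometry.

(** * The inradius of a convex hull *)
Section inradius.
Context (R : realType).
Implicit Types (A K : set 'rV[R]_2) (x y c : 'rV[R]_2).

(** One bounded coordinate is enough for the radii of the disks in the hull to
    be bounded. *)
Definition in_strip A (lo hi : R) := forall y, A y -> lo <= y 0 0 <= hi.

Lemma convex_hull_convex A : convex_set (convex_hull A).
Proof.
move=> x y t; rewrite !inE => hx hy K [cK AK].
rewrite -[K _]inE; apply: (cK); rewrite inE.
  exact: (hx K (conj cK AK)).
exact: (hy K (conj cK AK)).
Qed.

Lemma sub_convex_hull A : A `<=` convex_hull A.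
Proof. by move=> x Ax K [_]; exact. Qed.

Lemma convex_hull_halfplane A (u v t : R) :
  (forall y, A y -> u * y 0 0 + v * y 0 1 < t) ->
  forall y, convex_hull A y -> u * y 0 0 + v * y 0 1 < t.
Proof.
move=> At y Ay.
apply: (Ay [set y : 'rV[R]_2 | u * y 0 0 + v * y 0 1 < t]); split => //.
apply/convex_setP => p q s /andP[s0 s1] /= hp hq; rewrite !mxE.
rewrite [X in X < _](_ : _ = s * (u * p 0 0 + v * p 0 1) +
  (1 - s) * (u * q 0 0 + v * q 0 1)); last by ring.
move: s0; rewrite le_eqVlt => /orP[/eqP<-|s0].
  by rewrite mul0r add0r subr0 mul1r.
rewrite [ltRHS](_ : _ = s * t + (1 - s) * t); last by ring.
by rewrite ltr_leD// ?ltr_pM2l// ler_wpM2l ?subr_ge0// ltW.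
Qed.

Lemma diskE c (rho : R) x :
  disk c rho x <-> (x 0 0 - c 0 0) ^+ 2 + (x 0 1 - c 0 1) ^+ 2 <= rho ^+ 2.
Proof.
rewrite /disk/= !big_ord_recl big_ord0 addr0.
by rewrite (_ : lift ord0 ord0 = 1)//; exact/val_inj.
Qed.

Definition mkpoint (a b : R) : 'rV[R]_2 := \row_j (if j == 0 then a else b).

Lemma mkpoint0 a b : mkpoint a b 0 0 = a. Proof. by rewrite mxE. Qed.
Lemma mkpoint1 a b : mkpoint a b 0 1 = b. Proof. by rewrite mxE. Qed.

(** The support function of the set is at least that of any disk in the hull:
    otherwise the set, hence its hull, would miss a point of the disk. *)
Lemma disk_support A c (rho u v : R) : disk c rho `<=` convex_hull A ->
  0 < u ^+ 2 + v ^+ 2 -> exists2 a, A a &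
  u * c 0 0 + v * c 0 1 + rho * Num.sqrt (u ^+ 2 + v ^+ 2) <= u * a 0 0 + v * a 0 1.
Proof.
move=> cA uv; apply: contrapT => noa.
set n := Num.sqrt (u ^+ 2 + v ^+ 2).
have n0 : 0 < n by rewrite sqrtr_gt0.
have n2 : n ^+ 2 = u ^+ 2 + v ^+ 2 by rewrite sqr_sqrtr// ltW.
pose y := mkpoint (c 0 0 + rho / n * u) (c 0 1 + rho / n * v).
have /cA : disk c rho y.
  apply/diskE; rewrite mkpoint0 mkpoint1.
  have -> : (c 0 0 + rho / n * u - c 0 0) ^+ 2 + (c 0 1 + rho / n * v - c 0 1) ^+ 2 =
     (rho / n) ^+ 2 * (u ^+ 2 + v ^+ 2) by ring.
  by rewrite -n2 -exprMn divfK// gt_eqF.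
move/(@convex_hull_halfplane A u v (u * c 0 0 + v * c 0 1 + rho * n)).
rewrite mkpoint0 mkpoint1.
have -> : u * (c 0 0 + rho / n * u) + v * (c 0 1 + rho / n * v) =
    u * c 0 0 + v * c 0 1 + rho / n * (u ^+ 2 + v ^+ 2) by ring.
rewrite -n2 expr2 mulrA divfK ?gt_eqF// ltxx => h.
suff: false by []; apply: h => a Aa; rewrite ltNge; apply/negP => h.
by apply: noa; exists a.
Qed.

(** The support functions in the two directions of the first axis. *)
Lemma disk_width A c (rho lo hi : R) : 0 <= rho -> in_strip A lo hi ->
  disk c rho `<=` convex_hull A -> rho <= (hi - lo) / 2.
Proof.
move=> rho0 Alh cA.
have [|a Aa] := @disk_support A c rho 1 0 cA.
  by rewrite expr1n expr0n addr0.
rewrite expr1n expr0n addr0 sqrtr1 !mul1r !mul0r !addr0 mulr1 => ha.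
have [|b Ab] := @disk_support A c rho (-1) 0 cA.
  by rewrite sqrrN expr1n expr0n addr0.
rewrite sqrrN expr1n expr0n addr0 sqrtr1 !mulN1r !mul0r !addr0 mulr1 => hb.
have /andP[_ ?] := Alh _ Aa; have /andP[? _] := Alh _ Ab.
by rewrite ler_pdivlMr//; lra.
Qed.

Section bounded.
Variables (A : set 'rV[R]_2) (lo hi : R).
Hypotheses (A0 : A !=set0) (Alh : in_strip A lo hi).

Let radii := [set rho | 0 <= rho /\ exists c, disk c rho `<=` convex_hull A].

Let radii_nonempty : radii 0.
Proof.
split => //; have [a Aa] := A0; exists a => x /diskE.
rewrite expr0n/= => h.
have {}h : (x 0 0 - a 0 0) ^+ 2 + (x 0 1 - a 0 1) ^+ 2 == 0.
  by rewrite eq_le h addr_ge0// sqr_ge0.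
move: h; rewrite paddr_eq0 ?sqr_ge0// !sqrf_eq0 !subr_eq0 => /andP[/eqP h0 /eqP h1].
rewrite (_ : x = a); first exact: sub_convex_hull.
apply/rowP => j; case: j => [[|[|//]] hj].
  by rewrite (_ : Ordinal hj = 0)//; exact/val_inj.
by rewrite (_ : Ordinal hj = 1)//; exact/val_inj.
Qed.

Let radii_sup : has_sup radii.
Proof.
split; first by exists 0.
by exists ((hi - lo) / 2) => rho [rho0 [c]]; exact: disk_width.
Qed.

Lemma inradius_ge c rho : 0 <= rho -> disk c rho `<=` convex_hull A ->
  rho <= inradius (convex_hull A).
Proof.
by move=> rho0 cA; apply: (sup_upper_bound radii_sup); split => //; exists c.
Qed.

Lemma inradius_ge0 : 0 <= inradius (convex_hull A).
Proof. exact: (sup_upper_bound radii_sup). Qed.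

Lemma inradius_le (k : R) : (forall c rho, 0 <= rho ->
  disk c rho `<=` convex_hull A -> rho <= k) -> inradius (convex_hull A) <= k.
Proof.
move=> h; apply: sup_le_ub; first by exists 0.
by move=> rho [rho0 [c]]; exact: h.
Qed.

Lemma inradius_width : inradius (convex_hull A) <= (hi - lo) / 2.
Proof. by apply: inradius_le => c rho rho0; exact: disk_width. Qed.

End bounded.

(** A disk of radius rho in the hull of A', with center c, gives a disk of
    radius (rho - delta) / lambda in the hull of A: a line separating a point
    of the latter from A would keep A' away from the former. *)
Lemma inradius_dilation A A' (lambda delta lo hi : R) :
  A !=set0 -> A' !=set0 -> in_strip A lo hi ->
  0 < lambda -> 0 <= delta ->
  (forall a', A' a' -> exists2 a, A a &
    (a' 0 0 - lambda * a 0 0) ^+ 2 + (a' 0 1 - lambda * a 0 1) ^+ 2 <= delta ^+ 2) ->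
  inradius (convex_hull A') <= lambda * inradius (convex_hull A) + delta.
Proof.
move=> A0 A'0 Alh l0 d0 AA'; apply: (inradius_le A'0) => c rho rho0 cA'.
have r0 := inradius_ge0 A0 Alh.
have [rd|dr] := leP rho delta.
  by rewrite (le_trans rd)// lerDr mulr_ge0// ltW.
rewrite -lerBlDr -ler_pdivrMl//; apply/ler_addgt0Pr => e e0.
have [{}rd|{}dr] := leP ((rho - delta) / lambda) e.
  by rewrite mulrC (le_trans rd)// lerDr.
rewrite -lerBlDr; set rho' := _ - e.
have rho'0 : 0 < rho' by rewrite subr_gt0 mulrC.
apply: (@inradius_ge _ _ _ A0 Alh (lambda^-1 *: c)); first exact: ltW.
move=> x /diskE xd; apply: contrapT => xA.
have [u [v [uv sep]]] := convex_separation (@convex_hull_convex A) xA.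
have [a' A'a' ha'] := disk_support cA' uv.
have [a Aa ha] := AA' _ A'a'.
have {sep} := sep _ (sub_convex_hull Aa).
move: xd; rewrite !mxE; set n := Num.sqrt _ in ha' *.
have n0 : 0 < n by rewrite sqrtr_gt0.
have n2 : n ^+ 2 = u ^+ 2 + v ^+ 2 by rewrite sqr_sqrtr// ltW.
have cs (p q r : R) : 0 <= r -> p ^+ 2 + q ^+ 2 <= r ^+ 2 -> u * p + v * q <= r * n.
  move=> r0' pq; rewrite leNgt; apply/negP => h.
  have : (r * n) ^+ 2 < (u * p + v * q) ^+ 2.
    by rewrite ltr_sqr ?nnegrE ?mulr_ge0// ltW//(le_lt_trans _ h)// mulr_ge0// ltW.
  have : (p ^+ 2 + q ^+ 2) * n ^+ 2 <= r ^+ 2 * n ^+ 2 by rewrite ler_wpM2r ?sqr_ge0.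
  rewrite exprMn n2; have := sqr_ge0 (u * q - v * p); lra.
move=> /cs -/(_ (ltW rho'0)) hx.
move: ha => /cs -/(_ d0) ha sep.
have : lambda * rho' * n < (rho - delta) * n.
  rewrite ltr_pM2r// /rho' mulrBr mulrA divff ?gt_eqF// mul1r.
  by rewrite ltrBlDr ltrDl mulr_gt0.
have : lambda * (u * (x 0 0 - lambda^-1 * c 0 0) + v * (x 0 1 - lambda^-1 * c 0 1)) <=
   lambda * (rho' * n) by rewrite ler_pM2l.
have -> : lambda * (u * (x 0 0 - lambda^-1 * c 0 0) + v * (x 0 1 - lambda^-1 * c 0 1))
  = lambda * (u * x 0 0 + v * x 0 1) - (u * c 0 0 + v * c 0 1).
  by field; rewrite gt_eqF.
have : lambda * (u * a 0 0 + v * a 0 1) <= lambda * (u * x 0 0 + v * x 0 1).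
  by rewrite ler_pM2l.
lra.
Qed.

Lemma inradius_mono A A' (lo hi : R) : A !=set0 -> in_strip A' lo hi -> A `<=` A' ->
  inradius (convex_hull A) <= inradius (convex_hull A').
Proof.
move=> A0 A'lh AA'.
have A'0 : A' !=set0 by have [a Aa] := A0; exists a; exact: AA'.
rewrite -[leRHS]addr0 -[X in X + 0]mul1r.
apply: (inradius_dilation A'0 A0 A'lh) => // a Aa; exists a; first exact: AA'.
by rewrite !mul1r !subrr expr0n addr0.
Qed.

Lemma convex_hull3 A p q r (a b c : R) : A p -> A q -> A r ->
  0 <= a -> 0 <= b -> 0 <= c -> a + b + c = 1 ->
  convex_hull A (a *: p + b *: q + c *: r).
Proof.
move=> Ap Aq Ar a0 b0 c0 abc.
have /convex_setP cK := @convex_hull_convex A.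
have [c1|c1] := eqVneq c 1.
  have [-> ->] : a = 0 /\ b = 0 by split; lra.
  by rewrite c1 !scale0r !add0r scale1r; exact: sub_convex_hull.
have ab0 : 1 - c != 0 by rewrite subr_eq0 eq_sym.
have ab1 : 0 < 1 - c by rewrite lt_neqAle eq_sym ab0 /=; lra.
have h : convex_hull A ((a / (1 - c)) *: p + (1 - a / (1 - c)) *: q).
  apply: cK; try exact: sub_convex_hull.
  apply/andP; split; first by rewrite divr_ge0// ltW.
  by rewrite ler_pdivrMr//; lra.
have -> : a *: p + b *: q + c *: r =
  (1 - c) *: ((a / (1 - c)) *: p + (1 - a / (1 - c)) *: q) + (1 - (1 - c)) *: r.
  apply/rowP => j; rewrite !mxE (_ : b = 1 - c - a); last by lra.
  by field.
apply: cK => //; last exact: sub_convex_hull.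
by apply/andP; split; lra.
Qed.

(** The disk with the given radius around the incenter. Its weights are upper
    bounds of the side lengths instead of the lengths themselves. *)
Lemma inradius_triangle A p q r (lo hi s1 s2 s3 : R) : in_strip A lo hi ->
  A p -> A q -> A r -> 0 < s1 -> 0 < s2 -> 0 < s3 ->
  (q 0 0 - p 0 0) ^+ 2 + (q 0 1 - p 0 1) ^+ 2 <= s1 ^+ 2 ->
  (r 0 0 - q 0 0) ^+ 2 + (r 0 1 - q 0 1) ^+ 2 <= s2 ^+ 2 ->
  (p 0 0 - r 0 0) ^+ 2 + (p 0 1 - r 0 1) ^+ 2 <= s3 ^+ 2 ->
  `| (q 0 0 - p 0 0) * (r 0 1 - q 0 1) - (q 0 1 - p 0 1) * (r 0 0 - q 0 0) | /
     (s1 + s2 + s3) <= inradius (convex_hull A).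
Proof.
move=> Alh; wlog D0 : p q r s1 s2 s3 / 0 <=
    (q 0 0 - p 0 0) * (r 0 1 - q 0 1) - (q 0 1 - p 0 1) * (r 0 0 - q 0 0).
  move=> hw Ap Aq Ar s10 s20 s30 h1 h2 h3.
  have [D0|D0] := leP 0
    ((q 0 0 - p 0 0) * (r 0 1 - q 0 1) - (q 0 1 - p 0 1) * (r 0 0 - q 0 0)).
    exact: hw.
  rewrite (_ : _ - _ = - ((q 0 0 - r 0 0) * (p 0 1 - q 0 1) -
    (q 0 1 - r 0 1) * (p 0 0 - q 0 0))); last by ring.
  rewrite normrN [s1 + s2]addrC; apply: hw => //; lra.
move=> Ap Aq Ar s10 s20 s30 h1 h2 h3.
have A0 : A !=set0 by exists p.
rewrite ger0_norm//; set D := (X in X / _); set S := s1 + s2 + s3.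
have S0 : 0 < S by rewrite !addr_gt0.
move: D0; rewrite le_eqVlt => /orP[/eqP D0|D0].
  by rewrite /D -D0 mul0r; exact: inradius_ge0 Alh.
set rho := D / S; have rho0 : 0 < rho by rewrite divr_gt0.
pose c := (s2 / S) *: p + (s3 / S) *: q + (s1 / S) *: r.
apply: (inradius_ge A0 Alh (c := c)); first exact: ltW.
move=> x /diskE xd.
have cs (a b d s : R) : 0 < s -> a ^+ 2 + b ^+ 2 <= s ^+ 2 -> d = s * rho ->
    0 <= d + (a * (x 0 1 - c 0 1) - b * (x 0 0 - c 0 0)).
  move=> s0 ab ->; rewrite leNgt; apply/negP => h.
  move: h xd rho0; move: (x 0 1 - _) (x 0 0 - _) rho => X Y rho' h xd rho0.
  have : (s * rho') ^+ 2 < (a * X - b * Y) ^+ 2.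
    have sr0 : 0 < s * rho' by rewrite mulr_gt0.
    by rewrite -[ltRHS]sqrrN ltr_sqr ?nnegrE; lra.
  have : (a ^+ 2 + b ^+ 2) * (Y ^+ 2 + X ^+ 2) <= s ^+ 2 * rho' ^+ 2.
    by apply: ler_pM => //; rewrite addr_ge0// sqr_ge0.
  rewrite exprMn; have := sqr_ge0 (a * Y + b * X); lra.
have D0' : D != 0 by rewrite gt_eqF.
have S0' : S != 0 by rewrite gt_eqF.
pose w3 := ((q 0 0 - p 0 0) * (x 0 1 - p 0 1) - (q 0 1 - p 0 1) * (x 0 0 - p 0 0)) / D.
pose w1 := ((r 0 0 - q 0 0) * (x 0 1 - q 0 1) - (r 0 1 - q 0 1) * (x 0 0 - q 0 0)) / D.
pose w2 := ((p 0 0 - r 0 0) * (x 0 1 - r 0 1) - (p 0 1 - r 0 1) * (x 0 0 - r 0 0)) / D.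
have w1E : w1 * D = (r 0 0 - q 0 0) * (x 0 1 - q 0 1) - (r 0 1 - q 0 1) * (x 0 0 - q 0 0).
  by rewrite divfK.
have w2E : w2 * D = (p 0 0 - r 0 0) * (x 0 1 - r 0 1) - (p 0 1 - r 0 1) * (x 0 0 - r 0 0).
  by rewrite divfK.
have w3E : w3 * D = (q 0 0 - p 0 0) * (x 0 1 - p 0 1) - (q 0 1 - p 0 1) * (x 0 0 - p 0 0).
  by rewrite divfK.
have comb (a b d : R) : (w1 * a + w2 * b + w3 * d) * D =
  w1 * D * a + w2 * D * b + w3 * D * d by ring.
have -> : x = w1 *: p + w2 *: q + w3 *: r.
  apply/rowP => j; case: j => [[|[|//]] hj].
    rewrite (_ : Ordinal hj = 0); last exact/val_inj.
    by rewrite !mxE; apply: (mulIf D0'); rewrite comb w1E w2E w3E /D; ring.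
  rewrite (_ : Ordinal hj = 1); last exact/val_inj.
  by rewrite !mxE; apply: (mulIf D0'); rewrite comb w1E w2E w3E /D; ring.
have cE0 : c 0 0 = (s2 * p 0 0 + s3 * q 0 0 + s1 * r 0 0) / S.
  by rewrite !mxE; field.
have cE1 : c 0 1 = (s2 * p 0 1 + s3 * q 0 1 + s1 * r 0 1) / S.
  by rewrite !mxE; field.
apply: convex_hull3 => //.
- rewrite divr_ge0// ?(ltW D0)//.
  rewrite [leRHS](_ : _ = ((r 0 0 - q 0 0) * (c 0 1 - q 0 1) - (r 0 1 - q 0 1) * (c 0 0 - q 0 0)) + ((r 0 0 - q 0 0) * (x 0 1 - c 0 1) - (r 0 1 - q 0 1) * (x 0 0 - c 0 0))); last by ring.
  apply: (cs _ _ _ s2) => //; rewrite cE0 cE1 /rho /D.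
  by rewrite /S; field; rewrite gt_eqF.
- rewrite divr_ge0// ?(ltW D0)//.
  rewrite [leRHS](_ : _ = ((p 0 0 - r 0 0) * (c 0 1 - r 0 1) - (p 0 1 - r 0 1) * (c 0 0 - r 0 0)) + ((p 0 0 - r 0 0) * (x 0 1 - c 0 1) - (p 0 1 - r 0 1) * (x 0 0 - c 0 0))); last by ring.
  apply: (cs _ _ _ s3) => //; rewrite cE0 cE1 /rho /D.
  by rewrite /S; field; rewrite gt_eqF.
- rewrite divr_ge0// ?(ltW D0)//.
  rewrite [leRHS](_ : _ = ((q 0 0 - p 0 0) * (c 0 1 - p 0 1) - (q 0 1 - p 0 1) * (c 0 0 - p 0 0)) + ((q 0 0 - p 0 0) * (x 0 1 - c 0 1) - (q 0 1 - p 0 1) * (x 0 0 - c 0 0))); last by ring.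
  apply: (cs _ _ _ s1) => //; rewrite cE0 cE1 /rho /D.
  by rewrite /S; field; rewrite gt_eqF.
- apply: (mulIf D0'); rewrite mul1r !mulrDl w1E w2E w3E /D; ring.
Qed.

End inradius.

(** * Integrals against normal laws *)
(** The pushforward as a bundled measure, so that the measurability of the map
    need not be inferred. *)
Definition image_measure d1 d2 (T1 : measurableType d1) (T2 : measurableType d2)
    (R : realType) (m : {measure set T1 -> \bar R}) (f : T1 -> T2)
    (mf : measurable_fun setT f) : {measure set T2 -> \bar R} :=
  measure_function_pushforward__canonical__measure_function_Measure m mf.

Lemma integral_image_measure d1 d2 (T1 : measurableType d1)
    (T2 : measurableType d2) (R : realType) (m : {measure set T1 -> \bar R})
    (f : T1 -> T2) (mf : measurable_fun setT f) (g : T2 -> \bar R) :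
  measurable_fun setT g -> (forall y, 0 <= g y)%E ->
  (\int[image_measure m mf]_y g y = \int[m]_x g (f x))%E.
Proof. by move=> mg g0; rewrite ge0_integral_pushforward. Qed.

Section gaussian_integrals.
Context (R : realType).
Local Notation mu := (@lebesgue_measure R).
Implicit Types (f : R -> \bar R) (m s : R).

(** The normal law is dominated by the Lebesgue measure, and its Radon-Nikodym
    derivative agrees almost everywhere with the density. *)
Lemma integral_normal_prob f m s : measurable_fun setT f ->
  (forall x, 0 <= f x)%E ->
  (\int[normal_prob m s]_x f x = \int[mu]_x (f x * (normal_pdf m s x)%:E))%E.
Proof.
move=> mf f0.
have dom := normal_prob_dominates m s.
rewrite -(Radon_Nikodym_SigmaFinite.change_of_variables dom)//.
set g := Radon_Nikodym_SigmaFinite.f _ _.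
have gi := Radon_Nikodym_SigmaFinite.f_integrable dom.
have g0 := Radon_Nikodym_SigmaFinite.f_ge0 dom.
apply: ge0_ae_eq_integral => //.
- by apply: emeasurable_funM => //; exact: measurable_int gi.
- by apply: emeasurable_funM => //; apply/measurable_EFinP; exact: measurable_normal_pdf.
- by move=> x _; rewrite mule_ge0.
- by move=> x _; rewrite mule_ge0// lee_fin normal_pdf_ge0.
apply: ae_eqe_mul2l; apply: integral_ae_eq => //.
- by apply/measurable_EFinP; exact: measurable_normal_pdf.
- by move=> A _ mA; rewrite -(Radon_Nikodym_SigmaFinite.f_integral dom).
Qed.

Lemma integral_affine f (a b : R) : 0 < a -> measurable_fun setT f ->
  (forall x, 0 <= f x)%E ->
  (\int[mu]_x f x = a%:E * \int[mu]_x f (a * x + b)%R)%E.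
Proof.
move=> a0 mf f0.
pose h : R -> measurableTypeR R := fun x => a * x + b.
have mh : measurable_fun setT h by apply: measurable_funD => //; exact: measurable_funM.
pose nu := mscale (NngNum (ltW a0)) (image_measure mu mh).
have nuE A : measurable A -> mu A = nu A.
  apply: lebesgue_measure_unique => /= _ [[u v]] _ <-.
  rewrite /nu /mscale/= /pushforward.
  have -> : h @^-1` `]u, v] = `](u - b) / a, (v - b) / a]%classic.
    apply/seteqP; split => x; rewrite /h /= !in_itv/= => /andP[xu xv]; apply/andP; split.
    - by rewrite ltr_pdivrMr// mulrC; lra.
    - by rewrite ler_pdivlMr// mulrC; lra.
    - by move: xu; rewrite ltr_pdivrMr// mulrC; lra.
    - by move: xv; rewrite ler_pdivlMr// mulrC; lra.
  rewrite !lebesgue_measure_itv/= !lte_fin ltr_pM2r ?invr_gt0// ltrD2r.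
  case: ifPn => _; last by rewrite mule0.
  by rewrite -!EFinB -EFinM; congr EFin; field; rewrite gt_eqF.
rewrite (eq_measure_integral nu) => [|A mA _]; last exact: nuE.
rewrite ge0_integral_mscale//=; congr (_ * _)%E.
by rewrite integral_image_measure.
Qed.

Lemma normal_pdf0E s x : s != 0 ->
  normal_pdf 0 s x = normal_peak s * expR (- (x ^+ 2 / (s ^+ 2 *+ 2))).
Proof. by move=> s0; rewrite normal_pdfE// /normal_fun subr0 mulNr. Qed.

Lemma integral_normalN f s : s != 0 -> measurable_fun setT f ->
  (forall x, 0 <= f x)%E ->
  (\int[normal_prob 0 s]_x f (- x)%R = \int[normal_prob 0 s]_x f x)%E.
Proof.
move=> s0 mf f0.
have mfN : measurable_fun setT (fun x : R => f (- x)%R) by exact: measurableT_comp.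
rewrite !integral_normal_prob//.
pose g x := (f x * (normal_pdf 0 s x)%:E)%E.
have mg : measurable_fun setT g.
  by apply: emeasurable_funM => //; apply/measurable_EFinP; exact: measurable_normal_pdf.
have g0 x : (0 <= g x)%E by rewrite mule_ge0// lee_fin normal_pdf_ge0.
transitivity (\int[mu]_x g (- x)%R)%E.
  by apply: eq_integral => x _; rewrite /g !normal_pdf0E// sqrrN.
have mN : measurable_fun setT (-%R : R -> measurableTypeR R) by [].
transitivity (\int[image_measure (mu : {measure set (measurableTypeR R) -> \bar R}) mN]_x g x)%E.
  by rewrite integral_image_measure.
by apply: eq_measure_integral => //= A mA _; exact: lebesgue_measureN.
Qed.

(** The density, with respect to the normal law of standard deviation s, of
    that law scaled by lambda. *)
Definition scaling_density (s lambda y : R) : R :=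
  lambda^-1 * expR (- (y ^+ 2 / (s ^+ 2 *+ 2) * (lambda^-2 - 1))).

Lemma scaling_density_ge0 s lambda y : 0 < lambda -> 0 <= scaling_density s lambda y.
Proof. by move=> l0; rewrite mulr_ge0 ?expR_ge0// invr_ge0 ltW. Qed.

Lemma measurable_scaling_density s lambda :
  measurable_fun setT (scaling_density s lambda).
Proof.
apply: measurable_funM => //; apply: measurableT_comp => //.
apply: measurableT_comp => //; apply: measurable_funM => //.
by apply: measurable_funM => //; exact: measurable_funX.
Qed.

Lemma integral_normal_scale f s lambda : s != 0 -> 0 < lambda ->
  measurable_fun setT f -> (forall x, 0 <= f x)%E ->
  (\int[normal_prob 0 s]_x f (lambda * x)%R =
   \int[normal_prob 0 s]_x (f x * (scaling_density s lambda x)%:E))%E.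
Proof.
move=> s0 l0 mf f0.
have mfs : measurable_fun setT (fun x : R => f (lambda * x)%R).
  by apply: measurableT_comp => //; exact: measurable_funM.
have d0 x : (0 <= (scaling_density s lambda x)%:E)%E.
  by rewrite lee_fin scaling_density_ge0.
have md : measurable_fun setT (fun x : R => (scaling_density s lambda x)%:E).
  by apply/measurable_EFinP; exact: measurable_scaling_density.
have mp : measurable_fun setT (fun x : R => (normal_pdf 0 s x)%:E).
  by apply/measurable_EFinP; exact: measurable_normal_pdf.
have p0 x : (0 <= (normal_pdf 0 s x)%:E)%E by rewrite lee_fin normal_pdf_ge0.
rewrite !integral_normal_prob//; last 2 first.
- exact: emeasurable_funM.
- by move=> x; rewrite mule_ge0.
rewrite [RHS](integral_affine 0 l0)//; last 2 first.
- by apply: emeasurable_funM => //; exact: emeasurable_funM.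
- by move=> x; rewrite !mule_ge0.
rewrite -ge0_integralZl//; last 3 first.
- apply: emeasurable_funM.
    apply: emeasurable_funM.
      by under eq_fun do rewrite addr0.
    apply/measurable_EFinP; apply: measurableT_comp; first exact: measurable_scaling_density.
    by under eq_fun do rewrite addr0; exact: measurable_funM.
  apply/measurable_EFinP; apply: measurableT_comp; first exact: measurable_normal_pdf.
  by under eq_fun do rewrite addr0; exact: measurable_funM.
- by move=> x _; rewrite !mule_ge0.
- by rewrite lee_fin ltW.
apply: eq_integral => x _; rewrite addr0 !normal_pdf0E// -muleA [RHS]muleCA.
congr (_ * _)%E; rewrite -!EFinM; congr EFin.
rewrite /scaling_density mulrA mulVKf ?gt_eqF//; last first.
rewrite mulrCA; congr (_ * _); rewrite -expRD; congr expR.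
by field; rewrite s0 gt_eqF.
Qed.

Let bpdf s x := (normal_pdf 0 s x)%:E.

(** The product of the two densities only depends on x ^ 2 + y ^ 2. One variable
    is changed at a time: first y, with u = c x + t y as the new variable, and
    then x. *)
Lemma integral_normal_rotation (G : R -> R -> \bar R) s (c t : R) : s != 0 ->
  0 < t -> c ^+ 2 + t ^+ 2 = 1 ->
  measurable_fun setT (fun z : R * R => G z.1 z.2) -> (forall x y, 0 <= G x y)%E ->
  (\int[normal_prob 0 s]_x \int[normal_prob 0 s]_y G (c * x + t * y)%R (t * x - c * y)%R
  = \int[normal_prob 0 s]_x \int[normal_prob 0 s]_y G x y)%E.
Proof.
move=> s0 t0 ct mG G0.
have mp : measurable_fun setT (bpdf s).
  by apply/measurable_EFinP; exact: measurable_normal_pdf.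
have p0 x : (0 <= bpdf s x)%E by rewrite lee_fin normal_pdf_ge0.
(* both sides as iterated Lebesgue integrals against the two densities *)
have step (H : R -> R -> \bar R) :
    measurable_fun setT (fun z : R * R => H z.1 z.2) -> (forall x y, 0 <= H x y)%E ->
    (\int[normal_prob 0 s]_x \int[normal_prob 0 s]_y H x y =
     \int[mu]_x \int[mu]_y (H x y * bpdf s y * bpdf s x))%E.
  move=> mH H0.
  have mHx x : measurable_fun setT (H x).
    exact: (measurableT_comp mH (pair1_measurable x)).
  have mHp : measurable_fun setT (fun z : R * R => H z.1 z.2 * bpdf s z.2)%E.
    by apply: emeasurable_funM => //; exact: measurableT_comp.
  rewrite integral_normal_prob; last 2 first.
  - under eq_fun do rewrite integral_normal_prob//.
    apply: (measurable_fun_fubini_tonelli_F (m2 := mu) (fun z : R * R => H z.1 z.2 * bpdf s z.2)%E) => //.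
    by move=> z; rewrite mule_ge0.
  - by move=> x; exact: integral_ge0.
  apply: eq_integral => x _.
  rewrite (integral_normal_prob 0 s (mHx x) (H0 x)) -ge0_integralZr//.
  + by apply: emeasurable_funM; [exact: mHx|exact: mp].
  + by move=> y _; apply: mule_ge0; [exact: H0|exact: p0].
  + exact: (p0 x).
pose rot (z : R * R) := (c * z.1 + t * z.2, t * z.1 - c * z.2).
have mrot : measurable_fun setT rot.
  apply: measurable_fun_pair.
    by apply: measurable_funD; apply: measurable_funM.
  by apply: measurable_funB; apply: measurable_funM.
have mGrot : measurable_fun setT (fun z : R * R => G (c * z.1 + t * z.2) (t * z.1 - c * z.2)).
  exact: (measurableT_comp mG mrot).
rewrite (step (fun x y => G (c * x + t * y) (t * x - c * y)) mGrot)//.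
rewrite (step G mG G0).
have t0' : t != 0 by rewrite gt_eqF.
have pp x y : (bpdf s y * bpdf s x = (normal_peak s ^+ 2 *
    expR (- ((x ^+ 2 + y ^+ 2) / (s ^+ 2 *+ 2))))%:E)%E.
  rewrite /bpdf !normal_pdf0E// -EFinM; congr EFin.
  by rewrite mulrACA -expRD; congr (_ * expR _); ring.
have sq (x y : R) : (c * x + t * y) ^+ 2 + (t * x - c * y) ^+ 2 = x ^+ 2 + y ^+ 2.
  rewrite -[RHS]mul1r -ct; ring.
pose K (x u : R) := (G u ((x - c * u) / t)%R *
  ((normal_peak s ^+ 2 * expR (- ((u ^+ 2 + ((x - c * u) / t) ^+ 2) / (s ^+ 2 *+ 2)))) / t)%R%:E)%E.
have K0 x u : (0 <= K x u)%E.
  by rewrite mule_ge0// lee_fin !mulr_ge0 ?expR_ge0 ?invr_ge0 ?(ltW t0)// sqr_ge0.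
have msnd : measurable_fun setT (fun z : R * R => (z.1 - c * z.2) / t).
  by apply: measurable_funM => //; apply: measurable_funB => //; exact: measurable_funM.
have mK : measurable_fun setT (fun z : R * R => K z.1 z.2).
  apply: emeasurable_funM.
    exact: (measurableT_comp mG (measurable_fun_pair measurable_snd msnd)).
  apply/measurable_EFinP; do 2 (apply: measurable_funM => //).
  apply: measurableT_comp => //; apply: measurableT_comp => //; apply: measurable_funM => //.
  by apply: measurable_funD; exact: measurable_funX.
transitivity (\int[mu]_x \int[mu]_u K x u)%E.
  apply: eq_integral => x _; rewrite [RHS](integral_affine (c * x) t0)//; last first.
    exact: (measurableT_comp mK (pair1_measurable x)).
  have mKa : measurable_fun setT (fun y : R => K x (t * y + c * x)).
    apply: (measurableT_comp mK (g := fun y : R => (x, t * y + c * x))).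
    by apply: measurable_fun_pair => //; apply: measurable_funD => //; exact: measurable_funM.
  rewrite -ge0_integralZl//; last by rewrite lee_fin ltW.
  apply: eq_integral => y _; rewrite /K -muleA pp muleCA [(t * y + _)%R]addrC.
  have -> : (x - c * (c * x + t * y)) / t = t * x - c * y.
    have t2 : t ^+ 2 = 1 - c ^+ 2 by rewrite -ct addrAC subrr add0r.
    apply: (mulIf t0'); rewrite divfK//.
    by rewrite [RHS](_ : _ = t ^+ 2 * x - c * t * y); [rewrite t2; ring|ring].
  congr (_ * _)%E; rewrite -EFinM; congr EFin.
  by rewrite sq [RHS]mulrC divfK.
transitivity (\int[mu]_u \int[mu]_x K x u)%E.
  by apply: (fubini_tonelli (m1 := mu) (m2 := mu) (fun z : R * R => K z.1 z.2)) => // z; exact: K0.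
apply: eq_integral => u _ /=.
rewrite (integral_affine (c * u) t0)//; last first.
  exact: (measurableT_comp mK (pair2_measurable u)).
have mKa : measurable_fun setT (fun y : R => K (t * y + c * u) u).
  apply: (measurableT_comp mK (g := fun y : R => (t * y + c * u, u))).
  by apply: measurable_fun_pair => //; apply: measurable_funD => //; exact: measurable_funM.
rewrite -ge0_integralZl//; last by rewrite lee_fin ltW.
apply: eq_integral => y _; rewrite /K -muleA pp muleCA.
have -> : (t * y + c * u - c * u) / t = y by field.
congr (_ * _)%E; rewrite -EFinM; congr EFin.
by rewrite [LHS]mulrC divfK.
Qed.

End gaussian_integrals.

(** * Measures on sequences *)
Section sequence_space.
Context (R : realType).

Definition coordinate_system : set (set (nat -> R)) :=
  \bigcup_i preimage_set_system setT (fun x : nat -> R => x i) measurable.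

Definition seqR := g_sigma_algebraType coordinate_system.
HB.instance Definition _ := Measurable.on seqR.

Lemma measurable_coord i : measurable_fun setT (fun x : seqR => x i).
Proof.
move=> _ A mA; rewrite setTI; apply: sub_sigma_algebra.
by exists i => //; exists A => //; rewrite setTI.
Qed.

Lemma measurable_seqP d (T : measurableType d) (f : T -> seqR) :
  (forall i, measurable_fun setT (fun w => f w i)) -> measurable_fun setT f.
Proof.
move=> mf; apply: (@measurability _ _ _ _ _ f coordinate_system) => //.
move=> _ [_ [i _ [A mA <-]] <-]; rewrite !setTI -comp_preimage.
by have := mf i measurableT A mA; rewrite setTI.
Qed.

Definition box (A : nat -> set R) : set seqR := [set x | forall i, A i (x i)].

Lemma measurable_box A : (forall i, measurable (A i)) -> measurable (box A).
Proof.
move=> mA; rewrite (_ : box A = \bigcap_i ((fun x : seqR => x i) @^-1` (A i))).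
  apply: bigcapT_measurable => i; rewrite -[X in measurable X]setTI.
  exact: measurable_coord.
by apply/seteqP; split => [x xA i _|x xA i]; [exact: xA|exact: (xA i)].
Qed.

Lemma seq_measure_unique (m1 m2 : {measure set seqR -> \bar R}) :
  (m1 setT < +oo)%E ->
  (forall A, (forall i, measurable (A i)) -> m1 (box A) = m2 (box A)) ->
  forall B, measurable B -> m1 B = m2 B.
Proof.
move=> m1T m12 B mB.
pose G := [set box A | A in [set A : nat -> set R | forall i, measurable (A i)]].
have boxT : box (fun=> setT) = setT by apply/seteqP; split.
apply: (measure_unique G (fun=> setT)) => //.
- apply/seteqP; split.
    apply: smallest_sub; first exact: smallest_sigma_algebra.
    move=> _ [i _ [A mA <-]]; apply: sub_sigma_algebra.
    exists (fun j => if j == i then A else setT).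
      by move=> j /=; case: ifP.
    apply/seteqP; split => x /=.
      by move=> /(_ i); rewrite eqxx.
    by move=> [_ Axi] j; case: eqVneq => [->|].
  apply: smallest_sub; first exact: sigma_algebra_measurable.
  by move=> _ [A mA <-]; exact: measurable_box.
- move=> _ _ [A mA <-] [A' mA' <-]; exists (fun i => A i `&` A' i).
    by move=> i /=; exact: measurableI.
  apply/seteqP; split => x /=; first by move=> h; split => i; case: (h i).
  by move=> [h h'] i; split.
- by move=> _; exists (fun=> setT).
- by rewrite bigcup_const//; exists 0%N.
- by move=> _ [A mA <-]; exact: m12.
Qed.

Definition cyl (N : nat) (A : nat -> set R) : set seqR :=
  [set x | forall i, (i < N)%N -> A i (x i)].

Lemma cylE N A : cyl N A = box (fun i => if (i < N)%N then A i else setT).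
Proof.
apply/seteqP; split => x h i; first by case: ifP => // iN; exact: h.
by move=> iN; move: (h i); rewrite iN.
Qed.

Lemma measurable_cyl N A : (forall i, measurable (A i)) -> measurable (cyl N A).
Proof. by move=> mA; rewrite cylE; apply: measurable_box => i; case: ifP. Qed.

(** Vectors of any length are encoded as sequences that almost surely vanish
    from some index on; coordinates are then natural numbers, and blocks of
    coordinates need no dependent types. *)
Record iid_normal (N : nat) (s : R) (m : {measure set seqR -> \bar R}) : Prop := {
  iid_cyl : forall A, (forall i, measurable (A i)) ->
    m (cyl N A) = (\prod_(i < N) normal_prob 0%R s (A i))%E ;
  iid_tail : forall i, (N <= i)%N -> m [set x | x i != 0] = 0%E
}.

Lemma measurable_coord_neq0 i : measurable [set x : seqR | x i != 0].
Proof.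
rewrite (_ : mkset _ = (fun x : seqR => x i) @^-1` (~` [set 0])).
  by rewrite -[X in measurable X]setTI; apply: measurable_coord => //; exact: measurableC.
by apply/seteqP; split => x /= /eqP.
Qed.

(** Since the coordinates from N on vanish almost surely, a box is either
    negligible or, up to a null set, a condition on the first N coordinates. *)
Lemma cyl_measure_unique N (m1 m2 : {measure set seqR -> \bar R}) :
  (m1 setT < +oo)%E ->
  (forall A, (forall i, measurable (A i)) -> m1 (cyl N A) = m2 (cyl N A)) ->
  (forall i, (N <= i)%N -> m1 [set x | x i != 0] = 0%E) ->
  (forall i, (N <= i)%N -> m2 [set x | x i != 0] = 0%E) ->
  forall B, measurable B -> m1 B = m2 B.
Proof.
move=> m1T m12 t1 t2; apply: seq_measure_unique => // A mA.
have [A0|] := pselect (forall i, (N <= i)%N -> A i 0); last first.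
  move=> /existsNP[i /not_implyP[Ni Ai0]].
  have sub : box A `<=` [set x | x i != 0].
    by move=> x /(_ i) Axi /=; apply/eqP => xi0; apply: Ai0; rewrite -xi0.
  have z (m : {measure set seqR -> \bar R}) : m [set x | x i != 0] = 0%E -> m (box A) = 0%E.
    move=> m0; apply/eqP; rewrite -measure_le0 -m0.
    by apply: le_measure => //; rewrite inE; [exact: measurable_box|exact: measurable_coord_neq0].
  by rewrite !z ?t1 ?t2.
pose E i : set seqR := if (N <= i)%N then [set x : seqR | x i != 0] else set0.
have mE i : measurable (E i) by rewrite /E; case: ifP => // _; exact: measurable_coord_neq0.
pose D := \bigcup_i E i.
have mD : measurable D by exact: bigcupT_measurable.
have z (m : {measure set seqR -> \bar R}) :
    (forall i, (N <= i)%N -> m [set x | x i != 0] = 0%E) -> m (box A) = m (cyl N A).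
  move=> t; have mD0 : m D = 0%E.
    apply: (measure_negligible mD); apply: negligible_bigcup => i.
    by apply/negligibleP => //; rewrite /E; case: ifPn => [/t//|_]; rewrite measure0.
  apply/eqP; rewrite eq_le; apply/andP; split.
    apply: le_measure; rewrite ?inE; [exact: measurable_box|exact: measurable_cyl|].
    by move=> x h i _; exact: h.
  apply: (@le_trans _ _ (m (box A `|` D))).
    apply: le_measure; rewrite ?inE; first exact: measurable_cyl.
      by apply: measurableU => //; exact: measurable_box.
    move=> x xA; have [xD|xD] := pselect (D x); first by right.
    left => i; have [iN|Ni] := ltnP i N; first exact: xA.
    rewrite (_ : x i = 0); first exact: A0.
    by apply: contrapT => /eqP xi; apply: xD; exists i => //; rewrite /E Ni.
  have mbA := measurable_box mA.
  by apply: (le_trans (measureU2 _ mbA mD)); rewrite [X in (_ + X)%E](_ : _ = 0%E) ?adde0.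
by rewrite !z// m12.
Qed.

End sequence_space.

(** * Invariance of independent normal sequences *)
Section iid_invariance.
Context (R : realType) (N : nat) (s : R) (P : probability (seqR R) R).
Hypotheses (s0 : s != 0) (iidP : iid_normal N s P).
Implicit Types (F : seqR R -> \bar R) (x : seqR R).

Definition upd x (o : nat) (v : R) : seqR R := fun i => if i == o then v else x i.

Lemma measurable_upd d (T : measurableType d) (f : T -> seqR R) o (g : T -> R) :
  measurable_fun setT f -> measurable_fun setT g ->
  measurable_fun setT (fun w => upd (f w) o (g w)).
Proof.
move=> mf mg; apply: measurable_seqP => i; rewrite /upd.
by case: eqP => // _; exact: (measurableT_comp (measurable_coord i)).
Qed.

Lemma upd_same x o v : upd x o v o = v. Proof. by rewrite /upd eqxx. Qed.

Lemma upd_upd x o v w : upd (upd x o v) o w = upd x o w.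
Proof. by apply/funext => i; rewrite /upd; case: eqP. Qed.

Let updz o (z : seqR R * R) := upd z.1 o z.2.

Let measurable_updz o : measurable_fun setT (updz o).
Proof. by apply: measurable_upd. Qed.

Let totalP : (P setT < +oo)%E.
Proof. by rewrite (le_lt_trans (probability_le1 P measurableT))// ltry. Qed.

Let image_total (f : seqR R -> seqR R) (mf : measurable_fun setT f) :
  (image_measure P mf setT < +oo)%E.
Proof. by rewrite /image_measure/= /pushforward preimage_setT; exact: totalP. Qed.

(** Fubini: redrawing one coordinate independently does not change the law.
    This is how facts about one normal variable are applied to a coordinate. *)
Lemma integral_resample F o : (o < N)%N -> measurable_fun setT F ->
  (forall x, 0 <= F x)%E ->
  (\int[P]_x F x = \int[P]_x \int[normal_prob 0%R s]_v F (upd x o v))%E.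
Proof.
move=> oN mF F0.
pose PN := (P \x normal_prob 0%R s)%E.
pose nu := image_measure PN (measurable_updz o).
have nuE B : measurable B -> P B = nu B.
  apply: (@cyl_measure_unique _ N) => //.
  - move=> A mA; rewrite /nu/= /pushforward.
    have -> : updz o @^-1` cyl N A =
        cyl N (fun i => if i == o then setT else A i) `*` A o.
      apply/seteqP; split => [[x v] /= h|[x v] /= [h1 h2] i iN].
        split; last by have := h _ oN; rewrite /updz/= upd_same.
        by move=> i iN; case: eqP => // /eqP io; have := h _ iN; rewrite /updz/upd/= (negbTE io).
      rewrite /updz /upd/=; case: eqP => [->//|/eqP io].
      by have := h1 _ iN; rewrite (negbTE io).
    have mA' i : measurable (if i == o then setT else A i) by case: ifP.
    transitivity (P (cyl N (fun i => if i == o then setT else A i)) * normal_prob 0%R s (A o))%E;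
      last first.
      have mc := measurable_cyl N mA'.
      by apply/esym; apply: (product_measure1E P (normal_prob 0 s) mc (mA o)).
    rewrite (iid_cyl iidP)// (iid_cyl iidP)//.
    rewrite (bigD1 (Ordinal oN))//= [in RHS](bigD1 (Ordinal oN))//= eqxx probability_setT mul1e muleC.
    congr (_ * _)%E; apply: eq_bigr => i io.
    by rewrite ifN//; apply: contra io => /eqP io; apply/eqP/val_inj.
  - by move=> i /(iid_tail iidP).
  - move=> i Ni; rewrite /nu/= /pushforward.
    have -> : updz o @^-1` [set x | x i != 0] = [set x | x i != 0] `*` setT.
      apply/seteqP; split => [[x v]|[x v]] /=; rewrite /updz/upd/= ifN//.
      - by apply: contraTN oN => /eqP <-; rewrite -leqNgt.
      - by move=> [].
      - by apply: contraTN oN => /eqP <-; rewrite -leqNgt.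
    transitivity (P [set x | x i != 0%R] * normal_prob 0%R s setT)%E.
      by apply: product_measure1E => //; exact: measurable_coord_neq0.
    by rewrite (iid_tail iidP)// mul0e.
rewrite (eq_measure_integral nu) => [|A mA _]; last exact: nuE.
rewrite integral_image_measure//.
apply: (fubini_tonelli1 (m1 := P) (m2 := normal_prob 0 s) (fun z => F (updz o z))) => //.
exact: (measurableT_comp mF (measurable_updz o)).
Qed.

Definition preserves (f : seqR R -> seqR R) := measurable_fun setT f /\
  forall F, measurable_fun setT F -> (forall x, 0 <= F x)%E ->
    (\int[P]_x F (f x) = \int[P]_x F x)%E.

Lemma preserves_set f (B : set (seqR R)) : preserves f -> measurable B ->
  P (f @^-1` B) = P B.
Proof.
move=> [mf fP] mB.
have mfB : measurable (f @^-1` B) by rewrite -[X in measurable X]setTI; exact: mf.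
have ind C : measurable C -> (\int[P]_x (\1_C x)%:E)%E = P C.
  by move=> mC; rewrite integral_indic// setIT.
rewrite -(ind _ mB) -(ind _ mfB) -(fP (fun x => (\1_B x)%:E))//.
exact/measurable_EFinP.
Qed.

Lemma preserves_comp f g : preserves f -> preserves g -> preserves (f \o g).
Proof.
move=> [mf fP] [mg gP]; split; first exact: measurableT_comp.
move=> F mF F0; rewrite -(fP F)//; apply: (gP (F \o f)) => [|x]; last exact: F0.
exact: measurableT_comp.
Qed.

Lemma preserves_id : preserves id.
Proof. by split. Qed.

Definition flip (J : pred nat) x : seqR R := fun i => if J i then - x i else x i.

Lemma measurable_flip J : measurable_fun setT (flip J).
Proof.
apply: measurable_seqP => i; rewrite /flip; case: (J i) => //.
  by apply: measurableT_comp => //; exact: measurable_coord.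
exact: measurable_coord.
Qed.

Lemma normal_probN (A : set R) : measurable A ->
  normal_prob 0%R s (-%R @^-1` A) = normal_prob 0%R s A.
Proof.
move=> mA.
have mNA : measurable ((-%R : R -> R) @^-1` A).
  by rewrite -[X in measurable X]setTI; exact: measurable_funN.
have ind C : measurable C ->
    (\int[normal_prob 0 s]_y (\1_C y)%:E)%E = normal_prob 0 s C.
  by move=> mC; rewrite integral_indic// setIT.
rewrite -(ind _ mA) -(ind _ mNA) -(integral_normalN s0 (f := fun y => (\1_A y)%:E))//.
exact/measurable_EFinP.
Qed.

Lemma flip_preserves J : preserves (flip J).
Proof.
split; first exact: measurable_flip.
move=> F mF F0; rewrite -(integral_image_measure P (measurable_flip J))//.
apply: eq_measure_integral => B mB _.
apply: (@cyl_measure_unique _ N) => //.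
- move=> A mA; rewrite /= /pushforward (iid_cyl iidP)//.
  have -> : flip J @^-1` cyl N A = cyl N (fun i => if J i then -%R @^-1` A i else A i).
    by apply/seteqP; split => x h i iN; have := h i iN; rewrite /flip; case: (J i).
  have mA' i : measurable (if J i then -%R @^-1` A i else A i).
    case: ifP => // _; rewrite -[X in measurable X]setTI; exact: measurable_funN.
  rewrite (iid_cyl iidP)//; apply: eq_bigr => i _.
  by case: (J i) => //; rewrite normal_probN.
- move=> i Ni; rewrite /= /pushforward.
  rewrite (_ : _ @^-1` _ = [set x | x i != 0]); first exact: (iid_tail iidP).
  by apply/seteqP; split => x /=; rewrite /flip; case: (J i); rewrite ?oppr_eq0.
- by move=> i /(iid_tail iidP).
Qed.

Let measurable_inner F o : measurable_fun setT F -> (forall x, 0 <= F x)%E ->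
  measurable_fun setT (fun x => \int[normal_prob 0%R s]_v F (upd x o v))%E.
Proof.
move=> mF F0.
apply: (measurable_fun_fubini_tonelli_F (m2 := normal_prob 0%R s) (fun z => F (updz o z))) => //.
exact: (measurableT_comp mF (measurable_updz o)).
Qed.

Definition rotate (o j : nat) (c t : R) x : seqR R :=
  upd (upd x o (c * x o + t * x j)) j (t * x o - c * x j).

(** Redrawing both coordinates reduces this to a rotation of the plane. *)
Lemma rotate_preserves o j c t : (o < N)%N -> (j < N)%N -> o != j ->
  0 < t -> c ^+ 2 + t ^+ 2 = 1 -> preserves (rotate o j c t).
Proof.
move=> oN jN oj t0 ct.
have mrot : measurable_fun setT (rotate o j c t).
  apply: measurable_upd.
    apply: measurable_upd => //.
    by apply: measurable_funD; apply: measurable_funM => //; exact: measurable_coord.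
  by apply: measurable_funB; apply: measurable_funM => //; exact: measurable_coord.
split => // F mF F0.
have step G : measurable_fun setT G -> (forall x, 0 <= G x)%E ->
    (\int[P]_x G x = \int[P]_x \int[normal_prob 0%R s]_v
      \int[normal_prob 0%R s]_w G (upd (upd x o v) j w))%E.
  move=> mG G0; rewrite (integral_resample jN mG G0).
  have I0 x : (0 <= \int[normal_prob 0%R s]_w G (upd x j w))%E by exact: integral_ge0.
  by rewrite (integral_resample oN (measurable_inner j mG G0) I0).
have mFrot : measurable_fun setT (fun x => F (rotate o j c t x)).
  exact: (measurableT_comp mF mrot).
rewrite (step _ mFrot)// (step F mF F0); apply: eq_integral => x _.
pose G a b := F (upd (upd x o a) j b).
have mG : measurable_fun setT (fun z : R * R => G z.1 z.2).
  apply: (measurableT_comp mF).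
  by apply: measurable_upd => //; exact: measurable_upd.
transitivity (\int[normal_prob 0 s]_v \int[normal_prob 0 s]_w
    G (c * v + t * w)%R (t * v - c * w)%R)%E; last first.
  exact: (integral_normal_rotation s0 t0 ct mG (fun _ _ => F0 _)).
apply: eq_integral => v _; apply: eq_integral => w _; congr F.
apply/funext => i; rewrite /rotate /upd !eqxx (negbTE oj).
by case: (eqVneq i j) => //; case: (eqVneq i o).
Qed.

Lemma integral_scale F o lambda : (o < N)%N -> 0 < lambda ->
  measurable_fun setT F -> (forall x, 0 <= F x)%E ->
  (\int[P]_x F (upd x o (lambda * x o)%R) =
   \int[P]_x (F x * (scaling_density s lambda (x o))%:E))%E.
Proof.
move=> oN l0 mF F0.
have mFu x : measurable_fun setT (fun v => F (upd x o v)).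
  by apply: measurableT_comp => //; exact: measurable_upd.
rewrite (integral_resample oN (F := fun x => F (upd x o (lambda * x o)%R)))//; last first.
  apply: measurableT_comp => //; apply: measurable_upd => //.
  by apply: measurable_funM => //; exact: measurable_coord.
have mFl : measurable_fun setT (fun x => (F x * (scaling_density s lambda (x o))%:E)%E).
  apply: emeasurable_funM => //; apply/measurable_EFinP.
  by apply: measurableT_comp; [exact: measurable_scaling_density|exact: measurable_coord].
have Fl0 x : (0 <= F x * (scaling_density s lambda (x o))%:E)%E.
  by rewrite mule_ge0// lee_fin scaling_density_ge0.
rewrite (integral_resample oN mFl Fl0).
apply: eq_integral => x _.
under eq_integral do rewrite upd_upd upd_same.
by under [RHS]eq_integral do rewrite upd_same; rewrite -integral_normal_scale.
Qed.

Lemma integral_coord_indep F (g : R -> \bar R) o : (o < N)%N ->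
  measurable_fun setT F -> (forall x, 0 <= F x)%E ->
  measurable_fun setT g -> (forall y, 0 <= g y)%E ->
  (\int[P]_x (g (x o) * F (upd x o 0%R)) =
   \int[normal_prob 0%R s]_y g y * \int[P]_x F (upd x o 0%R))%E.
Proof.
move=> oN mF F0 mg g0.
have mF' : measurable_fun setT (fun x => F (upd x o 0)).
  by apply: measurableT_comp => //; exact: measurable_upd.
rewrite (integral_resample oN (F := fun x => (g (x o) * F (upd x o 0%R))%E))//; last 2 first.
- by apply: emeasurable_funM => //; apply: measurableT_comp => //; exact: measurable_coord.
- by move=> x; rewrite mule_ge0.
rewrite -ge0_integralZl//; last exact: integral_ge0.
apply: eq_integral => x _.
under eq_integral do rewrite upd_upd upd_same.
by rewrite ge0_integralZr.
Qed.

End iid_invariance.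

(** * Block sums and Helmert rotations *)
Section helmert.
Context (R : realType).
Implicit Types (x y : seqR R).

Definition walk x (o n : nat) : R := \sum_(i < n) x (o + i)%N.

Lemma walkS x o n : walk x o n.+1 = walk x o n + x (o + n)%N.
Proof. by rewrite /walk big_ord_recr. Qed.

Lemma measurable_walk o n : measurable_fun setT (fun x : seqR R => walk x o n).
Proof. by apply: measurable_sum => i; exact: measurable_coord. Qed.

(** The Helmert transformation of the block o, ..., o + k: a product of plane
    rotations that moves the normalized sum of the block to coordinate o. *)
Fixpoint helmert (o k : nat) x : seqR R :=
  if k is k'.+1 then
    rotate o (o + k) (Num.sqrt (k%:R / k.+1%:R)) (Num.sqrt (k.+1%:R)^-1) (helmert o k' x)
  else x.

Fixpoint unhelmert (o k : nat) x : seqR R :=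
  if k is k'.+1 then
    unhelmert o k'
     (rotate o (o + k) (Num.sqrt (k%:R / k.+1%:R)) (Num.sqrt (k.+1%:R)^-1) x)
  else x.

Lemma helmert_angle k : Num.sqrt (k%:R / k.+1%:R) ^+ 2 + Num.sqrt (k.+1%:R)^-1 ^+ 2 = 1 :> R.
Proof.
rewrite !sqr_sqrtr ?invr_ge0 ?divr_ge0//.
by rewrite -[X in _ + X]mul1r -mulrDl -natr1 divff// natr1 pnatr_eq0.
Qed.

Lemma rotateK o j (c t : R) x : o != j -> c ^+ 2 + t ^+ 2 = 1 ->
  rotate o j c t (rotate o j c t x) = x.
Proof.
move=> oj ct; apply/funext => i; rewrite /rotate /upd !eqxx (negbTE oj).
case: (eqVneq i j) => [->|ij].
  rewrite [LHS](_ : _ = (c ^+ 2 + t ^+ 2) * x j); first by rewrite ct mul1r.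
  by ring.
case: (eqVneq i o) => [->|//].
rewrite [LHS](_ : _ = (c ^+ 2 + t ^+ 2) * x o); first by rewrite ct mul1r.
by ring.
Qed.

Lemma helmertK o k x : unhelmert o k (helmert o k x) = x.
Proof.
elim: k x => //= k IH x; rewrite rotateK ?IH ?helmert_angle//.
by rewrite -[X in X != _]addn0 eqn_add2l.
Qed.

Lemma measurable_rotate o j (c t : R) : measurable_fun setT (@rotate R o j c t).
Proof.
apply: measurable_upd.
  apply: measurable_upd => //.
  by apply: measurable_funD; apply: measurable_funM => //; exact: measurable_coord.
by apply: measurable_funB; apply: measurable_funM => //; exact: measurable_coord.
Qed.

Lemma measurable_unhelmert o k : measurable_fun setT (unhelmert o k).
Proof. by elim: k => //= k IH; exact: (measurableT_comp IH (measurable_rotate _ _ _ _)). Qed.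

Lemma helmert_out o k x i : ((i < o) || (o + k < i))%N -> helmert o k x i = x i.
Proof.
elim: k => //= k IH h; rewrite /rotate/upd.
case: eqP h => [->|_]; first by rewrite ltnn orbF ltnNge leq_addr.
case: eqP => [->|_ h]; first by rewrite ltnn/= ltnNge leq_addr.
by apply: IH; case/orP: h => [->//|h]; rewrite (ltn_trans _ h) ?orbT// ltn_add2l.
Qed.

Lemma helmert_sum o k x : helmert o k x o = walk x o k.+1 / Num.sqrt k.+1%:R.
Proof.
elim: k => [|k IH]; first by rewrite /= /walk big_ord1 sqrtr1 divr1 addn0.
rewrite /= {1}/rotate /upd eqxx ifN; last first.
  by rewrite -[X in X != _]addn0 eqn_add2l.
rewrite IH helmert_out; last by rewrite ltn_add2l ltnSn orbT.
rewrite [walk x o k.+2]walkS sqrtrM// !sqrtrV// mulrC.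
set a := Num.sqrt k.+1%:R; have a0 : a != 0 by rewrite gt_eqF// sqrtr_gt0.
by field; rewrite a0 gt_eqF// sqrtr_gt0.
Qed.

Lemma helmertD o k x y (a : R) : helmert o k (fun i => x i + a * y i) =
  fun i => helmert o k x i + a * helmert o k y i.
Proof.
elim: k => //= k IH; rewrite IH; apply/funext => i; rewrite /rotate /upd.
by case: eqP => _; [ring|case: eqP => _ //; ring].
Qed.

Definition block (o k : nat) : seqR R := fun i => (o <= i <= o + k)%:R.

(** The coordinates of the transform within the block, except for o, are
    contrasts, which vanish on equal entries. *)
Lemma helmert_block o k i : i != o -> helmert o k (block o k) i = 0.
Proof.
(* a vector constant on the first j + 1 entries is killed at entries 1 .. j *)
have main j : (j <= k)%N -> forall i, (o < i <= o + j)%N -> helmert o j (block o k) i = 0.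
  elim: j => [_ i'|j IH jk i']; first by rewrite addn0 ltnNge andNb.
  move=> /andP[oi ij]; rewrite /= /rotate /upd.
  case: eqVneq => [_|ij'].
    rewrite helmert_sum helmert_out ?ltn_add2l ?ltnSn ?orbT//.
    have -> : walk (block o k) o j.+1 = j.+1%:R.
      rewrite /walk (eq_bigr (fun=> 1)) => [|i'' _].
        by rewrite sumr_const card_ord.
      by rewrite /block leq_addr leq_add2l (leq_trans _ (ltnW jk))// -ltnS.
    rewrite /block leq_addr leq_add2l jk mulr1 sqrtrM// !sqrtrV//.
    set a := Num.sqrt j.+1%:R; have a0 : a != 0 by rewrite gt_eqF// sqrtr_gt0.
    have -> : j.+1%:R = a * a by rewrite -expr2 sqr_sqrtr.
    by field; rewrite a0 gt_eqF// sqrtr_gt0.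
  rewrite ifN ?gtn_eqF//; apply: IH; first exact: ltnW.
  by rewrite oi -ltnS -addnS ltn_neqAle ij'.
move=> io; have [oi|] := ltnP o i; last first.
  rewrite leq_eqVlt (negbTE io)/= => io'.
  by rewrite helmert_out ?io'// /block leqNgt io'.
have [ik|ki] := leqP i (o + k); first by rewrite main// oi ik.
by rewrite helmert_out ?ki ?orbT// /block [(i <= _)%N]leqNgt ki andbF.
Qed.

(** Multiply the mean of the block by lambda, keeping the deviations from it. *)
Definition shrink (o k : nat) (lambda : R) x : seqR R :=
  fun i => x i + ((lambda - 1) * walk x o k.+1 / k.+1%:R) * block o k i.

(** Helmert coordinates turn the shrinking of a block into the scaling of one
    coordinate. *)
Lemma helmert_shrink o k lambda x :
  helmert o k (shrink o k lambda x) = upd (helmert o k x) o (lambda * helmert o k x o).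
Proof.
rewrite helmertD; apply/funext => i; rewrite /upd; case: eqVneq => [->|io]; last first.
  by rewrite helmert_block// mulr0 addr0.
rewrite !helmert_sum.
have -> : walk (block o k) o k.+1 = k.+1%:R.
  rewrite /walk (eq_bigr (fun=> 1)) => [|i' _]; first by rewrite sumr_const card_ord.
  by rewrite /block leq_addr leq_add2l -ltnS ltn_ord.
set a := Num.sqrt k.+1%:R; have a0 : a != 0 by rewrite gt_eqF// sqrtr_gt0.
have -> : k.+1%:R = a * a by rewrite -expr2 sqr_sqrtr.
by field; rewrite a0.
Qed.

Lemma measurable_shrink o k lambda : measurable_fun setT (shrink o k lambda).
Proof.
apply: measurable_seqP => i; apply: measurable_funD; first exact: measurable_coord.
do 2 apply: measurable_funM => //; apply: measurable_funM => //.
exact: measurable_walk.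
Qed.

Section law.
Variables (N : nat) (s : R) (P : probability (seqR R) R).
Hypotheses (s0 : s != 0) (iidP : iid_normal N s P).
Implicit Types F : seqR R -> \bar R.

Lemma helmert_preserves o k : (o + k < N)%N -> preserves P (helmert o k).
Proof.
elim: k => [_|k IH kN]; first exact: preserves_id.
apply: (preserves_comp (rotate_preserves s0 iidP _ kN _ _ (helmert_angle k.+1))).
- by rewrite (leq_ltn_trans _ kN)// leq_addr.
- by rewrite -[X in X != _]addn0 eqn_add2l.
- by rewrite sqrtr_gt0 invr_gt0.
- by apply: IH; rewrite (leq_ltn_trans _ kN)// leq_add2l.
Qed.

(** In Helmert coordinates this is the density of a single normal variable. *)
Lemma integral_shrink F o k lambda : (o + k < N)%N -> 0 < lambda ->
  measurable_fun setT F -> (forall x, 0 <= F x)%E ->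
  (\int[P]_x F (shrink o k lambda x) = \int[P]_x (F x *
    (scaling_density s lambda (walk x o k.+1 / Num.sqrt k.+1%:R))%:E))%E.
Proof.
move=> okN l0 mF F0.
have oN : (o < N)%N by rewrite (leq_ltn_trans _ okN)// leq_addr.
have [mh hP] := helmert_preserves okN.
have mu := measurable_unhelmert o k.
have mFu : measurable_fun setT (F \o unhelmert o k) by exact: measurableT_comp.
pose G y := F (unhelmert o k (upd y o (lambda * y o))).
transitivity (\int[P]_x G (helmert o k x))%E.
  by apply: eq_integral => x _; rewrite /G -helmert_shrink helmertK.
have mupd : measurable_fun setT (fun y : seqR R => upd y o (lambda * y o)).
  apply: measurable_upd => //; apply: measurable_funM => //; exact: measurable_coord.
rewrite hP; last 2 first.
- exact: (measurableT_comp mFu mupd).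
- by move=> x; exact: F0.
rewrite (integral_scale s0 iidP oN l0 mFu (fun=> F0 _)).
pose H y := (F (unhelmert o k y) * (scaling_density s lambda (y o))%:E)%E.
transitivity (\int[P]_x H (helmert o k x))%E; last first.
  by apply: eq_integral => x _; rewrite /H helmertK helmert_sum.
rewrite hP//.
- apply: emeasurable_funM => //; apply/measurable_EFinP.
  by apply: measurableT_comp; [exact: measurable_scaling_density|exact: measurable_coord].
- by move=> x; rewrite mule_ge0// lee_fin scaling_density_ge0.
Qed.

(** In Helmert coordinates the block sum is one coordinate, while the deviations
    from the block mean depend on the other coordinates only. *)
Lemma integral_block_indep F (g : R -> \bar R) o k : (o + k < N)%N ->
  measurable_fun setT F -> (forall x, 0 <= F x)%E ->
  measurable_fun setT g -> (forall z, 0 <= g z)%E ->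
  (\int[P]_x (g (walk x o k.+1 / Num.sqrt k.+1%:R)%R * F (shrink o k 0%R x)) =
   \int[normal_prob 0%R s]_z g z * \int[P]_x F (shrink o k 0%R x))%E.
Proof.
move=> okN mF F0 mg g0.
have oN : (o < N)%N by rewrite (leq_ltn_trans _ okN)// leq_addr.
have [mh hP] := helmert_preserves okN.
have mu := measurable_unhelmert o k.
have mFu : measurable_fun setT (F \o unhelmert o k) by exact: measurableT_comp.
have mupd : measurable_fun setT (fun y : seqR R => upd y o 0).
  by apply: measurable_upd.
have shr x : shrink o k 0 x = unhelmert o k (upd (helmert o k x) o 0).
  by have := helmert_shrink o k 0 x; rewrite mul0r => <-; rewrite helmertK.
pose G y := (g (y o) * F (unhelmert o k (upd y o 0%R)))%E.
transitivity (\int[P]_x G (helmert o k x))%E.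
  by apply: eq_integral => x _; rewrite /G helmert_sum shr.
rewrite hP; last 2 first.
- apply: emeasurable_funM; last exact: (measurableT_comp mFu mupd).
  exact: (measurableT_comp mg (measurable_coord o)).
- by move=> x; rewrite mule_ge0.
rewrite (integral_coord_indep iidP oN mFu (fun=> F0 _) mg g0); congr (_ * _)%E.
transitivity (\int[P]_x F (unhelmert o k (upd (helmert o k x) o 0%R)))%E.
  apply/esym; exact: (hP (fun y => F (unhelmert o k (upd y o 0))) (measurableT_comp mFu mupd) (fun=> F0 _)).
by apply: eq_integral => x _; rewrite shr.
Qed.

Lemma block_sum_law o k (A : set R) : (o + k < N)%N -> measurable A ->
  P [set x | A (walk x o k.+1 / Num.sqrt k.+1%:R)] = normal_prob 0 s A.
Proof.
move=> okN mA.
have mW : measurable_fun setT (fun x : seqR R => walk x o k.+1 / Num.sqrt k.+1%:R).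
  by apply: measurable_funM => //; exact: measurable_walk.
have mWA : measurable [set x : seqR R | A (walk x o k.+1 / Num.sqrt k.+1%:R)].
  by rewrite -[X in measurable X]setTI; exact: mW.
have ind d (T : measurableType d) (Q : probability T R) (C : set T) :
    measurable C -> (\int[Q]_z (\1_C z)%:E)%E = Q C.
  by move=> mC; rewrite integral_indic// setIT.
transitivity (\int[P]_x ((\1_A (walk x o k.+1 / Num.sqrt k.+1%:R))%:E *
    cst 1%E (shrink o k 0 x)))%E.
  rewrite -(ind _ _ _ _ mWA); apply: eq_integral => x _.
  by rewrite mule1 !indicE.
rewrite (integral_block_indep (F := cst 1%E) (g := fun z : R => (\1_A z)%:E) okN)//.
  by rewrite ind// integral_cst// mul1e [X in (_ * X)%E]probability_setT mule1.
exact/measurable_EFinP.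
Qed.

End law.

End helmert.

(** * Reflections of the random walk *)
Lemma measurable_ge d (T : measurableType d) (R : realType) (f : T -> R) (a : R) :
  measurable_fun setT f -> measurable [set x | a <= f x].
Proof.
move=> mf; rewrite (_ : mkset _ = f @^-1` `[a, +oo[).
  by rewrite -[X in measurable X]setTI; apply: mf => //; exact: measurable_itv.
by apply/seteqP; split => x; rewrite /= in_itv/= andbT.
Qed.

Lemma measurable_gt d (T : measurableType d) (R : realType) (f : T -> R) (a : R) :
  measurable_fun setT f -> measurable [set x | a < f x].
Proof.
move=> mf; rewrite (_ : mkset _ = f @^-1` `]a, +oo[).
  by rewrite -[X in measurable X]setTI; apply: mf => //; exact: measurable_itv.
by apply/seteqP; split => x; rewrite /= in_itv/= andbT.
Qed.

Lemma measurable_le d (T : measurableType d) (R : realType) (f : T -> R) (a : R) :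
  measurable_fun setT f -> measurable [set x | f x <= a].
Proof.
move=> mf; rewrite (_ : mkset _ = f @^-1` `]-oo, a]).
  by rewrite -[X in measurable X]setTI; apply: mf => //; exact: measurable_itv.
by apply/seteqP; split => x; rewrite /= in_itv.
Qed.

Section reflection.
Context (R : realType) (N : nat) (s : R) (P : probability (seqR R) R).
Hypotheses (s0 : s != 0) (iidP : iid_normal N s P).
Implicit Types (x : seqR R) (D E : set (seqR R)).

(** The map used is the one of the first event that occurs. It preserves the law
    and, by the invariance of the earlier events, also this index. *)
Lemma reflection_principle (B : nat -> set (seqR R)) (f : nat -> seqR R -> seqR R) n D E :
  (forall j, measurable (B j)) -> measurable D -> measurable E ->
  (forall j, preserves P (f j)) ->
  (forall i j x, (i <= j)%N -> (j < n)%N -> B i (f j x) <-> B i x) ->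
  (forall j x, (j < n)%N -> B j x -> E x -> D (f j x)) ->
  (P ([set x | exists2 j, (j < n)%N & B j x] `&` E) <= P D)%E.
Proof.
move=> mB mD mE pf inv hit.
pose A j := if (j < n)%N then B j `&` \bigcap_(i in `I_j) ~` B i else set0.
have mA j : measurable (A j).
  rewrite /A; case: ifP => // _; apply: measurableI => //.
  by apply: bigcap_measurableType => i _; exact: measurableC.
have tA : trivIset setT A.
  suff disj i j x : (i < j)%N -> A i x -> A j x -> False.
    move=> i j _ _ [x [Ai Aj]]; case: (ltngtP i j) => // ij.
      by case: (disj _ _ _ ij Ai Aj).
    by case: (disj _ _ _ ij Aj Ai).
  rewrite /A; case: ifP => // _; case: ifP => // _ ij [Bi _] [_ /(_ i ij)]; exact.
apply: (@le_trans _ _ (\sum_(0 <= j < n) P (A j `&` E))%E).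
  rewrite big_mkord; apply: (@content_subadditive _ _ _ P _ (fun j => A j `&` E)).
  - by move=> j _; exact: measurableI.
  - apply: measurableI => //.
    rewrite (_ : mkset _ = \bigcup_(j in `I_n) B j); first exact: bigcup_measurable.
    by apply/seteqP; split => x [j jn Bj]; exists j.
  - move=> x [[j jn Bj] Ex]; rewrite -(bigcup_mkord n (fun j => A j `&` E)).
    have ex : exists i, (i < n)%N && `[< B i x >] by exists j; rewrite jn; exact/asboolP.
    case: (ex_minnP ex) => i /andP[iN /asboolP Bi] imin; exists i => //; split => //.
    rewrite /A iN; split => // l /= li Bl.
    have : (i <= l)%N by apply: imin; rewrite (ltn_trans li iN); exact/asboolP.
    by rewrite leqNgt li.
apply: (@le_trans _ _ (\sum_(0 <= j < n) P (A j `&` D))%E).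
  rewrite !big_mkord; apply: lee_sum => j _.
  rewrite -(preserves_set (pf j) (measurableI _ _ (mA j) mD)).
  apply: le_measure; rewrite ?inE.
  - exact: measurableI.
  - by rewrite -[X in measurable X]setTI; apply: (pf j).1 => //; exact: measurableI.
  - move=> x []; rewrite /A ltn_ord => -[Bj nB] Ex; split => /=; last exact: hit.
    split; first exact/inv.
    by move=> i ij; rewrite /setC/= inv//; [exact: nB|exact: ltnW].
have mAD j : measurable (A j `&` D) by exact: measurableI.
rewrite big_mkord -(@measure_bigsetU _ _ _ P (fun j => A j `&` D) mAD)//; last exact: trivIset_setIr.
apply: le_measure; rewrite ?inE//.
  by apply: bigsetU_measurable => j _; exact: measurableI.
by rewrite -(bigcup_mkord n (fun j => A j `&` D)) => x [j _ []].
Qed.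

(** When one of the events occurs outside of D, the mapped sequence is in D. *)
Lemma levy_inequality (B : nat -> set (seqR R)) (f : nat -> seqR R -> seqR R) n D :
  (forall j, measurable (B j)) -> measurable D ->
  (forall j, preserves P (f j)) ->
  (forall i j x, (i <= j)%N -> (j < n)%N -> B i (f j x) <-> B i x) ->
  (forall j x, (j < n)%N -> B j x -> ~ D x -> D (f j x)) ->
  (P [set x | exists2 j, (j < n)%N & B j x] <= 2%:E * P D)%E.
Proof.
move=> mB mD pf inv hit.
set U := [set x | _].
have mU : measurable U.
  rewrite (_ : U = \bigcup_(j in `I_n) B j); first exact: bigcup_measurable.
  by apply/seteqP; split => x [j jn Bj]; exists j.
apply: (@le_trans _ _ (P ((U `&` ~` D) `|` D))).
  apply: le_measure; rewrite ?inE//.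
    by apply: measurableU => //; apply: measurableI => //; exact: measurableC.
  by move=> x Ux; have [Dx|nDx] := pselect (D x); [right|left].
apply: le_trans (measureU2 _ _ mD) _.
  by apply: measurableI => //; exact: measurableC.
rewrite (_ : 2%:E = 1 + 1)%E// ge0_muleDl// mul1e leeD2r//.
by apply: (reflection_principle (f := f)) => //; exact: measurableC.
Qed.

Lemma walk_flip_after x (o j n : nat) :
  walk (flip (fun i => (o + j <= i)%N) x) o n =
  if (n <= j)%N then walk x o n else walk x o j *+ 2 - walk x o n.
Proof.
elim: n => [|n IH]; first by rewrite /walk !big_ord0.
rewrite !walkS IH /flip leq_add2l; case: (ltngtP n j) => [nj|jn|nj] //.
  by ring.
by rewrite nj; ring.
Qed.

Lemma walk_flip_before x (j n : nat) :
  walk (flip (fun i => (i < j)%N) x) 0 n =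
  if (n <= j)%N then - walk x 0 n else walk x 0 n - walk x 0 j *+ 2.
Proof.
elim: n => [|n IH]; first by rewrite /walk !big_ord0 oppr0.
rewrite !walkS IH /flip add0n; case: (ltngtP n j) => [nj|jn|nj].
- by ring.
- by ring.
- by rewrite nj; ring.
Qed.

Lemma measurable_walk_ge o n (a : R) : measurable [set x : seqR R | a <= walk x o n].
Proof. by apply: measurable_ge; exact: measurable_walk. Qed.

Lemma measurable_walk_gt o n (a : R) : measurable [set x : seqR R | a < walk x o n].
Proof. by apply: measurable_gt; exact: measurable_walk. Qed.

Lemma measurable_walkB_gt o n m (a : R) :
  measurable [set x : seqR R | a < walk x o n - walk x o m].
Proof. by apply: measurable_gt; apply: measurable_funB; exact: measurable_walk. Qed.

(** Time is run backwards from M, so that what is reflected is the part of the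
    walk before the start of the rise. *)
Lemma walk_terminal_drawup M (a : R) :
  (P [set x | exists2 j, (j < M.+1)%N & (a < walk x 0 M - walk x 0 (M - j)%N)%R] <=
   2%:E * P [set x | (a < walk x 0 M)%R])%E.
Proof.
apply: (levy_inequality (f := fun j => flip (fun i => (i < M - j)%N))).
- by move=> j; exact: measurable_walkB_gt.
- exact: measurable_walk_gt.
- by move=> j; exact: (flip_preserves s0 iidP).
- move=> i j x ij jM /=; rewrite !walk_flip_before.
  have ji : (M - j <= M - i)%N := leq_sub2l M ij.
  case: (leqP M (M - j)) => e.
    have e' : (M - i = M)%N by apply/eqP; rewrite eqn_leq leq_subr (leq_trans e ji).
    by rewrite e' e !subrr.
  case: (leqP (M - i) (M - j)) => h.
    have -> : (M - i = M - j)%N by apply/eqP; rewrite eqn_leq h ji.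
    rewrite (_ : walk x 0 M - _ *+ 2 - - _ = walk x 0 M - walk x 0 (M - j)%N)//.
    by ring.
  by rewrite opprB addrA subrK.
- move=> j x jM /= h /negP; rewrite -leNgt => h'; rewrite walk_flip_before.
  case: ifP => [e|_]; last by lra.
  have e' : (M - j = M)%N by apply/eqP; rewrite eqn_leq leq_subr e.
  by rewrite e' in h; lra.
Qed.

(** If a rise by more than a is not maintained at time M, it is so after the walk
    is reflected from the end of the rise on. *)
Lemma walk_drawup M (a : R) :
  (P [set x | exists2 k, (k < M.+1)%N &
       exists2 j, (j < k.+1)%N & (a < walk x 0 k - walk x 0 j)%R] <=
   4%:E * P [set x | (a < walk x 0 M)%R])%E.
Proof.
pose D := [set x : seqR R | exists2 j, (j < M.+1)%N & a < walk x 0 M - walk x 0 (M - j)%N].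
have mB k : measurable [set x : seqR R | exists2 j, (j < k.+1)%N & a < walk x 0 k - walk x 0 j].
  rewrite (_ : mkset _ = \bigcup_(j in `I_k.+1) [set x : seqR R | a < walk x 0 k - walk x 0 j]).
    by apply: bigcup_measurable => j _; exact: measurable_walkB_gt.
  by apply/seteqP; split => x [j]; exists j.
have mD : measurable D.
  rewrite (_ : D = \bigcup_(j in `I_M.+1) [set x : seqR R | a < walk x 0 M - walk x 0 (M - j)%N]).
    by apply: bigcup_measurable => j _; exact: measurable_walkB_gt.
  by apply/seteqP; split => x [j]; exists j.
apply: (@le_trans _ _ (2%:E * P D)%E); last first.
  have := walk_terminal_drawup M a; rewrite -/D => h.
  have -> : (4%:E = 2%:E * 2%:E :> \bar R)%E by rewrite -EFinM -natrM.
  by rewrite -muleA; apply: lee_wpmul2l.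
apply: (levy_inequality (f := fun k => flip (fun i => (0 + k <= i)%N))) => //.
- by move=> j; exact: (flip_preserves s0 iidP).
- move=> i k x ik kM; split => -[j ji /= h]; exists j => //; move: h;
    rewrite /= !walk_flip_after !ik (leq_trans _ ik)//.
- move=> k x kM [j jk h] nD.
  have jM : (j <= M)%N by exact: leq_trans jk kM.
  have h' : walk x 0 M - walk x 0 j <= a.
    rewrite leNgt; apply/negP => h'; apply: nD.
    by exists (M - j)%N; rewrite ?subKn// ltnS leq_subr.
  exists (M - j)%N; first by rewrite ltnS leq_subr.
  have jk' : (j <= k)%N by rewrite -ltnS.
  rewrite subKn// !walk_flip_after jk'.
  case: ifP => kM'; last by lra.
  have Mk : k = M by apply/eqP; rewrite eqn_leq kM' -ltnS kM.
  by rewrite Mk in h; lra.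
Qed.

(** If the range exceeds a, then the walk rises or falls by more than a, and
    falls become rises by changing all signs. *)
Lemma walk_range_tail M (a : R) :
  (P [set x | exists j k, [/\ (j <= M)%N, (k <= M)%N & (a < walk x 0 k - walk x 0 j)%R]] <=
   8%:E * P [set x | (a < walk x 0 M)%R])%E.
Proof.
pose U := [set x : seqR R | exists2 k, (k < M.+1)%N &
       exists2 j, (j < k.+1)%N & a < walk x 0 k - walk x 0 j].
have mU : measurable U.
  rewrite (_ : U = \bigcup_(k in `I_M.+1) \bigcup_(j in `I_k.+1)
      [set x : seqR R | a < walk x 0 k - walk x 0 j]).
    by apply: bigcup_measurable => k _; apply: bigcup_measurable => j _; exact: measurable_walkB_gt.
  by apply/seteqP; split => x [k kM [j jk h]]; exists k => //; exists j.
have fp := flip_preserves s0 iidP xpredT.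
have wf x n : walk (flip xpredT x) 0 n = - walk x 0 n.
  by rewrite /walk sumrN.
have mV : measurable (flip xpredT @^-1` U).
  by rewrite -[X in measurable X]setTI; exact: fp.1.
apply: (@le_trans _ _ (P (U `|` flip xpredT @^-1` U))).
  apply: le_measure; rewrite ?inE; last 2 first.
  - exact: measurableU.
  - move=> x [j [k [jM kM h]]]; have [jk|kj] := leqP j k.
      by left; exists k => //; exists j.
    right; exists j => //; exists k; first exact: ltnW.
    by rewrite /= !wf; lra.
  rewrite (_ : mkset _ = \bigcup_(j in `I_M.+1) \bigcup_(k in `I_M.+1)
      [set x : seqR R | a < walk x 0 k - walk x 0 j]).
    by apply: bigcup_measurable => k _; apply: bigcup_measurable => j _; exact: measurable_walkB_gt.
  apply/seteqP; split => x.
    by move=> [j [k [jM kM h]]]; exists j => //; exists k.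
  by move=> [j jM [k kM h]]; exists j, k.
apply: le_trans (measureU2 _ mU mV) _.
rewrite [X in (_ + X <= _)%E](preserves_set fp mU).
rewrite (_ : 8%:E = 4%:E + 4%:E)%E; last by rewrite -EFinD -natrD.
by rewrite ge0_muleDl//; apply: leeD; exact: walk_drawup.
Qed.

Lemma walk_shrink0 o k j x : (j <= k.+1)%N ->
  walk (shrink o k 0 x) o j = walk x o j - j%:R / k.+1%:R * walk x o k.+1.
Proof.
move=> jk; rewrite /walk /shrink big_split/= -/(walk x o j) -/(walk x o k.+1); congr (_ + _).
rewrite (eq_bigr (fun=> - (walk x o k.+1 / k.+1%:R))) => [|i _].
  by rewrite sumr_const card_ord -mulr_natl; ring.
rewrite /block leq_addr leq_add2l -ltnS (leq_trans (ltn_ord i) jk) mulr1; ring.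
Qed.

Definition bridge_exceeds o k (z : R) : set (seqR R) :=
  [set x | exists2 j, (j < k.+2)%N & z <= walk (shrink o k 0 x) o j].

Lemma measurable_bridge_exceeds o k z : measurable (bridge_exceeds o k z).
Proof.
rewrite (_ : bridge_exceeds o k z = shrink o k 0 @^-1` \bigcup_(j in `I_k.+2)
    [set x | z <= walk x o j]).
  rewrite -[X in measurable X]setTI; apply: measurable_shrink => //.
  by apply: bigcup_measurable => j _; exact: measurable_walk_ge.
by apply/seteqP; split => x [j jk h]; exists j.
Qed.

(** Given that the block sum lies in [0, e], an event of the same probability
    as without this condition, a bridge above z is a walk above z; reflecting
    the walk then makes the block sum at least 2 z - e. *)
Lemma bridge_tail o k (z e : R) : (o + k < N)%N -> 0 <= e ->
  (normal_prob 0%R s `[0%R, (e / Num.sqrt k.+1%:R)%R] * P (bridge_exceeds o k z) <=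
   normal_prob 0%R s `[((2 * z - e) / Num.sqrt k.+1%:R)%R, +oo[)%E.
Proof.
move=> okN e0.
have K0 : 0 < Num.sqrt k.+1%:R :> R by rewrite sqrtr_gt0.
pose U := \bigcup_(j in `I_k.+2) [set x : seqR R | z <= walk x o j].
have mU : measurable U by apply: bigcup_measurable => j _; exact: measurable_walk_ge.
pose I : set R := `[0, e / Num.sqrt k.+1%:R]%classic.
pose B := [set x : seqR R | I (walk x o k.+1 / Num.sqrt k.+1%:R)].
have mB : measurable B.
  rewrite -[X in measurable X]setTI.
  by apply: (measurable_funM (measurable_walk o k.+1) (measurable_cst _)) => //; exact: measurable_itv.
have mbr := measurable_bridge_exceeds o k z.
have -> : (normal_prob 0%R s I * P (bridge_exceeds o k z) = P (B `&` bridge_exceeds o k z))%E.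
  have := @integral_block_indep R N s P s0 iidP (fun x => (\1_U x)%:E)
    (fun y : R => (\1_I y)%:E) o k okN.
  have ind d (T : measurableType d) (Q : probability T R) (C : set T) :
      measurable C -> (\int[Q]_z (\1_C z)%:E)%E = Q C.
    by move=> mC; rewrite integral_indic// setIT.
  have brE x : bridge_exceeds o k z x <-> U (shrink o k 0 x).
    by split => -[j jk h]; exists j.
  have ibr x : \1_(bridge_exceeds o k z) x = \1_U (shrink o k 0 x) :> R.
    by rewrite !indicE; congr (_%:R); congr nat_of_bool; apply/idP/idP; rewrite !inE => /brE.
  rewrite (_ : (fun x => (\1_U (shrink o k 0 x))%:E) =
      (fun x => (\1_(bridge_exceeds o k z) x)%:E)); last first.
    by apply/funext => x; rewrite ibr.
  rewrite (_ : (fun x => (_ * _)%E) = (fun x => (\1_(B `&` bridge_exceeds o k z) x)%:E)); last first.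
    by apply/funext => x; rewrite indicI/= EFinM ibr !indicE.
  have mI : measurable I by exact: measurable_itv.
  have indI : (\int[normal_prob 0 s]_z (\1_I z)%:E)%E = normal_prob 0 s I.
    by rewrite integral_indic// setIT.
  rewrite indI (ind _ _ _ _ mbr) (ind _ _ _ _ (measurableI _ _ mB mbr)) => h.
  apply/esym/h => //.
    exact/measurable_EFinP.
  by apply/measurable_EFinP; apply: measurable_indic; exact: measurable_itv.
rewrite -(block_sum_law s0 iidP okN (measurable_itv _)).
pose E := [set x : seqR R | walk x o k.+1 <= e].
have mE : measurable E by apply: measurable_le; exact: measurable_walk.
apply: (@le_trans _ _ (P ([set x | exists2 j, (j < k.+2)%N & z <= walk x o j] `&` E))).
  apply: le_measure; rewrite ?inE.
  - exact: measurableI.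
  - exact: measurableI.
  - move=> x [] /=; rewrite /B /I /= in_itv/= ler_pdivrMr// divfK ?gt_eqF// => /andP[Sx0 Sxe].
    move=> [j jk h]; split => //; exists j => //.
    move: h; rewrite walk_shrink0// => /le_trans; apply.
    rewrite gerBl mulr_ge0//.
    by move: Sx0; rewrite pmulr_lge0// invr_gt0.
rewrite (_ : [set x | _ (walk x o k.+1 / _)] = [set x : seqR R | 2 * z - e <= walk x o k.+1]); last first.
  by apply/seteqP; split => x /=; rewrite in_itv/= andbT ler_pdivrMr// divfK// gt_eqF.
apply: (reflection_principle (f := fun j => flip (fun i => (o + j <= i)%N))) => //.
- by move=> j; exact: measurable_walk_ge.
- exact: measurable_walk_ge.
- by move=> j; exact: (flip_preserves s0 iidP).
- by move=> i j x ij _; rewrite /= walk_flip_after ij.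
- move=> j x jk /= h1; rewrite /E/= => h2; rewrite walk_flip_after.
  case: ifP => kj; last by lra.
  have jk' : j = k.+1 by apply/eqP; rewrite eqn_leq kj -ltnS jk.
  by rewrite jk' in h1; lra.
Qed.

End reflection.

(** * Gaussian tails *)
Section gaussian_tails.
Context (R : realType).
Local Notation mu := (@lebesgue_measure R).
Implicit Types a b c x : R.

Definition bell x : R := expR (- (x ^+ 2 / 2)).

Lemma normal_pdf1E x : normal_pdf 0 1 x = normal_peak 1 * bell x.
Proof. by rewrite normal_pdf0E ?oner_neq0// expr1n. Qed.

Lemma bell_gt0 x : 0 < bell x. Proof. exact: expR_gt0. Qed.

Lemma bellM_cvg0 b c : (b + c * x) * bell x @[x --> +oo] --> (0 : R).
Proof.
have h : (`|b| + `|c|) * 2 * x^-1 @[x --> +oo] --> (0 : R).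
  rewrite -[X in _ --> X](mulr0 ((`|b| + `|c|) * 2)).
  apply: cvgM; first exact: cvg_cst.
  apply/gtr0_cvgV0; last exact: cvg_id.
  by near=> x; near: x; exact: nbhs_pinfty_gt.
have hN : - ((`|b| + `|c|) * 2 * x^-1) @[x --> +oo] --> (0 : R).
  by rewrite -oppr0; apply: cvgN.
apply: squeeze_cvgr hN h; near=> x.
have x1 : 1 <= x by near: x; apply: nbhs_pinfty_ge; rewrite num_real.
have x0 : 0 < x by lra.
rewrite -ler_norml normrM [X in _ * X]gtr0_norm ?bell_gt0//.
have e1 : bell x <= 2 / x ^+ 2.
  rewrite /bell expRN -[2 / _]invf_div lef_pV2 ?posrE ?expR_gt0 ?divr_gt0 ?exprn_gt0//.
  by have := expR_ge1Dx (x ^+ 2 / 2); lra.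
have e2 : `|b + c * x| <= (`|b| + `|c|) * x.
  rewrite (le_trans (ler_normD _ _))// mulrDl normrM (gtr0_norm x0) lerD2r.
  by rewrite ler_peMr.
apply: (le_trans (ler_pM _ _ e2 e1)) => //; first exact/ltW/bell_gt0.
rewrite le_eqVlt; apply/orP; left; apply/eqP.
by field; rewrite gt_eqF.
Unshelve. all: by end_near. Qed.

Definition bell_prim b c x : R := - ((b + c * x) * bell x).
(** The derivative of [bell_prim]: polynomial weights of this form, chosen so as
    to bound a given weight, make Gaussian integrals explicit. *)
Definition bell_integrand b c x : R := (x * (b + c * x) - c) * bell x.

Lemma is_derive_bell x : is_derive x 1 bell (- x * bell x).
Proof.
have h : is_derive x 1 (fun y : R => - (y ^+ 2 / 2)) (- x).
  rewrite (_ : (fun y : R => _) = horner (- (2^-1 *: 'X^2))); last first.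
    by apply/funext => y; rewrite hornerN hornerZ hornerXn mulrC.
  rewrite [X in is_derive _ _ _ X](_ : _ = (- (2^-1 *: 'X^2))^`().[x]).
    exact: is_derive_poly.
  by rewrite derivN derivZ derivXn hornerN hornerZ hornerMn hornerXn; field.
have h' := @is_derive1_comp _ expR (fun y : R => - (y ^+ 2 / 2)) x _ _ (is_derive_expR _) h.
apply: (@is_derive_eq _ _ _ _ _ _ _ _ h').
by rewrite /GRing.scale/= mulrC.
Qed.

Lemma is_derive_bell_prim b c x :
  is_derive x 1 (bell_prim b c) (bell_integrand b c x).
Proof.
have hp : is_derive x 1 (fun y : R => b + c * y) c.
  rewrite (_ : (fun y : R => _) = horner (b%:P + c *: 'X)); last first.
    by apply/funext => y; rewrite hornerD hornerC hornerZ hornerX.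
  rewrite [X in is_derive _ _ _ X](_ : _ = (b%:P + c *: 'X)^`().[x]).
    exact: is_derive_poly.
  by rewrite derivD derivC derivZ derivX add0r hornerZ hornerC mulr1.
have h := @is_deriveN _ _ _ _ _ _ _ (is_deriveM hp (is_derive_bell x)).
apply: (@is_derive_eq _ _ _ _ _ _ _ _ h).
by rewrite /bell_integrand /GRing.scale/=; ring.
Qed.

Lemma continuous_bell_integrand b c : continuous (bell_integrand b c).
Proof.
move=> x; apply: differentiable_continuous; apply/derivable1_diffP.
have hp : derivable (fun y : R => y * (b + c * y) - c) x 1.
  rewrite (_ : (fun y : R => _) = horner ('X * (b%:P + c *: 'X) - c%:P)); last first.
    by apply/funext => y; rewrite hornerD hornerN hornerM hornerX hornerD !hornerC hornerZ hornerX.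
  by apply: (@ex_derive _ _ _ _ _ _ _ (is_derive_poly _ x)).
exact: (derivableM hp (@ex_derive _ _ _ _ _ _ _ (is_derive_bell x))).
Qed.

Lemma continuous_bell_prim b c : continuous (bell_prim b c).
Proof.
move=> x; apply: differentiable_continuous; apply/derivable1_diffP.
exact: (@ex_derive _ _ _ _ _ _ _ (is_derive_bell_prim b c x)).
Qed.

Lemma integral_bell_y b c a : (forall x, a <= x -> 0 <= bell_integrand b c x) ->
  (\int[mu]_(x in `[a, +oo[) (bell_integrand b c x)%:E = ((b + c * a) * bell a)%:E)%E.
Proof.
move=> f0; rewrite (@ge0_continuous_FTC2y _ _ (bell_prim b c) a 0)//.
- by rewrite sub0e /bell_prim -EFinN opprK.
- exact/continuous_subspaceT/continuous_bell_integrand.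
- by rewrite -oppr0; apply: cvgN; exact: bellM_cvg0.
- by apply: cvg_at_right_filter; exact: continuous_bell_prim.
- by move=> x _; rewrite derive1E (@derive_val _ _ _ _ _ _ _ (is_derive_bell_prim b c x)).
Qed.

Lemma integral_bell b c a d : a < d ->
  (\int[mu]_(x in `[a, d]) (bell_integrand b c x)%:E =
   ((b + c * a) * bell a - (b + c * d) * bell d)%:E)%E.
Proof.
move=> ad; rewrite (@continuous_FTC2 _ _ (bell_prim b c) a d)//.
- by rewrite -EFinB /bell_prim opprK addrC.
- exact/continuous_subspaceT/continuous_bell_integrand.
- split => //.
  + by apply: cvg_at_right_filter; exact: continuous_bell_prim.
  + by apply: cvg_at_left_filter; exact: continuous_bell_prim.
- by move=> x _; rewrite derive1E (@derive_val _ _ _ _ _ _ _ (is_derive_bell_prim b c x)).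
Qed.

Lemma normal_peak1_le : normal_peak 1 <= 1 / 2 :> R.
Proof.
have h : 2 <= Num.sqrt (pi *+ 2) :> R.
  rewrite -[leLHS]ger0_norm// -sqrtr_sqr ler_wsqrtr//.
  by have := @pi_ge2 R; lra.
by rewrite /normal_peak expr1n mul1r div1r lef_pV2 ?posrE//; lra.
Qed.

Lemma normal_peak1_ge : 1 / 8 <= normal_peak 1 ^+ 2 :> R.
Proof.
have p4 : pi < 4 :> R.
  have : pi / 2 < 2 :> R by have /andP[] := @pihalf_02 R.
  by rewrite ltr_pdivrMr//; lra.
have p0 := @pi_gt0 R.
rewrite /normal_peak expr1n !mul1r exprVn sqr_sqrtr; last by lra.
by rewrite lef_pV2 ?posrE//; lra.
Qed.

Let mpdf : measurable_fun setT (fun x => (normal_pdf 0 1 x)%:E).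
Proof. by apply/measurable_EFinP; exact: measurable_normal_pdf. Qed.

Let mbell b c : measurable_fun setT (fun x => (bell_integrand b c x)%:E).
Proof.
by apply/measurable_EFinP; apply: continuous_measurable_fun; exact: continuous_bell_integrand.
Qed.

Let peak0 : 0 <= normal_peak 1 :> R.
Proof. exact: normal_peak_ge0. Qed.

(** Integrate x / a >= 1 against the density. *)
Lemma normal_tail_le a : 0 < a ->
  (normal_prob 0%R 1%R `[a, +oo[ <= (normal_peak 1 * (bell a / a))%:E)%E.
Proof.
move=> a0; rewrite /normal_prob EFinM.
have f0 x : a <= x -> 0 <= bell_integrand a^-1 0 x.
  move=> ax; rewrite /bell_integrand mul0r addr0 subr0 !mulr_ge0 ?(ltW (bell_gt0 _)) ?invr_ge0 ?(ltW a0)//.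
  by lra.
have -> : (bell a / a)%:E = (\int[mu]_(x in `[a, +oo[) (bell_integrand a^-1 0 x)%:E)%E.
  by rewrite integral_bell_y// mul0r addr0 mulrC.
rewrite -ge0_integralZl//; last 2 first.
- exact: (measurable_funTS (mbell _ _)).
- by move=> x /=; rewrite in_itv/= andbT => ax; rewrite lee_fin f0.
apply: ge0_le_integral => //.
- by move=> x _; rewrite lee_fin normal_pdf_ge0.
- exact: (measurable_funTS mpdf).
- by apply: measurable_funTS; apply: measurable_funeM; exact: mbell.
- move=> x /=; rewrite in_itv/= andbT => ax.
  rewrite lee_fin normal_pdf1E ler_wpM2l// /bell_integrand.
  rewrite mul0r addr0 subr0 ler_peMl ?(ltW (bell_gt0 _))//.
  by rewrite ler_pdivlMr// mul1r.
Qed.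

(** The weight (1 + x (2 a - x)) / (1 + a ^ 2) is at most 1 and makes the
    density integrable in closed form over [a, 2 a]. *)
Lemma normal_tail_ge a : 0 < a ->
  ((normal_peak 1 * (a / (1 + a ^+ 2) * bell a))%:E <= normal_prob 0%R 1%R `[a, +oo[)%E.
Proof.
move=> a0.
have k0 : 0 < 1 + a ^+ 2 by have := sqr_ge0 a; lra.
have k0' : 1 + a ^+ 2 != 0 by rewrite gt_eqF.
pose b := 2 * a / (1 + a ^+ 2); pose c := - (1 + a ^+ 2)^-1.
have fE x : bell_integrand b c x = (1 + x * (2 * a - x)) / (1 + a ^+ 2) * bell x.
  by rewrite /bell_integrand /b /c; congr (_ * _); field.
have f0 x : a <= x <= 2 * a -> 0 <= bell_integrand b c x.
  move=> /andP[ax xa]; rewrite fE mulr_ge0 ?(ltW (bell_gt0 _))// divr_ge0 ?(ltW k0)//.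
  by rewrite addr_ge0// mulr_ge0//; lra.
apply: (@le_trans _ _ (normal_prob 0 1 `[a, 2 * a])); last first.
  apply: le_measure; rewrite ?inE; try exact: measurable_itv.
  by move=> x /=; rewrite !in_itv/= andbT => /andP[].
rewrite /normal_prob EFinM.
have -> : (a / (1 + a ^+ 2) * bell a)%:E =
    (\int[mu]_(x in `[a, (2 * a)%R]) (bell_integrand b c x)%:E)%E.
  rewrite integral_bell; last by lra.
  by congr EFin; rewrite /b /c; field.
rewrite -ge0_integralZl//; last first.
  exact: (measurable_funTS (mbell _ _)).
apply: ge0_le_integral => //.
- by move=> x /=; rewrite in_itv/= => ax; rewrite mule_ge0// lee_fin f0.
- by apply: measurable_funTS; apply: measurable_funeM; exact: mbell.
- exact: (measurable_funTS mpdf).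
- move=> x /=; rewrite in_itv/= => ax.
  rewrite lee_fin normal_pdf1E ler_wpM2l// fE ler_piMl ?(ltW (bell_gt0 _))//.
  by rewrite ler_pdivrMr// mul1r; have := sqr_ge0 (x - a); lra.
Qed.

Lemma normal_interval_ge u a : - a <= u < a ->
  ((normal_peak 1 * ((a - u) * bell a))%:E <= normal_prob 0%R 1%R `[u, a])%E.
Proof.
move=> /andP[au ua].
apply: (@le_trans _ _ (\int[mu]_(x in `[u, a]) (normal_peak 1 * bell a)%:E)%E).
  rewrite integral_cst//= lebesgue_measure_itv/= lte_fin ua -EFinB -EFinM lee_fin.
  by rewrite -mulrA [(a - u) * _]mulrC.
apply: ge0_le_integral => //.
- by move=> x _; rewrite lee_fin mulr_ge0// ltW// bell_gt0.
- exact: (measurable_funTS mpdf).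
- move=> x /=; rewrite in_itv/= => /andP[x0 xa].
  rewrite lee_fin normal_pdf1E ler_wpM2l// ler_expR lerN2 ler_pM2r//.
  by rewrite -[leLHS]real_normK ?num_real// ler_sqr ?nnegrE// ?ler_norml; lra.
Qed.

(** Adding (x - a) / a >= 0 to x ^ 2 - a x gives a weight for which the density
    has a primitive in closed form. *)
Lemma normal_excess_le a (h : R -> R) : 0 < a -> measurable_fun setT h ->
  (forall x, 0 <= h x) -> (forall x, x < a -> h x = 0) ->
  (forall x, a <= x -> h x <= x ^+ 2 - a * x) ->
  (\int[normal_prob 0%R 1%R]_x (h x)%:E <= (normal_peak 1 * (bell a / a))%:E)%E.
Proof.
move=> a0 mh h0 hlt hle.
have f0 x : a <= x -> 0 <= bell_integrand (a^-1 - a) 1 x.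
  move=> ax; rewrite /bell_integrand mulr_ge0 ?(ltW (bell_gt0 _))//.
  rewrite (_ : _ - 1 = x * (x - a) + (x - a) / a); last by field; rewrite gt_eqF.
  by rewrite addr_ge0// ?divr_ge0 ?mulr_ge0//; lra.
rewrite integral_normal_prob//; last exact/measurable_EFinP.
have -> : (\int[mu]_x ((h x)%:E * (normal_pdf 0 1 x)%:E) =
    \int[mu]_(x in `[a, +oo[) ((h x)%:E * (normal_pdf 0 1 x)%:E))%E.
  rewrite [RHS]integral_mkcond; apply: eq_integral => x _.
  rewrite patchE; case: ifPn => //; rewrite notin_setE/= in_itv/= andbT => /negP.
  by rewrite -ltNge => /hlt ->; rewrite mul0e.
have -> : (normal_peak 1 * (bell a / a))%:E = ((normal_peak 1)%:E *
    \int[mu]_(x in `[a, +oo[) (bell_integrand (a^-1 - a) 1 x)%:E)%E.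
  rewrite integral_bell_y// -EFinM; congr EFin; congr (_ * _).
  by rewrite mul1r subrK mulrC.
rewrite -ge0_integralZl//; last 2 first.
- exact: (measurable_funTS (mbell _ _)).
- by move=> x /=; rewrite in_itv/= andbT => ax; rewrite lee_fin f0.
apply: ge0_le_integral => //.
- by move=> x _; rewrite mule_ge0// lee_fin ?normal_pdf_ge0.
- by apply: measurable_funTS; apply: emeasurable_funM => //; exact/measurable_EFinP.
- by apply: measurable_funTS; apply: measurable_funeM; exact: mbell.
- move=> x /=; rewrite in_itv/= andbT => ax.
  rewrite -!EFinM lee_fin normal_pdf1E mulrCA ler_wpM2l// /bell_integrand.
  rewrite ler_wpM2r ?(ltW (bell_gt0 _))//.
  rewrite (_ : _ - 1 = x * (x - a) + (x - a) / a); last by field; rewrite gt_eqF.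
  have := hle _ ax; have : 0 <= (x - a) / a by rewrite divr_ge0//; lra.
  by move: ((x - a) / a) => t; lra.
Qed.

Lemma normal_prob_scale (s : R) (A : set R) : 0 < s -> measurable A ->
  normal_prob 0%R s A = normal_prob 0%R 1%R ((fun x => s * x) @^-1` A).
Proof.
move=> s0 mA.
have mm : measurable_fun setT (fun x : R => s * x) by exact: measurable_funM.
have mA' : measurable ((fun x => s * x) @^-1` A).
  by rewrite -[X in measurable X]setTI; exact: mm.
have ind (t : R) (C : set R) : measurable C ->
    normal_prob 0 t C = (\int[normal_prob 0 t]_x (\1_C x)%:E)%E.
  by move=> mC; rewrite integral_indic// setIT.
have mind (C : set R) : measurable C -> measurable_fun setT (fun x => (\1_C x)%:E : \bar R).
  by move=> mC; exact/measurable_EFinP.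
have ind0 (C : set R) x : (0 <= (\1_C x)%:E :> \bar R)%E by rewrite lee_fin.
rewrite (ind s _ mA) (ind 1 _ mA').
rewrite (integral_normal_prob 0 s (mind _ mA) (ind0 A)) (integral_normal_prob 0 1 (mind _ mA') (ind0 _)).
rewrite (integral_affine 0 s0); last 2 first.
- by apply: emeasurable_funM; [exact: mind|apply/measurable_EFinP; exact: measurable_normal_pdf].
- by move=> x; rewrite mule_ge0// lee_fin ?normal_pdf_ge0.
rewrite -ge0_integralZl//; last 3 first.
- apply: emeasurable_funM.
    by apply: (measurableT_comp (mind _ mA)); under eq_fun do rewrite addr0.
  apply/measurable_EFinP; apply: measurableT_comp; first exact: measurable_normal_pdf.
  by under eq_fun do rewrite addr0.
- by move=> x _; rewrite mule_ge0// lee_fin ?normal_pdf_ge0.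
- by rewrite lee_fin ltW.
apply: eq_integral => x _; rewrite addr0 [LHS]muleCA; congr (_ * _)%E.
rewrite -EFinM; congr EFin; rewrite !normal_pdf0E ?oner_neq0 ?gt_eqF// mulrA; congr (_ * expR (- _)).
  rewrite /normal_peak expr1n mul1r -mulrnAr sqrtrM ?sqr_ge0// sqrtr_sqr gtr0_norm//.
  by rewrite invfM mulrA divff ?mul1r// gt_eqF.
by rewrite exprMn expr1n -mulr_natr; field; rewrite gt_eqF.
Qed.

End gaussian_tails.

(** * Numerical values of the exponential *)
Section exponential_bounds.
Context (R : realType).

(** Halving the argument repeatedly leads to arguments at which the tangent at 0
    is precise enough; each squaring is rounded down to eight decimals. *)
Lemma expR_ge_half (q a x : R) : 0 <= q -> a <= q ^+ 2 -> q <= expR (x / 2) -> a <= expR x.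
Proof.
move=> q0 aq qx; rewrite (splitr x) expRD -expr2 (le_trans aq)// lerXn2r ?nnegrE ?expR_ge0//.
Qed.

Lemma expR_leg : 165 / 1000 <= expR (- (17956 / 100 / 100)) :> R.
Proof.
apply: (@expR_ge_half ((4068 + 2087 / 100 / 100) / 100 / 100)); [lra|lra|].
apply: (@expR_ge_half ((6378 + 2511 / 100 / 100) / 100 / 100)); [lra|lra|].
apply: (@expR_ge_half ((7986 + 3954 / 100 / 100) / 100 / 100)); [lra|lra|].
apply: (@expR_ge_half ((8936 + 6635 / 100 / 100) / 100 / 100)); [lra|lra|].
apply: (@expR_ge_half ((9453 + 3928 / 100 / 100) / 100 / 100)); [lra|lra|].
apply: (@expR_ge_half ((9722 + 8560 / 100 / 100) / 100 / 100)); [lra|lra|].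
apply: (@expR_ge_half ((9860 + 4544 / 100 / 100) / 100 / 100)); [lra|lra|].
apply: (@expR_ge_half ((9929 + 9821 / 100 / 100) / 100 / 100)); [lra|lra|].
apply: (@expR_ge_half ((9964 + 9296 / 100 / 100) / 100 / 100)); [lra|lra|].
by apply: le_trans (expR_ge1Dx _); lra.
Qed.

Lemma expR_bridge : 372 * 100 <= expR (1056 / 100) :> R.
Proof.
apply: (@expR_ge_half (193 + (7226 + 764 / 100 / 100) / 100 / 100)); [lra|lra|].
apply: (@expR_ge_half (13 + (9184 + 2691 / 100 / 100) / 100 / 100)); [lra|lra|].
apply: (@expR_ge_half (3 + (7307 + 4080 / 100 / 100) / 100 / 100)); [lra|lra|].
apply: (@expR_ge_half (1 + (9315 + 1257 / 100 / 100) / 100 / 100)); [lra|lra|].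
apply: (@expR_ge_half (1 + (3897 + 8868 / 100 / 100) / 100 / 100)); [lra|lra|].
apply: (@expR_ge_half (1 + (1788 + 9299 / 100 / 100) / 100 / 100)); [lra|lra|].
apply: (@expR_ge_half (1 + (857 + 6839 / 100 / 100) / 100 / 100)); [lra|lra|].
apply: (@expR_ge_half (1 + (420 + 211 / 100 / 100) / 100 / 100)); [lra|lra|].
apply: (@expR_ge_half (1 + (207 + 8505 / 100 / 100) / 100 / 100)); [lra|lra|].
apply: (@expR_ge_half (1 + (103 + 3908 / 100 / 100) / 100 / 100)); [lra|lra|].
apply: (@expR_ge_half (1 + (51 + 5625 / 100 / 100) / 100 / 100)); [lra|lra|].
by apply: le_trans (expR_ge1Dx _); lra.
Qed.

Lemma expR_excess : 523 / 100 <= expR (16928 / 100 / 100) :> R.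
Proof.
apply: (@expR_ge_half (2 + (3057 + 3565 / 100 / 100) / 100 / 100)); [lra|lra|].
apply: (@expR_ge_half (1 + (5184 + 6490 / 100 / 100) / 100 / 100)); [lra|lra|].
apply: (@expR_ge_half (1 + (2322 + 6008 / 100 / 100) / 100 / 100)); [lra|lra|].
apply: (@expR_ge_half (1 + (1100 + 7211 / 100 / 100) / 100 / 100)); [lra|lra|].
apply: (@expR_ge_half (1 + (535 + 9960 / 100 / 100) / 100 / 100)); [lra|lra|].
apply: (@expR_ge_half (1 + (264 + 5000 / 100 / 100) / 100 / 100)); [lra|lra|].
by apply: le_trans (expR_ge1Dx _); lra.
Qed.

End exponential_bounds.

(** * Skeletons of the path *)
Section lipschitz_measurable.
Context (R : realType).

(** The set where the function exceeds a level is a countable union of boxes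
    with rational centers and radii. *)
Lemma lipschitz_measurable (N : nat) (C : R) (f : seqR R -> R) :
  (forall x y, f x <= f y + C * \sum_(i < N) `|x i - y i|) ->
  measurable_fun setT f.
Proof.
move=> fC; apply: (@measurability _ _ _ _ _ f (@RGenOInfty.G R)).
  exact: RGenOInfty.measurableE.
move=> _ [_ [a ->] <-]; rewrite setTI.
pose ratseq (q : seq rat) (i : nat) : R := ratr (nth 0 q i).
pose V (z : seq rat * rat) : set (seqR R) :=
  [set x | forall i, (i < N)%N -> `|x i - ratseq z.1 i| < ratr z.2].
have mV z : measurable (V z).
  rewrite (_ : V z = cyl N (fun i => [set v | `|v - ratseq z.1 i| < ratr z.2]))//.
  apply: measurable_cyl => i.
  rewrite (_ : mkset _ = ball (ratseq z.1 i) (ratr z.2 : R)); first exact: measurable_ball.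
  by apply/seteqP; split => v; rewrite /ball/= distrC.
rewrite (_ : f @^-1` `]a, +oo[ =
    \bigcup_(z in [set z | V z `<=` f @^-1` `]a, +oo[]) V z); last first.
  apply/seteqP; split => [x /= fx|x [z]]; last by apply.
  have {fx} fx : a < f x by move: fx; rewrite in_itv/= andbT.
  pose D : R := 1 + `|C| * N%:R * 2.
  have D0 : 0 < D by rewrite ltr_pwDl// !mulr_ge0.
  have ad0 : 0 < (f x - a) / D by rewrite divr_gt0// subr_gt0.
  have [e /[!in_itv]/= /andP[e0 ee]] := rat_in_itvoo ad0.
  have e2 : 0 < ratr e / 2 :> R by rewrite divr_gt0.
  have near_rat (v : R) : exists q : rat, `|v - ratr q| < ratr e.
    have [q /[!in_itv]/= /andP[q1 q2]] := @rat_in_itvoo _ (v - ratr e) (v + ratr e) ltac:(lra).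
    by exists q; rewrite ltr_norml; apply/andP; split; lra.
  have [q hq] := choice (fun i => near_rat (x i)).
  pose z := (mkseq q N, e).
  have zq i : (i < N)%N -> ratseq z.1 i = ratr (q i).
    by move=> iN; rewrite /ratseq nth_mkseq.
  exists z; last by move=> i iN; rewrite zq.
  move=> y yz /=; rewrite in_itv/= andbT.
  suff : C * \sum_(i < N) `|x i - y i| < f x - a by have := fC x y; lra.
  have S0 : 0 <= \sum_(i < N) `|x i - y i| by exact: sumr_ge0.
  have SN : \sum_(i < N) `|x i - y i| <= N%:R * (ratr e * 2).
    rewrite mulr_natl -[X in _ *+ X]card_ord -sumr_const; apply: ler_sum => i _.
    rewrite (_ : x i - y i = (x i - ratr (q i)) - (y i - ratr (q i))); last by ring.
    rewrite (le_trans (ler_normB _ _))// mulr_natr mulr2n lerD//; first exact/ltW.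
    by rewrite -zq//; exact/ltW/yz.
  have h1 : C * \sum_(i < N) `|x i - y i| <= `|C| * (N%:R * (ratr e * 2)).
    apply: (le_trans (ler_norm _)); rewrite normrM (ger0_norm S0).
    exact: ler_wpM2l.
  apply: (le_lt_trans h1).
  have : ratr e * D < f x - a by rewrite -ltr_pdivlMr.
  by rewrite /D mulrDr mulr1; lra.
rewrite bigcup_mkcond; apply: countable_bigcupT_measurable.
  exact: countableP.
by move=> z; case: ifP.
Qed.

End lipschitz_measurable.

Section skeleton.
Context (R : realType) (M : nat).
Implicit Types (x y : seqR R).

(** The points at times j / M of the path whose increments are the entries of
    the sequence, first those of one coordinate and then those of the other. *)
Definition skel_point x j : 'rV[R]_2 := mkpoint (walk x 0 j) (walk x M j).
Definition skeleton x : set 'rV[R]_2 := [set skel_point x j | j in `I_M.+1].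
Definition skel_inradius x : R := inradius (convex_hull (skeleton x)).

Lemma skeleton_nonempty x : skeleton x !=set0.
Proof. by exists (skel_point x 0), 0%N. Qed.

Lemma skeleton_strip x : exists j k, [/\ (j <= M)%N, (k <= M)%N &
  in_strip (skeleton x) (walk x 0 j) (walk x 0 k)].
Proof.
pose f (i : 'I_M.+1) := walk x 0 i.
exists [arg min_(i < ord0) f i]%O, [arg max_(i > ord0) f i]%O; split.
- by rewrite -ltnS.
- by rewrite -ltnS.
- case: arg_minP => // i _ imin; case: arg_maxP => // k _ kmax.
  move=> _ [j jM <-]; rewrite mkpoint0.
  by have := imin (Ordinal jM) isT; have := kmax (Ordinal jM) isT; rewrite /f/= => -> ->.
Qed.

Lemma skel_inradius_ge0 x : 0 <= skel_inradius x.
Proof.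
have [j [k [_ _ h]]] := skeleton_strip x.
exact: inradius_ge0 (skeleton_nonempty x) h.
Qed.

Lemma skel_inradius_range x : exists j k, [/\ (j <= M)%N, (k <= M)%N &
  skel_inradius x * 2 <= walk x 0 k - walk x 0 j].
Proof.
have [j [k [jM kM h]]] := skeleton_strip x; exists j, k; split => //.
have := inradius_width (skeleton_nonempty x) h.
by rewrite -/(skel_inradius x); lra.
Qed.

Lemma skel_inradius_dilation x y (lambda delta : R) : 0 < lambda -> 0 <= delta ->
  (forall j, (j <= M)%N -> (walk y 0 j - lambda * walk x 0 j) ^+ 2 +
     (walk y M j - lambda * walk x M j) ^+ 2 <= delta ^+ 2) ->
  skel_inradius y <= lambda * skel_inradius x + delta.
Proof.
move=> l0 d0 h; have [j [k [_ _ hs]]] := skeleton_strip x.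
apply: (inradius_dilation (skeleton_nonempty x) (skeleton_nonempty y) hs) => //.
move=> _ [i iM <-]; exists (skel_point x i); first by exists i.
by rewrite !mkpoint0 !mkpoint1 h.
Qed.

Lemma walk_add x o m n : walk x o (m + n) = walk x o m + walk x (o + m) n.
Proof.
elim: n => [|n IH]; first by rewrite addn0 /walk big_ord0 addr0.
by rewrite addnS !walkS IH addrA addnA.
Qed.

Lemma walk_ge0 x o n : (forall i, 0 <= x i) -> 0 <= walk x o n.
Proof. by move=> x0; apply: sumr_ge0. Qed.

Lemma walk_lipschitz x y o n : (o + n <= M + M)%N ->
  `|walk x o n - walk y o n| <= \sum_(i < M + M) `|x i - y i|.
Proof.
move=> onM; rewrite /walk -sumrB (le_trans (ler_norm_sum _ _ _))//.
pose d : seqR R := fun i => `|x i - y i|.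
have d0 i : 0 <= d i by exact: normr_ge0.
rewrite -[leLHS]/(walk d o n) -[leRHS]/(walk d 0 (M + M)) -(subnKC onM) !walk_add.
by rewrite -addrA addrCA lerDl addr_ge0// walk_ge0.
Qed.

Lemma measurable_skel_inradius : measurable_fun setT skel_inradius.
Proof.
apply: (@lipschitz_measurable _ (M + M) 2) => x y.
set d := \sum_(i < M + M) _; have d0 : 0 <= d by exact: sumr_ge0.
rewrite -[skel_inradius y]mul1r; apply: skel_inradius_dilation => //.
  by rewrite mulr_ge0.
move=> j jM; rewrite !mul1r.
have sq o : (o + j <= M + M)%N -> (walk x o j - walk y o j) ^+ 2 <= d ^+ 2.
  by move=> h; rewrite -real_normK ?num_real// lerXn2r ?nnegrE// walk_lipschitz.
have := sq 0 (leq_trans jM (leq_addr _ _)); have := sq M (leq_add (leqnn M) jM).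
have := sqr_ge0 d; lra.
Qed.

End skeleton.

(** * The upper bound for skeletons *)
Section upper_bound.
Context (R : realType).

Lemma block_sum_normal (N : nat) (s : R) (P : probability (seqR R) R) o k (A : set R) :
  0 < s -> iid_normal N s P -> (o + k < N)%N -> measurable A ->
  P [set x | A (walk x o k.+1)] =
  normal_prob 0 1 [set y | A (s * Num.sqrt k.+1%:R * y)].
Proof.
move=> s0 iidP okN mA.
have K0 : Num.sqrt k.+1%:R != 0 :> R by rewrite gt_eqF// sqrtr_gt0.
have mA' : measurable [set v : R | A (Num.sqrt k.+1%:R * v)].
  have mm : measurable_fun setT (fun v : R => Num.sqrt k.+1%:R * v).
    exact: measurable_funM.
  by rewrite -[X in measurable X]setTI; exact: mm.
have := block_sum_law (lt0r_neq0 s0) iidP okN mA'.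
rewrite normal_prob_scale// => h.
transitivity (P [set x | [set v : R | A (Num.sqrt k.+1%:R * v)] (walk x o k.+1 / Num.sqrt k.+1%:R)]).
  by congr (P _); apply/seteqP; split => x /=; rewrite mulrCA divff// mulr1.
rewrite h; congr (normal_prob _ _ _).
by apply/seteqP; split => y; rewrite /= mulrA [s * _]mulrC.
Qed.

(** The integral of a nonnegative function is the integral of its tail. *)
Lemma ge0_integral_tail_le d (T : measurableType d) (P : probability T R)
    (X Y : T -> R) (C : R) : 0 <= C -> measurable_fun setT X -> measurable_fun setT Y ->
  (forall w, 0 <= X w) -> (forall w, 0 <= Y w) ->
  (forall t : R, 0 <= t -> (P [set w | (t < X w)%R] <= C%:E * P [set w | (t < Y w)%R])%E) ->
  (\int[P]_w (X w)%:E <= C%:E * \int[P]_w (Y w)%:E)%E.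
Proof.
move=> C0 mX mY X0 Y0 XY.
pose X' : {RV P >-> R} := mfun_Sub (mem_set mX).
pose Y' : {RV P >-> R} := mfun_Sub (mem_set mY).
have := @ge0_expectation_ccdf _ _ _ P X' X0; rewrite expectation_def => ->.
have := @ge0_expectation_ccdf _ _ _ P Y' Y0; rewrite expectation_def => ->.
rewrite -ge0_integralZl//; last first.
  by apply: measurable_funTS; exact: ccdf_measurable.
apply: ge0_le_integral => //.
- by apply: measurable_funTS; exact: ccdf_measurable.
- by apply: measurable_funTS; apply: measurable_funeM; exact: ccdf_measurable.
move=> t; rewrite /= in_itv/= andbT => t0.
have := XY t t0; rewrite /ccdf /distribution /pushforward.
have e (Z : T -> R) : Z @^-1` `]t, +oo[ = [set w | t < Z w].
  by apply/seteqP; split => w; rewrite /= in_itv/= andbT.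
by rewrite -!e.
Qed.

Section excess.
Variables (M : nat) (P : probability (seqR R) R).
Hypothesis iidP : iid_normal (M.+1 + M.+1) (Num.sqrt M.+1%:R)^-1 P.
Variable a : R.
Hypothesis a0 : 0 < a.

Lemma step_gt0 : 0 < (Num.sqrt M.+1%:R)^-1 :> R.
Proof. by rewrite invr_gt0 sqrtr_gt0. Qed.

(** For a = 4 c, this is the positive part of (y / 2 - c) ^ 2 - c ^ 2, where y
    stands for twice the inradius. *)
Definition excess (y : R) : R := if y <= a then 0 else (y ^+ 2 - a * y) / 4.

Lemma excess_ge0 y : 0 <= excess y.
Proof.
rewrite /excess; case: (leP y a) => // ay; rewrite divr_ge0//.
by rewrite expr2 -mulrBl; apply: mulr_ge0; have := a0; lra.
Qed.

Lemma measurable_excess : measurable_fun setT excess.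
Proof.
rewrite /excess; apply: measurable_fun_ifT => //.
  exact: measurable_fun_ler.
apply: measurable_funM => //; apply: measurable_funB; first exact: measurable_funX.
exact: measurable_funM.
Qed.

Lemma terminal_integral (h : R -> R) : measurable_fun setT h -> (forall y, 0 <= h y) ->
  (\int[P]_x (h (walk x 0 M.+1))%:E = \int[normal_prob 0%R 1%R]_y (h y)%:E)%E.
Proof.
move=> mh h0.
have mW : measurable_fun setT (fun x : seqR R => walk x 0 M.+1 : measurableTypeR R).
  exact: measurable_walk.
transitivity (\int[image_measure P mW]_y (h y)%:E)%E.
  by rewrite integral_image_measure//; exact/measurable_EFinP.
apply: eq_measure_integral => A mA _.
rewrite /= /pushforward.
have := @block_sum_normal _ _ P 0 M A step_gt0 iidP (leq_addr _ _) mA.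
rewrite mulVf ?gt_eqF ?sqrtr_gt0// => e; rewrite [LHS]e; congr normal_prob.
by apply/seteqP; split => y; rewrite /= mul1r.
Qed.

(** Twice the inradius is at most the range of the first coordinate, whose tail is
    that of the endpoint up to a factor; the excess exceeds t exactly beyond a
    level, so that the tails of the excesses compare in the same way. *)
Lemma skel_excess : (\int[P]_x (excess (skel_inradius M.+1 x * 2))%:E <=
   (2 * (normal_peak 1 * (bell a / a)))%:E)%E.
Proof.
pose X x := excess (skel_inradius M.+1 x * 2).
pose Y (x : seqR R) := excess (walk x 0 M.+1).
have mX : measurable_fun setT X.
  apply: (measurableT_comp measurable_excess).
  by apply: measurable_funM => //; exact: measurable_skel_inradius.
have mY : measurable_fun setT Y.
  by apply: (measurableT_comp measurable_excess); exact: measurable_walk.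
apply: (@le_trans _ _ (8%:E * \int[P]_x (Y x)%:E)%E).
  apply: ge0_integral_tail_le => //; try by move=> x; exact: excess_ge0.
  move=> t t0.
  (* the excess takes the value t at b, so that it exceeds t beyond b *)
  pose b := (a + Num.sqrt (a ^+ 2 + 16 * t)) / 2.
  have sq2 : Num.sqrt (a ^+ 2 + 16 * t) ^+ 2 = a ^+ 2 + 16 * t.
    by rewrite sqr_sqrtr// addr_ge0 ?sqr_ge0 ?mulr_ge0.
  have sqa : a <= Num.sqrt (a ^+ 2 + 16 * t).
    by rewrite -[leLHS]gtr0_norm// -sqrtr_sqr ler_wsqrtr// lerDl mulr_ge0.
  have ab : a <= b by rewrite /b ler_pdivlMr//; lra.
  have b2 : b * (b - a) = 4 * t.
    by rewrite /b; move: sq2; move: (Num.sqrt _) => q q2; lra.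
  have level y : (t < excess y) = (b < y).
    rewrite /excess; case: (leP y a) => ya; first by rewrite !ltNge t0 (le_trans ya ab).
    rewrite ltr_pdivlMr//; apply/idP/idP => h.
      rewrite ltNge; apply/negP => yb.
      have : y * (y - a) <= b * (b - a) by apply: ler_pM; have := a0; lra.
      lra.
    have : b * (b - a) < y * (y - a) by apply: ltr_pM; have := a0; lra.
    lra.
  apply: (@le_trans _ _ (P [set x | exists j k,
      [/\ (j <= M.+1)%N, (k <= M.+1)%N & (b < walk x 0 k - walk x 0 j)%R]])).
    apply: le_measure; rewrite ?inE.
    - exact: measurable_gt.
    - rewrite (_ : mkset _ = \bigcup_(j in `I_M.+2) \bigcup_(k in `I_M.+2)
        [set x : seqR R | b < walk x 0 k - walk x 0 j]).
        by apply: bigcup_measurable => k _; apply: bigcup_measurable => j _; exact: measurable_walkB_gt.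
      apply/seteqP; split => x.
        by move=> [j [k [jM kM h]]]; exists j => //; exists k.
      by move=> [j jM [k kM h]]; exists j, k.
    - move=> x /=; rewrite level => h.
      have [j [k [jM kM h']]] := skel_inradius_range M.+1 x.
      by exists j, k; split => //; exact: lt_le_trans h'.
  apply: (le_trans (walk_range_tail (lt0r_neq0 step_gt0) iidP M.+1 b)).
  rewrite lee_wpmul2l// (_ : [set x | t < Y x] = [set x | b < walk x 0 M.+1])//.
  by apply/seteqP; split => x /=; rewrite /Y level.
rewrite terminal_integral//; [|exact: measurable_excess|exact: excess_ge0].
have h : (\int[normal_prob 0%R 1%R]_y (4 * excess y)%:E <=
    (normal_peak 1 * (bell a / a))%:E)%E.
  apply: normal_excess_le => //.
  - by apply: measurable_funM => //; exact: measurable_excess.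
  - by move=> y; rewrite mulr_ge0// excess_ge0.
  - by move=> y ya; rewrite /excess ltW// mulr0.
  - move=> y ay; rewrite /excess; case: (leP y a) => ya; last by rewrite mulrC divfK.
    by rewrite mulr0 subr_ge0 expr2 ler_wpM2r//; have := a0; lra.
move: h; under eq_integral do rewrite EFinM.
rewrite ge0_integralZl//; last 2 first.
  by apply/measurable_EFinP; exact: measurable_excess.
  by move=> y _; rewrite lee_fin excess_ge0.
move=> h.
rewrite (_ : 8%:E = 2%:E * 4%:E)%E; last by rewrite -EFinM -natrM.
by rewrite -muleA EFinM lee_wpmul2l.
Qed.

(** As F >= 0, the square exceeds c ^ 2 only for F > 2 c, and then by the excess. *)
Lemma skel_second_moment c : a = 4 * c ->
  (\int[P]_x ((skel_inradius M.+1 x - c) ^+ 2)%:E <= (c ^+ 2 + bell a / a)%:E)%E.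
Proof.
move=> ac; pose X x := excess (skel_inradius M.+1 x * 2).
have mF := @measurable_skel_inradius R M.+1.
have mX : measurable_fun setT X.
  by apply: (measurableT_comp measurable_excess); exact: measurable_funM.
apply: (@le_trans _ _ (\int[P]_x ((c ^+ 2)%:E + (X x)%:E))%E).
  apply: ge0_le_integral => //.
  - by move=> x _; rewrite lee_fin sqr_ge0.
  - apply/measurable_EFinP; apply: measurable_funX; exact: measurable_funB.
  - by apply: emeasurable_funD => //; exact/measurable_EFinP.
  - move=> x _; rewrite -EFinD lee_fin /X /excess.
    have F0 := skel_inradius_ge0 M.+1 x.
    have [h|h] := leP (skel_inradius M.+1 x * 2) a.
      rewrite addr0 -subr_ge0 (_ : _ - _ = skel_inradius M.+1 x * (c *+ 2 - skel_inradius M.+1 x)).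
        by rewrite mulr_ge0//; lra.
      by ring.
    rewrite -subr_ge0 le_eqVlt; apply/orP; left; apply/eqP.
    by rewrite ac; field.
rewrite ge0_integralD//; last 3 first.
- by move=> x _; rewrite lee_fin sqr_ge0.
- by move=> x _; rewrite lee_fin excess_ge0.
- exact/measurable_EFinP.
rewrite integral_cst// [X in (_ * X)%E]probability_setT mule1 EFinD leeD2l//.
apply: (le_trans skel_excess); rewrite lee_fin mulrA ler_piMl//.
  by rewrite divr_ge0 ?(ltW a0)// ltW// bell_gt0.
by have := @normal_peak1_le R; lra.
Qed.

End excess.

End upper_bound.

(** * Independence of block sums *)
Section blocks.
Context (R : realType) (k : nat).
Implicit Types (x : seqR R).

Definition block_sum (b : nat) x : R := walk x (b * k.+1) k.+1.
Definition block_coord (b : nat) x : R := block_sum b x / Num.sqrt k.+1%:R.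

Lemma measurable_block_coord b : measurable_fun setT (block_coord b).
Proof. by apply: measurable_funM => //; exact: measurable_walk. Qed.

Lemma block_sum_shrink b n lambda x : b != n ->
  block_sum b (shrink (n * k.+1) k lambda x) = block_sum b x.
Proof.
move=> bn; apply: eq_bigr => i _; rewrite /shrink /block.
suff -> : (n * k.+1 <= b * k.+1 + i <= n * k.+1 + k)%N = false by rewrite mulr0 addr0.
apply/negbTE/negP => /andP[nb bn'].
have ik := ltn_ord i.
by move: bn; rewrite neq_ltn => /orP[h|h]; have := leq_mul2r k.+1 b.+1 n; have := leq_mul2r k.+1 n.+1 b;
  rewrite h orbT !mulSn; lia.
Qed.

Section law.
Variables (N : nat) (s : R) (P : probability (seqR R) R).
Hypotheses (s0 : 0 < s) (iidP : iid_normal N s P).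

Let last_block n : (n.+1 * k.+1 <= N)%N -> (n * k.+1 + k < N)%N.
Proof. by rewrite mulSn; lia. Qed.

(** Shrinking the means of all blocks to zero leaves only what is independent
    of the block sums; peeling the blocks off one at a time shows that they are
    independent. *)
Lemma block_coord_indep n (A : nat -> set R) : (n * k.+1 <= N)%N ->
  (forall b, measurable (A b)) ->
  P [set x | forall b, (b < n)%N -> A b (block_coord b x)] =
  (\prod_(b < n) normal_prob 0%R s (A b))%E.
Proof.
move=> nN mA.
pose U n := [set x : seqR R | forall b, (b < n)%N -> A b (block_coord b x)].
have mB b : measurable [set x : seqR R | A b (block_coord b x)].
  by rewrite -[X in measurable X]setTI; exact: measurable_block_coord.
have mU m : measurable (U m).
  rewrite (_ : U m = \bigcap_(b in `I_m) [set x | A b (block_coord b x)])//.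
  exact: bigcap_measurableType.
rewrite -/(U n); elim: n nN => [_|n IH nN].
  by rewrite big_ord0 (_ : U 0 = setT) ?probability_setT//; apply/seteqP; split.
have nN' : (n * k.+1 <= N)%N by rewrite (leq_trans _ nN)// leq_mul2r leqnSn orbT.
have Ushr x : U n (shrink (n * k.+1) k 0 x) = U n x.
  apply/propext; split => h b bn; have := h b bn;
    by rewrite /block_coord block_sum_shrink ?ltn_eqF.
rewrite big_ord_recr/= -(IH nN').
have ind d (T : measurableType d) (Q : probability T R) (C : set T) :
    measurable C -> (\int[Q]_z (\1_C z)%:E)%E = Q C.
  by move=> mC; rewrite integral_indic// setIT.
have m1 d (T : measurableType d) (C : set T) : measurable C ->
    measurable_fun setT (fun z => (\1_C z)%:E : \bar R).
  by move=> mC; apply/measurable_EFinP; exact: measurable_indic.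
have h := @integral_block_indep R N s P (lt0r_neq0 s0) iidP (fun x => (\1_(U n) x)%:E)
  (fun z => (\1_(A n) z)%:E) _ k (last_block nN) (m1 _ _ _ (mU n)) (fun=> ltac:(by rewrite lee_fin))
  (m1 _ _ _ (mA n)) (fun=> ltac:(by rewrite lee_fin)).
rewrite ind// in h.
transitivity (\int[P]_x (\1_(A n) (block_coord n x) * \1_(U n) (shrink (n * k.+1) k 0 x))%:E)%E.
  rewrite -ind//; apply: eq_integral => x _; rewrite !indicE -natrM mulnb.
  congr (_ %:R)%:E; congr nat_of_bool; apply/idP/idP.
    move=> /set_mem Ux; apply/andP; split; apply/mem_set; first exact: Ux.
    by rewrite Ushr => b bn; apply: Ux; exact: ltnW.
  move=> /andP[/set_mem An /set_mem]; rewrite Ushr => Un; apply/mem_set => b.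
  by rewrite ltnS leq_eqVlt => /orP[/eqP->//|]; exact: Un.
rewrite muleC; under eq_integral do rewrite EFinM.
rewrite [LHS]h; congr (_ * _)%E.
  transitivity (\int[P]_x (\1_(U n) x)%:E)%E; last by rewrite ind.
  apply: eq_integral => x _; rewrite !indicE; congr (nat_of_bool _)%:R%:E.
  by apply/idP/idP => /set_mem h'; apply/mem_set; move: h'; rewrite Ushr.
exact: mA.
Qed.

End law.
End blocks.

(** * A triangle inscribed in the skeleton *)
Section triangle.
Context (R : realType).

(** Here 21 / 625 = 0.0336 bounds the excess of the hypotenuse with legs P and 0.3
    over P. The third side s3 is chosen such that the three sides have sum
    (P W - 0.09) / 0.33, for which the area estimate gives the inradius 0.33. *)
Lemma legs_perimeter (P W : R) : 134 / 100 <= P -> 134 / 100 <= W ->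
  let s3 := (P * W - (3 / 10) ^+ 2) / (33 / 100) - (P + 21 / 625) - (W + 21 / 625) in
  [/\ P ^+ 2 + (3 / 10) ^+ 2 <= (P + 21 / 625) ^+ 2,
      W ^+ 2 + (3 / 10) ^+ 2 <= (W + 21 / 625) ^+ 2,
      0 < s3, 0 < P * W - (3 / 10) ^+ 2 &
      (P + 3 / 10) ^+ 2 + (W + 3 / 10) ^+ 2 <= s3 ^+ 2].
Proof.
pose e : R := 21 / 625.
move=> P0 W0 s3.
pose u := P - 134 / 100; pose v := W - 134 / 100.
have u0 : 0 <= u by rewrite /u subr_ge0.
have v0 : 0 <= v by rewrite /v subr_ge0.
have PE : P = 134 / 100 + u by rewrite /u addrC subrK.
have WE : W = 134 / 100 + v by rewrite /v addrC subrK.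
have uv : 0 <= u * v by exact: mulr_ge0.
have uu : 0 <= u * u by exact: mulr_ge0.
have vv : 0 <= v * v by exact: mulr_ge0.
have s3E : s3 = (134 / 100 * (u + v) + u * v + (1066 / 625)) / (33 / 100) - (1717 / 625 + u + v).
  by rewrite /s3 PE WE; field.
move: s3E PE WE uv uu vv u0 v0; clearbody u v s3; clear P0 W0 => s3E -> -> uv uu vv u0 v0.
have lin : 242 / 100 + 306 / 100 * (u + v) <= s3 by rewrite s3E; lra.
split; [lra|lra|lra|lra|].
apply: (@le_trans _ _ ((242 / 100 + 306 / 100 * (u + v)) ^+ 2)); first lra.
clear s3E; have := lin; set w := 242 / 100 + _; have : 0 <= w by rewrite /w; lra.
by clearbody w => w0 ws; rewrite lerXn2r// nnegrE (le_trans w0).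
Qed.

(** The triangle with vertices 0, W(1/2) and W(1), when both legs are at least
    1.34 long and almost parallel to distinct axes. *)
Lemma inradius_legs A p q r (lo hi P W : R) : in_strip A lo hi -> A p -> A q -> A r ->
  134 / 100 <= P -> 134 / 100 <= W ->
  (q 0 0 - p 0 0) ^+ 2 + (q 0 1 - p 0 1) ^+ 2 <= P ^+ 2 + (3 / 10) ^+ 2 ->
  (r 0 0 - q 0 0) ^+ 2 + (r 0 1 - q 0 1) ^+ 2 <= W ^+ 2 + (3 / 10) ^+ 2 ->
  (p 0 0 - r 0 0) ^+ 2 + (p 0 1 - r 0 1) ^+ 2 <= (P + 3 / 10) ^+ 2 + (W + 3 / 10) ^+ 2 ->
  P * W - (3 / 10) ^+ 2 <=
    `| (q 0 0 - p 0 0) * (r 0 1 - q 0 1) - (q 0 1 - p 0 1) * (r 0 0 - q 0 0) | ->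
  33 / 100 <= inradius (convex_hull A).
Proof.
move=> Alh Ap Aq Ar P0 W0 h1 h2 h3 cr.
have [] := legs_perimeter P0 W0; set s3 := (X in X - _ - _ ) => sP sW s30 PW s3P.
have pos (x : R) : 134 / 100 <= x -> 0 < x + 21 / 625.
  by clear => x0; lra.
apply: (le_trans _ (inradius_triangle Alh Ap Aq Ar (pos _ P0) (pos _ W0) s30
  (le_trans h1 sP) (le_trans h2 sW) (le_trans h3 s3P))).
rewrite (_ : _ + _ + _ = s3); last by ring.
by rewrite ler_pdivlMr; [rewrite mulrC divfK|apply: divr_gt0].
Qed.

Lemma skel_legs H (x : seqR R) (a1 a2 b1 b2 : R) :
  a1 = walk x 0 H -> a2 = walk x H H -> b1 = walk x (H + H) H ->
  b2 = walk x (H + H + H) H ->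
  [/\ 134 / 100 <= `|a1|, `|a2| <= 3 / 10, `|b1| <= 3 / 10 & 134 / 100 <= `|b2| ] \/
  [/\ `|a1| <= 3 / 10, 134 / 100 <= `|a2|, 134 / 100 <= `|b1| & `|b2| <= 3 / 10 ] ->
  33 / 100 <= skel_inradius (H + H) x.
Proof.
move=> e1 e2 e3 e4 h.
have [j [k [_ _ hs]]] := skeleton_strip (H + H) x.
have pt n : (n <= H + H)%N -> skeleton (H + H) x (skel_point (H + H) x n) by move=> nM; exists n.
have p0 : skel_point (H + H) x 0 = mkpoint 0 0 by rewrite /skel_point /walk !big_ord0.
have p1 : skel_point (H + H) x H = mkpoint a1 b1 by rewrite /skel_point -e1 -e3.
have p2 : skel_point (H + H) x (H + H) = mkpoint (a1 + a2) (b1 + b2).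
  by rewrite /skel_point !walk_add -e1 -e3 !add0n -e2 -e4.
have sq (c u : R) : `|c| <= u -> c ^+ 2 <= u ^+ 2.
  by move=> cu; rewrite -real_normK ?num_real// lerXn2r ?nnegrE// (le_trans _ cu).
have cross (u v w z : R) : `|v| <= 3 / 10 -> `|w| <= 3 / 10 ->
    `|u| * `|z| - (3 / 10) ^+ 2 <= `|u * z - v * w|.
  move=> hv hw; rewrite -normrM (le_trans _ (lerB_dist _ _))// lerD2l lerN2 normrM expr2.
  by rewrite ler_pM.
have H0 := pt 0 (leq0n _); have H1 := pt H (leq_addr _ _); have H2 := pt _ (leqnn (H + H)).
case: h => -[h1 h2 h3 h4].
- apply: (inradius_legs hs H0 H1 H2 h1 h4); rewrite ?p0 ?p1 ?p2 !mkpoint0 !mkpoint1.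
  + by rewrite !subr0 real_normK ?num_real// lerD2l sq.
  + rewrite [a1 + a2]addrC addrK [b1 + b2]addrC addrK.
    by rewrite addrC real_normK ?num_real// lerD2l sq.
  + rewrite !sub0r !sqrrN lerD// sq// (le_trans (ler_normD _ _))//; lra.
  + by rewrite !subr0 [a1 + a2]addrC addrK [b1 + b2]addrC addrK; apply: cross.
- apply: (inradius_legs hs H0 H1 H2 h3 h2); rewrite ?p0 ?p1 ?p2 !mkpoint0 !mkpoint1.
  + by rewrite !subr0 addrC real_normK ?num_real// lerD2l sq.
  + rewrite [a1 + a2]addrC addrK [b1 + b2]addrC addrK.
    by rewrite real_normK ?num_real// lerD2l sq.
  + rewrite !sub0r !sqrrN addrC lerD// sq// (le_trans (ler_normD _ _))//; lra.
  + rewrite !subr0 [a1 + a2]addrC addrK [b1 + b2]addrC addrK distrC; exact: cross.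
Qed.

End triangle.

Section leg_probabilities.
Context (R : realType).

Lemma normal_prob_outside (a : R) : 0 < a ->
  ((normal_peak 1 * (2 * a / (1 + a ^+ 2) * bell a))%:E <=
   normal_prob 0%R 1%R [set v | (a <= `|v|)%R])%E.
Proof.
move=> a0.
have e : [set v : R | a <= `|v|] = `[a, +oo[ `|` -%R @^-1` `[a, +oo[.
  apply/seteqP; split => v /=; rewrite !in_itv/= !andbT ler_normr; first by move/orP.
  by move=> h; apply/orP.
have mA : measurable (`[a, +oo[%classic : set R) by exact: measurable_itv.
have mB : measurable (-%R @^-1` `[a, +oo[ : set R).
  by rewrite -[X in measurable X]setTI; exact: measurable_funN.
rewrite e measureU//; last first.
  by apply/seteqP; split => v //=; rewrite !in_itv/= !andbT => -[h1 h2]; lra.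
rewrite [X in (_ <= _ + X)%E](_ : _ = normal_prob 0 1 `[a, +oo[); last first.
  exact: (normal_probN (oner_neq0 R) mA).
have h := normal_tail_ge a0.
apply: (le_trans _ (leeD h h)); rewrite -EFinD lee_fin le_eqVlt; apply/orP; left.
by apply/eqP; ring.
Qed.

Lemma normal_prob_inside (a : R) : 0 < a ->
  ((normal_peak 1 * (2 * a * bell a))%:E <=
   normal_prob 0%R 1%R [set v | (`|v| <= a)%R])%E.
Proof.
move=> a0; rewrite (_ : mkset _ = `[- a, a]%classic); last first.
  by apply/seteqP; split => v; rewrite /= in_itv/= ler_norml.
have := @normal_interval_ge R (- a) a; rewrite opprK lexx (_ : a + a = 2 * a); last by ring.
by apply; lra.
Qed.

End leg_probabilities.

Section legs.
Context (R : realType) (h : nat) (P : probability (seqR R) R).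
Local Notation M := (h.+1 + h.+1)%N.
Hypothesis iidP : iid_normal (M + M) (Num.sqrt M%:R)^-1 P.

Definition leg_long : set R := [set v | 134 / 100 <= `|Num.sqrt h.+1%:R * v| ].
Definition leg_short : set R := [set v | `|Num.sqrt h.+1%:R * v| <= 3 / 10].

Lemma leg_scale (v : R) :
  Num.sqrt h.+1%:R * ((Num.sqrt M%:R)^-1 * v) = v / Num.sqrt 2.
Proof.
have hm : M%:R = 2 * h.+1%:R :> R by rewrite natrD; ring.
have q0 : Num.sqrt h.+1%:R != 0 :> R by rewrite gt_eqF// sqrtr_gt0.
have t0 : Num.sqrt 2 != 0 :> R by rewrite gt_eqF// sqrtr_gt0.
by rewrite hm sqrtrM//; field; rewrite q0 t0.
Qed.

Lemma leg_step_gt0 : 0 < (Num.sqrt M%:R)^-1 :> R.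
Proof. by rewrite invr_gt0 sqrtr_gt0 ltr0n addnS. Qed.

Let sqrt2_sqr : Num.sqrt 2 ^+ 2 = 2 :> R. Proof. by rewrite sqr_sqrtr. Qed.

Let sqrt2 : 14142 / 100 / 100 <= Num.sqrt 2 :> R.
Proof.
rewrite leNgt; apply/negP => lt2; have t0 := sqrtr_ge0 (2 : R).
have := ler_pM t0 t0 (ltW lt2) (ltW lt2); rewrite -expr2 sqrt2_sqr; lra.
Qed.

Let m_abs (f : R -> R) : measurable_fun setT f -> measurable_fun setT (fun v => `|f v|).
Proof. by move=> mf; exact: measurableT_comp. Qed.

Lemma measurable_leg_long : measurable leg_long.
Proof. by apply: measurable_ge; apply: m_abs; exact: measurable_funM. Qed.

Lemma measurable_leg_short : measurable leg_short.
Proof. by apply: measurable_le; apply: m_abs; exact: measurable_funM. Qed.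

Lemma leg_long_numeric (u b : R) : 14142 / 100 / 100 <= u -> 165 / 1000 <= b ->
  681 / 5000 <= 2 * (134 / 100 * u) / (5739 / 1250) * b.
Proof.
move=> hu hb; have : 14142 / 100 / 100 * (165 / 1000) <= u * b by apply: ler_pM; lra.
by lra.
Qed.

Lemma leg_short_numeric (u b : R) : 14142 / 100 / 100 <= u -> 91 / 100 <= b ->
  386 / 500 <= 2 * (3 / 10 * u) * b.
Proof.
move=> hu hb; have : 14142 / 100 / 100 * (91 / 100) <= u * b by apply: ler_pM; lra.
by lra.
Qed.

Lemma leg_long_prob : ((normal_peak 1 * (681 / 5000))%:E <=
  normal_prob 0%R (Num.sqrt M%:R)^-1 leg_long)%E.
Proof.
rewrite (normal_prob_scale leg_step_gt0 measurable_leg_long).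
have a0 : 0 < 134 / 100 * Num.sqrt 2 :> R by rewrite mulr_gt0// sqrtr_gt0.
have sq : (134 / 100 * Num.sqrt 2) ^+ 2 = 2 * (17956 / 100 / 100) :> R.
  by rewrite exprMn sqrt2_sqr; lra.
have -> : (fun v => (Num.sqrt M%:R)^-1 * v) @^-1` leg_long =
    [set v | 134 / 100 * Num.sqrt 2 <= `|v| ].
  apply/seteqP; split => v; rewrite /leg_long/= leg_scale normrM normfV
    [`|Num.sqrt 2|]ger0_norm ?sqrtr_ge0// ler_pdivlMr// sqrtr_gt0.
apply: le_trans (normal_prob_outside a0).
rewrite lee_fin ler_wpM2l ?normal_peak_ge0//.
have b : 165 / 1000 <= bell (134 / 100 * Num.sqrt 2) :> R.
  rewrite /bell sq [2 * _]mulrC mulfK//; exact: expR_leg.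
rewrite sq (_ : 1 + 2 * (17956 / 100 / 100) = 5739 / 1250 :> R); last by lra.
exact: leg_long_numeric sqrt2 b.
Qed.

Lemma leg_short_prob : ((normal_peak 1 * (386 / 500))%:E <=
  normal_prob 0%R (Num.sqrt M%:R)^-1 leg_short)%E.
Proof.
rewrite (normal_prob_scale leg_step_gt0 measurable_leg_short).
have a0 : 0 < 3 / 10 * Num.sqrt 2 :> R by rewrite mulr_gt0// sqrtr_gt0.
have -> : (fun v => (Num.sqrt M%:R)^-1 * v) @^-1` leg_short =
    [set v | `|v| <= 3 / 10 * Num.sqrt 2].
  apply/seteqP; split => v; rewrite /leg_short/= leg_scale normrM normfV
    [`|Num.sqrt 2|]ger0_norm ?sqrtr_ge0// ler_pdivrMr// sqrtr_gt0.
apply: le_trans (normal_prob_inside a0).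
rewrite lee_fin ler_wpM2l ?normal_peak_ge0//.
have b : 91 / 100 <= bell (3 / 10 * Num.sqrt 2) :> R.
  rewrite /bell exprMn sqrt2_sqr mulfK; last by rewrite pnatr_eq0.
  by apply: le_trans (expR_ge1Dx _); lra.
exact: leg_short_numeric sqrt2 b.
Qed.

(** The blocks 0 and 1 are the increments of the first coordinate over the two
    halves of the time interval, the blocks 2 and 3 those of the second one. *)
Definition leg_event (J : pred nat) : set (seqR R) := [set x | forall b, (b < 4)%N ->
  (if J b then leg_long else leg_short) (block_coord h b x)].

(** The product of the four probabilities, each of them at least the peak of the
    density times 2 * 0.0681 or 2 * 0.386; the fourth power of the peak is at
    least 1 / 64. *)
Lemma leg_event_prob (J : pred nat) : (\sum_(b < 4) J (nat_of_ord b) = 2)%N ->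
  ((345 / 10 ^+ 6 / 2)%:E <= P (leg_event J))%E.
Proof.
move=> J2.
have mA b : measurable (if J b then leg_long else leg_short).
  by case: (J b); [exact: measurable_leg_long|exact: measurable_leg_short].
rewrite /leg_event (block_coord_indep leg_step_gt0 iidP (A := fun b => if J b then leg_long else leg_short))//; last first.
  by rewrite 2!mulSn mul2n -addnn addnA.
pose c : R := normal_peak 1.
have c0 : 0 <= c by exact: normal_peak_ge0.
apply: (@le_trans _ _ (\prod_(b < 4) ((c * (if J (nat_of_ord b) then 681 / 5000 else 386 / 500))%:E)))%E.
  rewrite prodEFin lee_fin big_split/= prodr_const card_ord.
  rewrite (_ : \prod_(b < 4) _ = (681 / 5000) ^+ 2 * (386 / 500) ^+ 2); last first.
    move: J2; rewrite !big_ord_recr !big_ord0/=.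
    by case: (J 0%N); case: (J 1%N); case: (J 2); case: (J 3) => h4; try discriminate h4; lra.
  have : 1 / 64 <= c ^+ 4.
    have := @normal_peak1_ge R; rewrite -/c => cc.
    rewrite (_ : c ^+ 4 = (c ^+ 2) * (c ^+ 2)); last by ring.
    have -> : 1 / 64 = (1 / 8) * (1 / 8) :> R by lra.
    by apply: ler_pM; lra.
  move=> c4; apply: (@le_trans _ _ (1 / 64 * ((681 / 5000) ^+ 2 * (386 / 500) ^+ 2))).
    by lra.
  by apply: ler_wpM2r; lra.
suff /andP[] : ((0 <= \prod_(b < 4) (c * (if J (nat_of_ord b) then 681 / 5000 else 386 / 500))%:E) &&
    (\prod_(b < 4) (c * (if J (nat_of_ord b) then 681 / 5000 else 386 / 500))%:E <=
     \prod_(b < 4) normal_prob 0%R (Num.sqrt M%:R)^-1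
       (if J (nat_of_ord b) then leg_long else leg_short)))%E by [].
apply: (big_ind2 (fun u v : \bar R => (0 <= u) && (u <= v))%E).
- by rewrite lee01 lexx.
- move=> u1 v1 u2 v2 /andP[u10 uv1] /andP[u20 uv2].
  by rewrite mule_ge0//= lee_pmul.
- move=> b _; apply/andP; split.
    by rewrite lee_fin; apply: mulr_ge0 => //; case: (J b); lra.
  by case: (J b); [exact: leg_long_prob|exact: leg_short_prob].
Qed.

End legs.

(** * The second moment around small centers *)
Section small_center.
Context (R : realType) (h : nat) (P : probability (seqR R) R).
Local Notation M := (h.+1 + h.+1)%N.
Hypothesis iidP : iid_normal (M + M) (Num.sqrt M%:R)^-1 P.

Lemma leg_block_sum b (x : seqR R) :
  Num.sqrt h.+1%:R * block_coord h b x = walk x (b * h.+1) h.+1.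
Proof.
by rewrite /block_coord mulrC divfK// gt_eqF// sqrtr_gt0.
Qed.

Lemma leg_event_inradius (J : pred nat) (x : seqR R) : J =1 pred2 0%N 3 \/ J =1 pred2 1%N 2 ->
  leg_event h J x -> 33 / 100 <= skel_inradius M x.
Proof.
move=> hJ Jx.
have leg b : (b < 4)%N -> if J b then 134 / 100 <= `|walk x (b * h.+1) h.+1|
    else `|walk x (b * h.+1) h.+1| <= 3 / 10.
  move=> b4; have := Jx b b4; rewrite -leg_block_sum.
  by case: (J b).
have h0 := leg 0 isT; have h1 := leg 1 isT; have h2 := leg 2 isT; have h3 := leg 3 isT.
apply: (@skel_legs _ h.+1 x _ _ _ _ (erefl _) (erefl _) (erefl _) (erefl _)).
move: h0 h1 h2 h3; rewrite mul0n mul1n mul2n -addnn (_ : 3 * h.+1 = M + h.+1)%N; last first.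
  by rewrite mulSn mul2n -addnn addnA.
by case: hJ => E; rewrite !E /= => h0 h1 h2 h3; [left|right]; split.
Qed.

Lemma measurable_leg_event J : measurable (leg_event h J : set (seqR R)).
Proof.
rewrite (_ : leg_event h J = \bigcap_(b in `I_4)
    [set x | (if J b then leg_long h else leg_short h) (block_coord h b x)]); last first.
  by apply/seteqP; split.
apply: bigcap_measurableType => b _; rewrite -[X in measurable X]setTI.
apply: measurable_block_coord => //.
by case: (J b); [exact: measurable_leg_long|exact: measurable_leg_short].
Qed.

(** Either leg can be the horizontal one, which gives two disjoint events on
    which F - m >= 0.09. *)
Lemma small_center_second_moment (m : R) : m <= 24 / 100 ->
  ((27 / 10 / 10 ^+ 6)%:E <= \int[P]_x ((skel_inradius M x - m) ^+ 2)%:E)%E.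
Proof.
move=> m24.
pose E1 : set (seqR R) := leg_event h (pred2 0%N 3).
pose E2 : set (seqR R) := leg_event h (pred2 1%N 2).
have mE1 : measurable E1 by exact: measurable_leg_event.
have mE2 : measurable E2 by exact: measurable_leg_event.
have p1 : ((345 / 10 ^+ 6 / 2)%:E <= P E1)%E.
  by apply: leg_event_prob => //; rewrite !big_ord_recl big_ord0.
have p2 : ((345 / 10 ^+ 6 / 2)%:E <= P E2)%E.
  by apply: leg_event_prob => //; rewrite !big_ord_recl big_ord0.
have E12 : E1 `&` E2 = set0.
  apply/seteqP; split => // x [/(_ 0%N isT) h1 /(_ 0%N isT) h2].
  move: h1 h2; rewrite /= /leg_long /leg_short /= => h1 h2.
  by move: (le_trans h1 h2); lra.
have mU : measurable (E1 `|` E2) by exact: measurableU.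
have mF : measurable_fun setT (fun x => (skel_inradius M x - m) ^+ 2).
  by apply: measurable_funX; apply: measurable_funB => //; exact: measurable_skel_inradius.
apply: (@le_trans _ _ (\int[P]_x ((9 / 100) ^+ 2 * \1_(E1 `|` E2) x)%:E)%E); last first.
  apply: ge0_le_integral => //.
  - by apply/measurable_EFinP; apply: measurable_funM => //; exact: measurable_indic.
  - exact/measurable_EFinP.
  - move=> x _; rewrite lee_fin indicE.
    have [/set_mem hx|_] := boolP (x \in _); last by rewrite mulr0 sqr_ge0.
    rewrite mulr1.
    have r33 : 33 / 100 <= skel_inradius M x.
      by case: hx => hx; apply: leg_event_inradius hx; [left|right].
    have : 9 / 100 <= skel_inradius M x - m by lra.
    by move=> h9; rewrite lerXn2r// nnegrE; lra.
under eq_integral do rewrite EFinM.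
rewrite ge0_integralZl//; last first.
  by apply/measurable_EFinP; exact: measurable_indic.
rewrite integral_indic// setIT measureU//.
apply: (@le_trans _ _ (((9 / 100) ^+ 2)%:E * ((345 / 10 ^+ 6 / 2)%:E + (345 / 10 ^+ 6 / 2)%:E)))%E.
  by rewrite -EFinD -EFinM lee_fin; lra.
by rewrite lee_wpmul2l ?leeD// lee_fin sqr_ge0.
Qed.

End small_center.

(** * Shrinking all blocks *)
Section contraction.
Context (R : realType) (k : nat).
Implicit Types (x : seqR R).
Local Notation K := k.+1.

(** All of the first n blocks are shrunk at once; the explicit formula shows the
    result as a combination of the sequence and its bridges. *)
Definition shrink_all n (lambda : R) x : seqR R := fun i =>
  if (i < n * K)%N then x i + (lambda - 1) * block_sum k ((i %/ K)%N) x / K%:R else x i.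

Lemma blockS_index n i : (n * K <= i < n.+1 * K)%N = ((i %/ K)%N == n).
Proof. by rewrite eqn_leq -[(_ %/ _ <= n)%N]ltnS ltn_divLR// leq_divRL// andbC. Qed.

Lemma shrink_all0 lambda x : shrink_all 0 lambda x = x.
Proof. by apply/funext => i; rewrite /shrink_all ltn0. Qed.

Lemma shrink_allS n lambda x :
  shrink_all n.+1 lambda x = shrink_all n lambda (shrink (n * K) k lambda x).
Proof.
apply/funext => i; rewrite /shrink_all.
have hin : block R (n * K) k i = ((i %/ K)%N == n)%:R :> R.
  by rewrite /block -blockS_index mulSn addSn addnC ltnS.
rewrite [shrink _ _ _ _ i]/shrink hin.
have [inK|nKi] := ltnP i (n * K).
  have ne : (i %/ K)%N != n by rewrite ltn_eqF// ltn_divLR.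
  by rewrite (ltn_trans inK) ?ltn_mul2r//= (negbTE ne) mulr0 addr0 block_sum_shrink.
rewrite -blockS_index nKi/=; case: ifP => h; last by rewrite mulr0 addr0.
have /eqP -> : ((i %/ K)%N == n) by rewrite -blockS_index nKi.
by rewrite mulr1.
Qed.

Lemma measurable_shrink_all n lambda : measurable_fun setT (shrink_all n lambda).
Proof.
elim: n => [|n IH].
  by rewrite (_ : shrink_all 0 lambda = id)//; apply/funext => x; exact: shrink_all0.
rewrite (_ : shrink_all n.+1 lambda = shrink_all n lambda \o shrink (n * K) k lambda).
  exact: (measurableT_comp IH (measurable_shrink _ _ _)).
by apply/funext => x; exact: shrink_allS.
Qed.

(** The image is the sequence dilated by lambda, up to its bridges, which do not
    depend on lambda. *)
Lemma shrink_all_affine n lambda x i :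
  shrink_all n lambda x i = lambda * x i + (1 - lambda) * shrink_all n 0 x i.
Proof. by rewrite /shrink_all; case: ifP => _; ring. Qed.

Lemma walk_shrink_all n lambda x o j : walk (shrink_all n lambda x) o j =
  lambda * walk x o j + (1 - lambda) * walk (shrink_all n 0 x) o j.
Proof.
rewrite /walk !mulr_sumr -big_split/=; apply: eq_bigr => i _.
exact: shrink_all_affine.
Qed.

Lemma block_sum_shrink_all n lambda x b : (b < n)%N ->
  block_sum k b (shrink_all n lambda x) = lambda * block_sum k b x.
Proof.
move=> bn; rewrite {1}/block_sum /walk.
rewrite (eq_bigr (fun i : 'I_K => x (b * K + i)%N + (lambda - 1) * block_sum k b x / K%:R)).
  rewrite big_split/= sumr_const card_ord -/(walk x (b * K) K) -/(block_sum k b x).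
  by rewrite -[X in _ + X]mulr_natr mulfVK// ?pnatr_eq0//; ring.
move=> i _; rewrite /shrink_all divnMDl// (divn_small (ltn_ord i)) addn0 ifT//.
have : (b.+1 * K <= n * K)%N by rewrite leq_mul2r bn orbT.
by apply: leq_trans; rewrite mulSn addnC ltn_add2r.
Qed.

Lemma shrink_all_shrink_all n lambda x : shrink_all n 0 (shrink_all n lambda x) = shrink_all n 0 x.
Proof.
apply/funext => i; rewrite {1}/shrink_all; case: ifP => inK; last by rewrite /shrink_all inK.
rewrite block_sum_shrink_all ?ltn_divLR// /shrink_all inK.
by ring.
Qed.

Lemma block_sum_shrink_all_out n lambda x b : (n <= b)%N ->
  block_sum k b (shrink_all n lambda x) = block_sum k b x.
Proof.
move=> nb; apply: eq_bigr => i _; rewrite /shrink_all ifN// -leqNgt.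
by rewrite (leq_trans _ (leq_addr _ _))// leq_mul2r nb orbT.
Qed.

Section law.
Variables (N : nat) (s : R) (P : probability (seqR R) R).
Hypotheses (s0 : 0 < s) (iidP : iid_normal N s P).

Definition shrink_all_density n (lambda : R) x : R :=
  \prod_(b < n) scaling_density s lambda (block_coord k b x).

Lemma shrink_all_density_ge0 n lambda x : 0 < lambda -> 0 <= shrink_all_density n lambda x.
Proof. by move=> l0; apply: prodr_ge0 => b _; exact: scaling_density_ge0. Qed.

Lemma measurable_shrink_all_density n lambda :
  measurable_fun setT (shrink_all_density n lambda).
Proof.
apply: measurable_prod => b _.
exact: (measurableT_comp (measurable_scaling_density s lambda) (@measurable_block_coord R k b)).
Qed.

Lemma integral_shrink_all (F : seqR R -> \bar R) n lambda : (n * K <= N)%N -> 0 < lambda ->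
  measurable_fun setT F -> (forall x, 0 <= F x)%E ->
  (\int[P]_x F (shrink_all n lambda x) = \int[P]_x (F x * (shrink_all_density n lambda x)%:E))%E.
Proof.
move=> nN l0 mF F0; elim: n nN F mF F0 => [_ F mF F0|n IH nN F mF F0].
  by apply: eq_integral => x _; rewrite shrink_all0 /shrink_all_density big_ord0 mule1.
have okN : (n * K + k < N)%N by rewrite -addnS addnC -mulSn.
have mL : measurable_fun setT (fun x => (shrink_all_density n lambda x)%:E).
  by apply/measurable_EFinP; exact: measurable_shrink_all_density.
under eq_integral do rewrite shrink_allS.
rewrite (integral_shrink (lt0r_neq0 s0) iidP (F := fun x => F (shrink_all n lambda x)))//; last first.
  exact: (measurableT_comp mF (measurable_shrink_all _ _)).
pose G x := (F x * (scaling_density s lambda (block_coord k n x))%:E)%E.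
transitivity (\int[P]_x G (shrink_all n lambda x))%E.
  by apply: eq_integral => x _; rewrite /G /block_coord block_sum_shrink_all_out.
rewrite IH.
- apply: eq_integral => x _; rewrite /G -muleA -EFinM; congr (_ * _%:E)%E.
  by rewrite /shrink_all_density big_ord_recr/= mulrC.
- by rewrite (leq_trans _ nN)// leq_mul2r leqnSn orbT.
- apply: emeasurable_funM => //; apply/measurable_EFinP.
  exact: (measurableT_comp (measurable_scaling_density s lambda) (@measurable_block_coord R k n)).
- by move=> x; rewrite mule_ge0// lee_fin scaling_density_ge0.
Qed.
End law.
End contraction.

(** * Bridges over the blocks *)
Lemma union_bound d (T : measurableType d) (R : realType) (P : probability T R)
    (A : set T) (F : nat -> set T) n (delta : R) :
  measurable A -> (forall b, measurable (F b)) ->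
  (forall b, (b < n)%N -> P (F b) <= delta%:E)%E ->
  A `<=` \bigcup_(b in `I_n) F b -> (P A <= (n%:R * delta)%:E)%E.
Proof.
move=> mA mF FP AF.
apply: (@le_trans _ _ (\sum_(b < n) P (F b))%E).
  by apply: (@content_subadditive _ _ _ P _ F) => //; rewrite -bigcup_mkord.
apply: (@le_trans _ _ (\sum_(b < n) delta%:E)%E); first by apply: lee_sum => b _; exact: FP.
by rewrite sumEFin sumr_const card_ord mulr_natl.
Qed.

Section bridges.
Context (R : realType) (k n : nat).
Implicit Types (x : seqR R).
Local Notation K := k.+1.
Local Notation bridges := (shrink_all k (n + n) 0).

Lemma walk_bridges_block b x i : (b < n + n)%N -> (i <= K)%N ->
  walk (bridges x) (b * K) i = walk (shrink (b * K) k 0 x) (b * K) i.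
Proof.
move=> bn iK; apply: eq_bigr => j _.
have jK : (j < K)%N := leq_trans (ltn_ord j) iK.
rewrite /shrink_all /shrink divnMDl// (divn_small jK) addn0 ifT; last first.
  have : (b.+1 * K <= (n + n) * K)%N by rewrite leq_mul2r bn orbT.
  by apply: leq_trans; rewrite mulSn addnC ltn_add2r.
by rewrite /block leq_addr leq_add2l -ltnS jK mulr1.
Qed.

Lemma walk_bridges_blocks b c x : (c + b <= n + n)%N -> walk (bridges x) (c * K) (b * K) = 0.
Proof.
elim: b => [_|b IH cb]; first by rewrite /walk mul0n big_ord0.
rewrite mulSn addnC walk_add IH ?add0r; last by rewrite (leq_trans _ cb)// leq_add2l.
rewrite -mulnDl -/(block_sum k (c + b) (bridges x)) block_sum_shrink_all ?mul0r//.
by rewrite -addnS.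
Qed.

Definition narrow_bridges (z : R) : set (seqR R) := [set x | forall j, (j <= n * K)%N ->
  `|walk (bridges x) 0 j| <= z /\ `|walk (bridges x) (n * K) j| <= z].

Lemma measurable_narrow_bridges z : measurable (narrow_bridges z).
Proof.
rewrite (_ : narrow_bridges z = \bigcap_(j in `I_(n * K).+1)
   ([set x | `|walk (bridges x) 0 j| <= z] `&` [set x | `|walk (bridges x) (n * K) j| <= z])).
  have mw o j : measurable_fun setT (fun x => `|walk (bridges x) o j|).
    apply: measurableT_comp => //.
    exact: (measurableT_comp (@measurable_walk R o j) (@measurable_shrink_all R k (n + n) 0)).
  by apply: bigcap_measurableType => j _; apply: measurableI; exact: measurable_le.
by apply/seteqP; split => x h j; [move=> /= jM; exact: h|move=> jM; exact: (h j)].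
Qed.

Lemma narrow_bridges_shrink_all z (lambda : R) x :
  narrow_bridges z (shrink_all k (n + n) lambda x) = narrow_bridges z x.
Proof. by rewrite /narrow_bridges /= shrink_all_shrink_all. Qed.

Lemma shrink0_flip o x : shrink o k 0 (flip xpredT x) = flip xpredT (shrink o k 0 x).
Proof.
apply/funext => i; rewrite /flip /shrink.
have -> : walk (fun i => - x i) o K = - walk x o K by rewrite /walk sumrN.
ring.
Qed.

(** The bridges vanish at the ends of the blocks, so a large value occurs inside
    a single block. *)
Lemma wide_bridge z x : 0 <= z -> ~ narrow_bridges z x -> exists2 b, (b < n + n)%N &
  bridge_exceeds (b * K) k z x \/ bridge_exceeds (b * K) k z (flip xpredT x).
Proof.
move=> z0 nx.
have [c [j [cn jM zw]]] : exists c j, [/\ (c + n <= n + n)%N, (j <= n * K)%N &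
    z < `|walk (bridges x) (c * K) j| ].
  apply: contrapT => /forallNP h; apply: nx => j jM.
  split; rewrite leNgt; apply/negP => zw.
    by apply: (h 0%N); exists j; split; [exact: leq_addl|exact: jM|exact: zw].
  by apply: (h n); exists j; split; [exact: leqnn|exact: jM|exact: zw].
have jn : (j %/ K <= n)%N by rewrite -ltnS ltn_divLR// mulSn (leq_ltn_trans jM)// -[X in (X < _)%N]add0n ltn_add2r.
have [cb|cb] := ltnP (c + j %/ K) (n + n); last first.
  have : (j %/ K == n)%N by lia.
  have jE := divn_eq j K; move=> /eqP jKn; rewrite jKn in jE.
  have j0 : (j %% K = 0)%N by lia.
  move: zw; rewrite jE j0 addn0 walk_bridges_blocks ?normr0; last by rewrite -jKn; lia.
  by rewrite ltNge z0.
exists (c + j %/ K)%N => //.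
move: zw; rewrite {1}(divn_eq j K) walk_add walk_bridges_blocks ?add0r ?(ltnW cb)//.
have iK : (j %% K < k.+1)%N by rewrite ltn_mod.
rewrite -mulnDl walk_bridges_block ?(ltnW iK)// ltr_normr => /orP[h|h]; [left|right].
  by exists (j %% K)%N; [exact: ltnW|exact: ltW].
exists (j %% K)%N; first exact: ltnW.
rewrite shrink0_flip (_ : walk _ _ _ = - walk (shrink ((c + j %/ K) * K) k 0 x) ((c + j %/ K) * K) (j %% K)).
  exact: ltW.
by rewrite /walk -sumrN.
Qed.

Lemma wide_bridges_prob (N : nat) (s : R) (P : probability (seqR R) R) (z delta : R) :
  s != 0 -> iid_normal N s P -> 0 <= z -> ((n + n) * K <= N)%N ->
  (forall b, (b < n + n)%N -> P (bridge_exceeds (b * K) k z) <= delta%:E)%E ->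
  (P (~` narrow_bridges z) <= ((n + n)%:R * (2 * delta))%:E)%E.
Proof.
move=> s0 iidP z0 nN hb.
have [mf _] := flip_preserves s0 iidP xpredT.
have mBf b : measurable (flip xpredT @^-1` bridge_exceeds (b * K) k z : set (seqR R)).
  by rewrite -[X in measurable X]setTI; apply: mf => //; exact: measurable_bridge_exceeds.
apply: (@union_bound _ _ _ _ _ (fun b => bridge_exceeds (b * K) k z `|`
    flip xpredT @^-1` bridge_exceeds (b * K) k z)).
- by apply: measurableC; exact: measurable_narrow_bridges.
- by move=> b; apply: measurableU => //; exact: measurable_bridge_exceeds.
- move=> b bn; have mB := measurable_bridge_exceeds (b * K) k z.
  apply: (le_trans (measureU2 _ _ _)) => //.
  rewrite [X in (_ + X)%E](preserves_set (flip_preserves s0 iidP xpredT) mB).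
  by rewrite (_ : 2 * delta = delta + delta) ?EFinD ?leeD ?hb//; ring.
- by move=> x /(wide_bridge z0)[b bn hx]; exists b.
Qed.

End bridges.

(** * Second moments and a change of density *)
Section tilted.
Context d (T : measurableType d) (R : realType) (P : probability T R).

Lemma ge0_integral_lin (a : R) (g h : T -> R) : 0 <= a -> measurable_fun setT g ->
  measurable_fun setT h -> (forall w, 0 <= g w) -> (forall w, 0 <= h w) ->
  (\int[P]_w (a * g w + h w)%:E = a%:E * \int[P]_w (g w)%:E + \int[P]_w (h w)%:E)%E.
Proof.
move=> a0 mg mh g0 h0; under eq_integral do rewrite EFinD EFinM.
rewrite ge0_integralD//.
- rewrite ge0_integralZl//; first exact/measurable_EFinP.
  by move=> w _; rewrite lee_fin.
- by move=> w _; rewrite mule_ge0// lee_fin.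
- by apply: measurable_funeM; exact/measurable_EFinP.
- by move=> w _; rewrite lee_fin.
- exact/measurable_EFinP.
Qed.

Variables (f l : T -> R) (E : set T) (lambda z m p0 chi t : R).
Hypotheses (mf : measurable_fun setT f) (ml : measurable_fun setT l) (mE : measurable E).
Hypotheses (f0 : forall w, 0 <= f w) (l0 : forall w, 0 <= l w).
Hypotheses (lambda0 : 0 <= lambda) (lambda1 : lambda <= 1) (m0 : 0 <= m) (zm : z <= m) (t0 : 0 < t).

Let e w : R := \1_E w.

(** With a = 1_E (f - m) and b = lambda - l, this is the inequality
    2 a b <= t a ^ 2 + b ^ 2 / t, integrated. The terms are distributed over the
    two sides so that all of them are nonnegative. *)
Lemma tilted_second_moment :
  (\int[P]_w (l w)%:E = 1)%E ->
  (\int[P]_w (l w ^+ 2)%:E <= (1 + chi)%:E)%E ->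
  (\int[P]_w (e w * l w)%:E = P E)%E ->
  (\int[P]_w (e w * f w)%:E < +oo)%E ->
  (\int[P]_w (e w * f w * l w)%:E <=
    lambda%:E * \int[P]_w (e w * f w)%:E + ((1 - lambda) * z)%:E * P E)%E ->
  (p0%:E <= P E)%E ->
  (((2 * (1 - lambda) * (m - z) * p0 - ((1 - lambda) ^+ 2 + chi) / t) / t)%:E <=
    \int[P]_w ((f w - m) ^+ 2)%:E)%E.
Proof.
move=> hl hl2 hel hefoo hefl hp.
have me : measurable_fun setT e by exact: measurable_indic.
have e0 w : 0 <= e w by [].
have mef : measurable_fun setT (fun w => e w * f w) by exact: measurable_funM.
have mel : measurable_fun setT (fun w => e w * l w) by exact: measurable_funM.
have mefl : measurable_fun setT (fun w => e w * f w * l w) by exact: measurable_funM.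
have mV : measurable_fun setT (fun w => (f w - m) ^+ 2).
  by apply: measurable_funX; exact: measurable_funB.
have ml2 : measurable_fun setT (fun w => l w ^+ 2) by exact: measurable_funX.
pose A1 w := 2 * m * lambda * e w + lambda ^+ 2 / t.
pose A2 w := 2 * (e w * f w * l w) + A1 w.
pose A3 w := t^-1 * l w ^+ 2 + A2 w.
pose lhs w := t * (f w - m) ^+ 2 + A3 w.
pose B1 w := 2 * lambda / t * l w + 0.
pose B2 w := 2 * m * (e w * l w) + B1 w.
pose rhs w := 2 * lambda * (e w * f w) + B2 w.
have t1 : 0 <= t^-1 by rewrite invr_ge0 ltW.
have le w : rhs w <= lhs w.
  have : 0 <= (t * (e w * (f w - m)) - (lambda - l w)) ^+ 2 / t by rewrite divr_ge0 ?sqr_ge0// ltW.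
  have -> : (t * (e w * (f w - m)) - (lambda - l w)) ^+ 2 / t =
      t * (e w * (f w - m)) ^+ 2 - 2 * (e w * (f w - m)) * (lambda - l w) + (lambda - l w) ^+ 2 / t.
    by field; rewrite gt_eqF.
  have ee : e w * e w = e w by rewrite /e indicE -natrM mulnb andbb.
  have e1 : e w <= 1 by rewrite /e indicE lern1 leq_b1.
  have h1 : t * (e w * (f w - m)) ^+ 2 <= t * (f w - m) ^+ 2.
    by rewrite ler_pM2l// exprMn expr2 ee ler_piMl ?sqr_ge0.
  move=> h2; rewrite -subr_ge0 in h1; rewrite -subr_ge0 /lhs /A3 /A2 /A1 /rhs /B2 /B1.
  apply: le_trans (addr_ge0 h1 h2) _.
  rewrite le_eqVlt; apply/orP; left; apply/eqP; field; rewrite gt_eqF//.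
have c1 : 0 <= 2 * m * lambda by rewrite !mulr_ge0.
have c2 : 0 <= 2 * lambda by rewrite mulr_ge0.
have c3 : 0 <= 2 * m by rewrite mulr_ge0.
have c4 : 0 <= 2 * lambda / t by rewrite mulr_ge0.
have c5 : 0 <= lambda ^+ 2 / t by rewrite mulr_ge0 ?sqr_ge0.
have madd a (g h : T -> R) : measurable_fun setT g -> measurable_fun setT h ->
    measurable_fun setT (fun w => a * g w + h w).
  by move=> mg mh; apply: measurable_funD => //; exact: measurable_funM.
have nadd (a u v : R) : 0 <= a -> 0 <= u -> 0 <= v -> 0 <= a * u + v.
  by move=> a0 u0 v0; rewrite addr_ge0 ?mulr_ge0.
have mA1 : measurable_fun setT A1 by apply: madd => //; exact: measurable_cst.
have mA2 : measurable_fun setT A2 by exact: madd.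
have mA3 : measurable_fun setT A3 by exact: madd.
have mB1 : measurable_fun setT B1 by apply: madd => //; exact: measurable_cst.
have mB2 : measurable_fun setT B2 by exact: madd.
have A10 w : 0 <= A1 w by exact: nadd.
have A20 w : 0 <= A2 w by apply: nadd => //; rewrite !mulr_ge0.
have A30 w : 0 <= A3 w by apply: nadd => //; rewrite sqr_ge0.
have B10 w : 0 <= B1 w by exact: nadd.
have B20 w : 0 <= B2 w by apply: nadd => //; rewrite mulr_ge0.
have int_le : (\int[P]_w (rhs w)%:E <= \int[P]_w (lhs w)%:E)%E.
  apply: ge0_le_integral => //.
  - by move=> w _; rewrite lee_fin; apply: nadd => //; rewrite mulr_ge0.
  - by apply/measurable_EFinP; exact: madd.
  - by apply/measurable_EFinP; apply: madd.
  - by move=> w _; rewrite lee_fin.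
have intE : (\int[P]_w (e w)%:E = P E)%E by rewrite integral_indic// setIT.
have intc c : (\int[P]_w c%:E = c%:E)%E.
  by rewrite integral_cst// [X in (_ * X)%E]probability_setT mule1.
have lhsE : (\int[P]_w (lhs w)%:E = t%:E * \int[P]_w ((f w - m) ^+ 2)%:E +
    (t^-1%:E * \int[P]_w (l w ^+ 2)%:E + (2%:E * \int[P]_w (e w * f w * l w)%:E +
     ((2 * m * lambda)%:E * P E + (lambda ^+ 2 / t)%:E))))%E.
  rewrite ge0_integral_lin// ?(ltW t0)//; last by move=> w; rewrite sqr_ge0.
  rewrite ge0_integral_lin//; last by move=> w; rewrite sqr_ge0.
  rewrite ge0_integral_lin//; last by move=> w; rewrite !mulr_ge0.
  by rewrite ge0_integral_lin// intE intc.
have rhsE : (\int[P]_w (rhs w)%:E = (2 * lambda)%:E * \int[P]_w (e w * f w)%:E +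
    ((2 * m)%:E * P E + ((2 * lambda / t)%:E + 0)))%E.
  rewrite ge0_integral_lin//; last by move=> w; rewrite mulr_ge0.
  rewrite ge0_integral_lin//; last by move=> w; rewrite mulr_ge0.
  by rewrite ge0_integral_lin// hel hl mule1 intc.
move: int_le; rewrite lhsE rhsE.
have V0 : (0 <= \int[P]_w ((f w - m) ^+ 2)%:E)%E.
  by apply: integral_ge0 => w _; rewrite lee_fin sqr_ge0.
have Y0 : (0 <= \int[P]_w (e w * f w)%:E)%E.
  by apply: integral_ge0 => w _; rewrite lee_fin mulr_ge0.
have X0 : (0 <= \int[P]_w (e w * f w * l w)%:E)%E.
  by apply: integral_ge0 => w _; rewrite lee_fin !mulr_ge0.
have L0 : (0 <= \int[P]_w (l w ^+ 2)%:E)%E.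
  by apply: integral_ge0 => w _; rewrite lee_fin sqr_ge0.
have pfin : P E \is a fin_num by rewrite fin_num_measure.
have yfin : (\int[P]_w (e w * f w)%:E)%E \is a fin_num by rewrite ge0_fin_numE.
move: hefl hl2 hp V0 X0 L0; rewrite -(fineK pfin) -(fineK yfin).
move: (fine (P E)) (fine _) => p y.
case: (\int[P]_w (e w * f w * l w)%:E)%E => [x| |]; last 2 first.
- by rewrite -EFinM -EFinM -EFinD leNgt ltry.
- by [].
case: (\int[P]_w (l w ^+ 2)%:E)%E => [q| |]; last 2 first.
- by move=> _; rewrite leye_eq.
- by [].
case: (\int[P]_w ((f w - m) ^+ 2)%:E)%E => [v| |]; last 2 first.
- by move=> *; rewrite leey.
- by move=> _ _ _; rewrite leeNy_eq.
rewrite -!EFinM -!EFinD !lee_fin => hx hq hp v0 x0 q0 h.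
rewrite ler_pdivrMr//.
have h1 : 2 * (1 - lambda) * (m - z) * p0 <= 2 * (1 - lambda) * (m - z) * p.
  by rewrite ler_wpM2l// !mulr_ge0// subr_ge0.
have h2 : t^-1 * q <= t^-1 * (1 + chi) by rewrite ler_wpM2l.
move: h h1 h2 hx; move: (t^-1) => i h h1 h2 hx; lra.
Qed.
End tilted.

(** * The probability of wide bridges *)
Section bridge_probability.
Context (R : realType) (k n : nat) (P : probability (seqR R) R).
Local Notation K := k.+1.
Local Notation M := (n * K)%N.
Hypothesis iidP : iid_normal (M + M) (Num.sqrt M%:R)^-1 P.
Hypothesis n0 : (0 < n)%N.

Let w : R := Num.sqrt n%:R.
Let q : R := Num.sqrt K%:R.

Lemma sqrt_steps : Num.sqrt M%:R = w * q :> R.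
Proof. by rewrite natrM sqrtrM. Qed.

Lemma sqrt_blocks_gt0 : 0 < w. Proof. by rewrite sqrtr_gt0 ltr0n. Qed.
Lemma sqrt_length_gt0 : 0 < q. Proof. by rewrite sqrtr_gt0 ltr0n. Qed.

Lemma steps_gt0 : 0 < (Num.sqrt M%:R)^-1 :> R.
Proof. by rewrite invr_gt0 sqrt_steps mulr_gt0 ?sqrt_blocks_gt0 ?sqrt_length_gt0. Qed.

Lemma scale_step (y a : R) :
  ((Num.sqrt M%:R)^-1 * y <= a / w / q) = (y <= a).
Proof.
have wq : 0 < w * q by rewrite mulr_gt0 ?sqrt_blocks_gt0 ?sqrt_length_gt0.
by rewrite sqrt_steps -mulrA -invfM [_^-1 * y]mulrC ler_pM2r// invr_gt0.
Qed.

(** In units of the standard deviation of a block sum, the level is 2.4 and the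
    interval to which the block sum is confined is [0, 0.2]. *)
Lemma bridge_exceeds_prob b : (b < n + n)%N ->
  (P (bridge_exceeds (b * K) k (24 / 10 / w)) <= (3 / 100 / 1024)%:E)%E.
Proof.
move=> bn; have s0 := steps_gt0.
have okN : (b * K + k < M + M)%N.
  have : (b.+1 * K <= (n + n) * K)%N by rewrite leq_mul2r bn orbT.
  by rewrite mulnDl; apply: leq_trans; rewrite mulSn addnC ltn_add2r.
have e0 : 0 <= 2 / 10 / w by rewrite divr_ge0 ?(ltW sqrt_blocks_gt0)//; lra.
have := bridge_tail (lt0r_neq0 s0) iidP (24 / 10 / w) okN e0.
rewrite (normal_prob_scale s0 (measurable_itv _)) (normal_prob_scale s0 (measurable_itv _)).
have -> : (fun x => (Num.sqrt M%:R)^-1 * x) @^-1` `[0, 2 / 10 / w / q] = `[0, 2 / 10]%classic.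
  apply/seteqP; split => y; rewrite /= !in_itv/= scale_step.
    by rewrite pmulr_rge0.
  by rewrite pmulr_rge0.
have -> : (fun x => (Num.sqrt M%:R)^-1 * x) @^-1` `[(2 * (24 / 10 / w) - 2 / 10 / w) / q, +oo[ =
    `[46 / 10, +oo[%classic.
  apply/seteqP; split => y; rewrite /= !in_itv/= !andbT => h.
    rewrite leNgt; apply/negP => y46.
    have wq : 0 < w * q by rewrite mulr_gt0 ?sqrt_blocks_gt0 ?sqrt_length_gt0.
    have : (2 * (24 / 10 / w) - 2 / 10 / w) / q = 46 / 10 / (w * q).
      by rewrite invfM; move: w^-1 q^-1 => u v; lra.
    move=> e; move: h; rewrite e sqrt_steps [_^-1 * y]mulrC ler_pM2r ?invr_gt0//.
    by rewrite leNgt y46.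
  have -> : (2 * (24 / 10 / w) - 2 / 10 / w) / q = 46 / 10 / (w * q).
    by rewrite invfM; move: w^-1 q^-1 => u v; lra.
  have wq : 0 < w * q by rewrite mulr_gt0 ?sqrt_blocks_gt0 ?sqrt_length_gt0.
  by rewrite sqrt_steps [_^-1 * y]mulrC ler_pM2r ?invr_gt0.
have hI := @normal_interval_ge R 0 (2 / 10) ltac:(lra).
have hT := @normal_tail_le R (46 / 10) ltac:(lra).
set A := (X in (X * _ <= _)%E); set B := (X in (_ * _ <= X)%E) => h.
have mP : P (bridge_exceeds (b * K) k (24 / 10 / w)) \is a fin_num.
  by rewrite fin_num_measure//; exact: measurable_bridge_exceeds.
have {h} : ((normal_peak 1 * ((2 / 10 - 0) * bell (2 / 10)))%:E *
    P (bridge_exceeds (b * K) k (24 / 10 / w)) <= (normal_peak 1 * (bell (46 / 10) / (46 / 10)))%:E)%E.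
  apply: le_trans (le_trans _ h) hT.
  by rewrite lee_wpmul2r// measure_ge0.
rewrite -(fineK mP); move: (fine _) => pr; rewrite -EFinM !lee_fin -[_ * _ * pr]mulrA.
rewrite ler_pM2l ?normal_peak_gt0 ?oner_neq0//.
have -> : bell (46 / 10) = bell (2 / 10) * expR (- (1056 / 100)) :> R.
  by rewrite /bell -expRD; congr expR; field.
rewrite subr0 [2 / 10 * _]mulrC -[_ * _ * pr]mulrA -[X in _ <= X]mulrA.
rewrite ler_pM2l ?bell_gt0//.
have h1 := @expR_bridge R; have h2 := expR_gt0 (- (1056 / 100) : R).
have h3 : expR (- (1056 / 100)) * expR (1056 / 100) = 1 :> R by rewrite -expRD addNr expR0.
have h4 := ler_wpM2l (ltW h2) h1; rewrite h3 in h4.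
by move: h4; move: (expR _) => u; lra.
Qed.
End bridge_probability.

(** * The second moment of the density *)
Lemma bernoulli_inequality (R : realDomainType) (a : R) n : 0 <= a <= 1 ->
  1 - n%:R * a <= (1 - a) ^+ n.
Proof.
move=> /andP[a0 a1]; elim: n => [|n IH]; first by rewrite mul0r subr0 expr0.
rewrite exprS; apply: le_trans (ler_wpM2l _ IH); last by rewrite subr_ge0.
rewrite -natr1 -subr_ge0 (_ : _ - _ = n%:R * (a * a)); first by rewrite !mulr_ge0.
by ring.
Qed.

Section density.
Context (R : realType) (k : nat).
Local Notation K := k.+1.

(** Up to a constant, the square of the density of the scaling by lambda is the
    density of the scaling by this factor. *)
Definition squared_ratio (lambda : R) : R := (Num.sqrt (2 * lambda ^- 2 - 1))^-1.

Lemma squared_ratio_gt0 lambda : 0 < lambda < 1 -> 0 < 2 * lambda ^- 2 - 1 :> R.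
Proof.
move=> /andP[l0 l1].
have : 1 <= lambda ^- 2 :> R.
  by rewrite -[leLHS]invr1 lef_pV2 ?posrE ?exprn_gt0// expr_le1// ltW.
by lra.
Qed.

Lemma scaling_density_sqr (s lambda y : R) : 0 < lambda < 1 ->
  scaling_density s lambda y ^+ 2 = lambda ^- 2 * squared_ratio lambda *
    scaling_density s (squared_ratio lambda) y.
Proof.
move=> l01; have c0 := squared_ratio_gt0 l01.
have r0 : Num.sqrt (2 * lambda ^- 2 - 1) != 0 by rewrite gt_eqF// sqrtr_gt0.
rewrite /scaling_density exprMn exprVn.
rewrite -[RHS]mulrA; congr (_ * _).
rewrite mulrA divff ?mul1r; last by rewrite /squared_ratio invr_eq0.
rewrite expr2 -expRD /squared_ratio exprVn invrK sqr_sqrtr ?(ltW c0)//.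
by congr expR; ring.
Qed.

Lemma squared_constant lambda : 0 < lambda < 1 ->
  (lambda ^- 2 * squared_ratio lambda) ^+ 2 = (1 - (1 - lambda ^+ 2) ^+ 2)^-1 :> R.
Proof.
move=> l01; have c0 := squared_ratio_gt0 l01; move: (l01) => /andP[l0 l1].
rewrite exprMn /squared_ratio [X in _ * X]exprVn sqr_sqrtr ?(ltW c0)//.
have l2 : lambda ^+ 2 != 0 by rewrite expf_neq0// gt_eqF.
have e : 1 - (1 - lambda ^+ 2) ^+ 2 = lambda ^+ 2 * lambda ^+ 2 * (2 * lambda ^- 2 - 1).
  by field; exact: lt0r_neq0.
by rewrite e !invfM expr2.
Qed.

Variables (N : nat) (s : R) (P : probability (seqR R) R).
Hypotheses (s0 : 0 < s) (iidP : iid_normal N s P).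

Lemma integral_density n lambda : (n * K <= N)%N -> 0 < lambda ->
  (\int[P]_x (shrink_all_density k s n lambda x)%:E = 1)%E.
Proof.
move=> nN l0.
have := integral_shrink_all s0 iidP (F := cst 1%E) nN l0 (measurable_cst _) (fun=> lee01).
rewrite integral_cst// mul1e [X in X = _ -> _]probability_setT => ->.
by apply: eq_integral => x _; rewrite mul1e.
Qed.

Lemma integral_density_sqr n lambda : (n * K <= N)%N -> 0 < lambda < 1 ->
  (\int[P]_x (shrink_all_density k s n lambda x ^+ 2)%:E =
    ((lambda ^- 2 * squared_ratio lambda) ^+ n)%:E)%E.
Proof.
move=> nN l01; have c0 := squared_ratio_gt0 l01; move: (l01) => /andP[l0 l1].
have r0 : 0 < squared_ratio lambda by rewrite invr_gt0 sqrtr_gt0.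
set C := lambda ^- 2 * _.
have C0 : 0 <= C by rewrite mulr_ge0 ?(ltW r0)// invr_ge0 exprn_ge0// ltW.
transitivity (\int[P]_x ((C ^+ n)%:E * (shrink_all_density k s n (squared_ratio lambda) x)%:E))%E.
  apply: eq_integral => x _; rewrite -EFinM /shrink_all_density; congr _%:E.
  rewrite -prodrXl (eq_bigr (fun b : 'I_n => C * scaling_density s (squared_ratio lambda) (block_coord k b x))).
    by rewrite big_split/= prodr_const card_ord.
  by move=> b _; rewrite scaling_density_sqr.
rewrite ge0_integralZl//.
- by rewrite integral_density// mule1.
- by apply/measurable_EFinP; exact: measurable_shrink_all_density.
- by move=> x _; rewrite lee_fin shrink_all_density_ge0.
- by rewrite lee_fin exprn_ge0.
Qed.

End density.

(** * The second moment around large centers *)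
Lemma density_numeric (R : realFieldType) (u : R) :
  8759 / 10000 + 74 / 100 / 10000 <= u -> u^-1 <= 1 + 14159 / 100 / 1000.
Proof.
move=> hu; have u0 : 0 < u by apply: lt_le_trans hu; lra.
by rewrite -[leLHS]mul1r ler_pdivrMr//; lra.
Qed.

Lemma large_center_numeric (R : realFieldType) (m : R) : 24 / 100 <= m ->
  27 / 10 / 10 ^+ 6 <= (2 * (1 - 127 / 128) * (m - 15 / 100) * (94 / 100) -
    ((1 - 127 / 128) ^+ 2 + 14159 / 100 / 1000) / 214) / 214.
Proof. by lra. Qed.

Section large_center.
Context (R : realType) (k n : nat) (P : probability (seqR R) R).
Local Notation K := k.+1.
Local Notation M := (n * K)%N.
Hypothesis iidP : iid_normal (M + M) (Num.sqrt M%:R)^-1 P.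
Hypothesis n512 : n%:R = 512 :> R.

Let lambda : R := 127 / 128.
Let z0 : R := 24 / 10 / Num.sqrt n%:R.
Let z : R := 15 / 100.
Let E : set (seqR R) := narrow_bridges k n z0.
Let f (x : seqR R) : R := skel_inradius M x.
Let l : seqR R -> R := shrink_all_density k (Num.sqrt M%:R)^-1 (n + n) lambda.

Lemma blocks_gt0 : (0 < n)%N.
Proof. by rewrite -(ltr0n R) n512; lra. Qed.

Let nN : ((n + n) * K <= M + M)%N.
Proof. by rewrite mulnDl. Qed.

Let z00 : 0 <= z0.
Proof. by rewrite /z0; apply: divr_ge0; [lra|exact: sqrtr_ge0]. Qed.

Lemma diagonal_width : z0 ^+ 2 + z0 ^+ 2 = z ^+ 2.
Proof.
rewrite /z0 exprMn exprVn sqr_sqrtr ?ler0n// n512 /z.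
by lra.
Qed.

Lemma narrow_bridges_prob : ((94 / 100)%:E <= P E)%E.
Proof.
have mE : measurable E by exact: measurable_narrow_bridges.
have h := wide_bridges_prob (lt0r_neq0 (steps_gt0 R k blocks_gt0)) iidP z00 nN
  (bridge_exceeds_prob iidP blocks_gt0).
have e : (n + n)%:R * (2 * (3 / 100 / 1024)) = 6 / 100 :> R by rewrite natrD n512; lra.
rewrite e -/E in h.
have := probability_setC P mE; have pE : P E \is a fin_num by rewrite fin_num_measure.
move: h => /[swap] ->; rewrite -(fineK pE); move: (fine _) => p.
rewrite -EFinB !lee_fin; lra.
Qed.

(** On narrow bridges the contracted path is, up to the bridges, the dilated
    path. *)
Lemma inradius_shrink_all x : E x ->
  f (shrink_all k (n + n) lambda x) <= lambda * f x + (1 - lambda) * z.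
Proof.
move=> Ex.
have l1 : 0 <= 1 - lambda by rewrite /lambda; lra.
have z1 : 0 <= z by rewrite /z; lra.
apply: skel_inradius_dilation => [||j jM].
- by rewrite /lambda; lra.
- exact: mulr_ge0.
have [h1 h2] := Ex j jM.
rewrite ![walk (shrink_all _ _ lambda x) _ _]walk_shrink_all ![lambda * _ + _]addrC !addrK.
rewrite ![(_ * walk _ _ _) ^+ 2]exprMn [((1 - lambda) * z) ^+ 2]exprMn -mulrDr; apply: ler_wpM2l; first exact: sqr_ge0.
rewrite -diagonal_width; apply: lerD.
  by rewrite -real_normK ?num_real// lerXn2r ?nnegrE.
by rewrite -real_normK ?num_real// lerXn2r ?nnegrE.
Qed.

Lemma large_center_second_moment (m : R) : 24 / 100 <= m ->
  (\int[P]_x (f x)%:E < +oo)%E ->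
  ((27 / 10 / 10 ^+ 6)%:E <= \int[P]_x ((f x - m) ^+ 2)%:E)%E.
Proof.
move=> m24 ffin.
have zm : z <= m by rewrite /z; lra.
have m0 : 0 <= m by lra.
have zl : 0 <= (1 - lambda) * z by rewrite /lambda /z; lra.
have s0 := steps_gt0 R k blocks_gt0.
have l01 : 0 < lambda < 1 by apply/andP; split; rewrite /lambda; lra.
have l0 : 0 < lambda by case/andP: l01.
have l1 : lambda <= 1 by case/andP: l01 => _ /ltW.
have mE : measurable E by exact: measurable_narrow_bridges.
have mf : measurable_fun setT f by exact: measurable_skel_inradius.
have f0 x : 0 <= f x by exact: skel_inradius_ge0.
have ml : measurable_fun setT l by exact: measurable_shrink_all_density.
have d0 x : 0 <= l x by exact: shrink_all_density_ge0.
have me : measurable_fun setT (\1_E : seqR R -> R) by exact: measurable_indic.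
have Einv x : \1_E (shrink_all k (n + n) lambda x) = \1_E x :> R.
  by rewrite !indicE; congr (nat_of_bool _)%:R; apply/idP/idP => /set_mem h; apply/mem_set;
    move: h; rewrite /E narrow_bridges_shrink_all.
have hl : (\int[P]_x (l x)%:E = 1)%E by exact: (integral_density s0 iidP).
(* the inverse of 1 - 512 (1 - lambda ^ 2) ^ 2, by the inequality of Bernoulli *)
have hl2 : (\int[P]_x (l x ^+ 2)%:E <= (1 + 14159 / 100 / 1000)%:E)%E.
  rewrite (integral_density_sqr s0 iidP nN l01) lee_fin.
  rewrite addnn -mul2n exprM squared_constant// exprVn.
  have e01 : 0 <= (1 - lambda ^+ 2) ^+ 2 <= 1 by apply/andP; split; rewrite /lambda; lra.
  have hB := bernoulli_inequality n e01.
  have hC : 8759 / 10000 + 74 / 100 / 10000 <= (1 - (1 - lambda ^+ 2) ^+ 2) ^+ n.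
    by apply: le_trans hB; rewrite n512 /lambda; lra.
  exact: density_numeric.
have hel : (\int[P]_x (\1_E x * l x)%:E = P E)%E.
  transitivity (\int[P]_x (\1_E (shrink_all k (n + n) lambda x) : R)%:E)%E.
    rewrite (integral_shrink_all s0 iidP (F := fun x => (\1_E x)%:E))//.
    exact/measurable_EFinP.
  by under eq_integral do rewrite Einv; rewrite integral_indic// setIT.
have indic_ge0' (x : seqR R) : 0 <= \1_E x :> R by [].
have mef : measurable_fun setT (fun x => \1_E x * f x) by exact: measurable_funM.
have hefoo : (\int[P]_x (\1_E x * f x)%:E < +oo)%E.
  apply: le_lt_trans ffin; apply: ge0_le_integral => //.
  - by move=> x _; rewrite lee_fin mulr_ge0.
  - exact/measurable_EFinP.
  - exact/measurable_EFinP.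
  - by move=> x _; rewrite lee_fin ler_piMl// indicE lern1 leq_b1.
have hefl : (\int[P]_x (\1_E x * f x * l x)%:E <=
    lambda%:E * \int[P]_x (\1_E x * f x)%:E + ((1 - lambda) * z)%:E * P E)%E.
  have -> : (\int[P]_x (\1_E x * f x * l x)%:E =
      \int[P]_x (\1_E (shrink_all k (n + n) lambda x) * f (shrink_all k (n + n) lambda x))%:E)%E.
    rewrite (integral_shrink_all s0 iidP (F := fun x => (\1_E x * f x)%:E))//.
    - exact/measurable_EFinP.
    - by move=> x; rewrite lee_fin mulr_ge0.
  have -> : P E = (\int[P]_x (\1_E x : R)%:E)%E by rewrite integral_indic// setIT.
  have -> : (((1 - lambda) * z)%:E * \int[P]_x (\1_E x : R)%:E =
      \int[P]_x ((1 - lambda) * z * \1_E x)%:E)%E.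
    under [RHS]eq_integral do rewrite EFinM.
    by rewrite ge0_integralZl//; exact/measurable_EFinP.
  rewrite -(@ge0_integral_lin _ _ R P lambda (fun x => \1_E x * f x)
    (fun x => (1 - lambda) * z * \1_E x) (ltW l0) mef (measurable_funM (measurable_cst _) me)
    (fun x => mulr_ge0 (indic_ge0' x) (f0 x)) (fun x => mulr_ge0 zl (indic_ge0' x))).
  apply: ge0_le_integral => //.
  - by move=> x _; rewrite lee_fin mulr_ge0.
  - apply/measurable_EFinP.
    exact: (measurableT_comp mef (@measurable_shrink_all R k (n + n) lambda)).
  - apply/measurable_EFinP; apply: measurable_funD; first exact: measurable_funM.
    exact: measurable_funM.
  - move=> x _; rewrite lee_fin Einv indicE.
    have [/set_mem Ex|_] := boolP (x \in E); last by rewrite !mul0r !mulr0 addr0.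
    by rewrite !mul1r mulr1; exact: inradius_shrink_all.
(* t is close to its best value E (lambda - l) ^ 2 / ((1 - lambda) (m - z) P(E)) *)
have t0 : 0 < 214 :> R by rewrite ltr0n.
have h := @tilted_second_moment _ _ R P f l E lambda z m (94 / 100) (14159 / 100 / 1000) 214
  mf ml mE f0 d0 (ltW l0) l1 m0 zm t0 hl hl2 hel hefoo hefl narrow_bridges_prob.
by apply: le_trans h; rewrite lee_fin; exact: large_center_numeric.
Qed.

End large_center.

(** * Discretization of continuous paths *)
Section path.
Context (R : realType).

(** Heine's theorem on [0, 1]. *)
Lemma uniform_continuity (f : R -> R) (eps : R) :
  {within `[0, +oo[, continuous f} -> 0 < eps ->
  exists2 delta, 0 < delta & forall s t, 0 <= s <= 1 -> 0 <= t <= 1 ->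
    `|s - t| < delta -> `|f s - f t| < eps.
Proof.
move=> cf e0.
pose Q (delta s : R) := 0 <= s <= 1 -> forall t, 0 <= t <= 1 -> `|s - t| < delta -> `|f s - f t| < eps.
have near_Q : forall s : R, `[0, 1]%classic s -> \forall s' \near s & delta \near (0 : R)^'+, Q delta s'.
  move=> s /=; rewrite in_itv/= => /andP[s0 s1].
  have e2 : 0 < eps / 2 by rewrite divr_gt0.
  have : exists2 eta, 0 < eta & forall t, 0 <= t -> `|s - t| < eta -> `|f s - f t| < eps / 2.
    have s0' : `[0, +oo[%classic s by rewrite /= in_itv/= andbT.
    have /subspace_continuousP /(_ s s0') /cvgrPdist_lt /(_ _ e2) := cf.
    rewrite /prop_near1 /nbhs/= /within/= => -[eta /= eta0 h]; exists eta => // t t0 st.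
    by apply: (h t) => //=; rewrite in_itv/= andbT.
  move=> [eta eta0 h].
  have eta2 : 0 < eta / 2 by rewrite divr_gt0.
  exists (ball s (eta / 2), [set d : R | d < eta / 2]) => /=.
    split; first exact: nbhsx_ballx.
    exact: nbhs_right_lt.
  move=> [s' d] /= [ss' dd] /andP[s'0 s'1] t /andP[t0 t1] s't.
  have h1 := h s' s'0; have h2 := h t t0.
  rewrite /ball/= in ss'.
  have a1 : `|f s - f s'| < eps / 2 by apply: h1; lra.
  have a2 : `|f s - f t| < eps / 2.
    apply: h2; rewrite (_ : s - t = (s - s') + (s' - t)); last by ring.
    by apply: (le_lt_trans (ler_normD _ _)); lra.
  rewrite (_ : f s' - f t = (f s - f t) - (f s - f s')); last by ring.
  by apply: (le_lt_trans (ler_normB _ _)); lra.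
have /compact_near_coveringP := @segment_compact R 0 1.
move=> /(_ R (0 : R)^'+ Q _ near_Q) hQ.
have [delta d0 hd] : exists2 delta : R, 0 < delta & `[0, 1]%classic `<=` Q delta.
  have := @nbhs_right_gt R 0 => h0.
  near (0 : R)^'+ => d; exists d => //.
  by near: d.
exists delta => // s t s01; apply: hd => //=.
Unshelve. all: by end_near. Qed.

Variable W : R -> 'rV[R]_2.
Hypothesis cW : forall i, {within `[0, +oo[, continuous (fun t : R => W t 0 i)}.

Definition path_range : set 'rV[R]_2 := [set W s | s in `[0, 1]].
Definition path_grid (M : nat) : set 'rV[R]_2 := [set W (j%:R / M%:R) | j in `I_M.+1].

Lemma grid_time (M j : nat) : (0 < M)%N -> (j <= M)%N -> 0 <= (j%:R / M%:R : R) <= 1.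
Proof.
by move=> M0 jM; rewrite divr_ge0//= ler_pdivrMr ?ltr0n// mul1r ler_nat.
Qed.

Lemma path_grid_sub M : (0 < M)%N -> path_grid M `<=` path_range.
Proof.
move=> M0 _ [j jM <-]; exists (j%:R / M%:R) => //=.
by rewrite in_itv/= grid_time.
Qed.

Lemma path_grid_nonempty M : path_grid M !=set0.
Proof. by exists (W (0%:R / M%:R)), 0%N. Qed.

Lemma path_range_strip : exists lo hi, in_strip path_range lo hi.
Proof.
have c01 : {within `[0, 1], continuous (fun t : R => W t 0 0)}.
  apply: (continuous_subspaceW _ (@cW 0)).
  by move=> t /=; rewrite !in_itv/= => /andP[-> _].
have [c _ hc] := EVT_max ler01 c01; have [b _ hb] := EVT_min ler01 c01.
exists (W b 0 0), (W c 0 0) => _ [s s01 <-].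
by rewrite hb// hc.
Qed.

Lemma path_grid_inradius_le M : (0 < M)%N ->
  inradius (convex_hull (path_grid M)) <= inradius (convex_hull path_range).
Proof.
move=> M0; have [lo [hi h]] := path_range_strip.
exact: (inradius_mono (path_grid_nonempty M) h (path_grid_sub M0)).
Qed.

(** By uniform continuity each point of the path is close to one of the grid. *)
Lemma path_grid_inradius_ge (eps : R) : 0 < eps ->
  exists M0, forall M, (M0 < M)%N ->
    inradius (convex_hull path_range) <= inradius (convex_hull (path_grid M)) + eps.
Proof.
move=> e0; have e2 : 0 < eps / 2 by rewrite divr_gt0.
have [d0 d00 h0] := uniform_continuity (@cW 0) e2.
have [d1 d10 h1] := uniform_continuity (@cW 1) e2.
pose delta := Num.min d0 d1.
have delta0 : 0 < delta by rewrite lt_min d00.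
exists (Num.truncn delta^-1) => M hM.
have M0 : (0 < M)%N := leq_ltn_trans (leq0n _) hM.
have MR : 0 < M%:R :> R by rewrite ltr0n.
have Md : M%:R^-1 < delta.
  rewrite invf_plt ?posrE//.
  have := truncnS_gt (delta^-1); move/lt_le_trans; apply.
  by rewrite ler_nat.
have [lo [hi hs]] := path_range_strip.
have hs' : in_strip (path_grid M) lo hi by move=> a /(path_grid_sub M0); exact: hs.
have range0 : path_range !=set0 by have [a /(path_grid_sub M0) ?] := path_grid_nonempty M; exists a.
rewrite -[X in X + _]mul1r.
apply: (inradius_dilation (path_grid_nonempty M) range0 hs') => //; first exact: ltW.
move=> _ [s /= s01 <-]; move: s01; rewrite in_itv/= => /andP[s0 s1].
have sM0 : 0 <= s * M%:R by rewrite mulr_ge0.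
have /andP[j1 j2] := truncn_itv sM0.
set j := Num.truncn _ in j1 j2.
have jM : (j <= M)%N.
  by rewrite -(ler_nat R) (le_trans j1)// ler_piMl.
exists (W (j%:R / M%:R)); first by exists j.
have sj : `|s - j%:R / M%:R| < delta.
  apply: le_lt_trans Md; rewrite ler_norml; apply/andP; split.
    by rewrite (@le_trans _ _ 0) ?oppr_le0 ?invr_ge0// subr_ge0 ler_pdivrMr.
  by rewrite lerBlDr addrC -[X in _ + X]mul1r -mulrDl natr1 ler_pdivlMr// ltW.
have st : 0 <= s <= 1 by rewrite s0.
move: sj; rewrite lt_min => /andP[sj0 sj1].
have /ltW b0 := h0 _ _ st (grid_time M0 jM) sj0.
have /ltW b1 := h1 _ _ st (grid_time M0 jM) sj1.
rewrite !mul1r.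
have sq (u : R) : `|u| <= eps / 2 -> u ^+ 2 <= (eps / 2) ^+ 2.
  by move=> hu; rewrite -real_normK ?num_real// lerXn2r// nnegrE ltW.
have := sq _ b0; have := sq _ b1; have := sqr_ge0 eps; lra.
Qed.

End path.

(** * Increments of planar Brownian motion *)
Section brownian_increments.
Context d (T : measurableType d) (R : realType) (P : probability T R).

(** The increments are measurable with respect to the process, as differences of
    its values. *)
Lemma increments_process_event (X : R -> T -> R) (t : nat -> R) M (A : nat -> set R) :
  (forall i, 0 <= t i) -> (forall i, measurable (A i)) ->
  process_sigma_algebra X
    [set w | forall i, (i < M)%N -> A i (X (t i.+1) w - X (t i) w)].
Proof.
move=> t0 mA.
pose G := \bigcup_(t in `[0, +oo[) preimage_set_system setT (X t) measurable.
pose TG : measurableType _ := g_sigma_algebraType G.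
have mX u : 0 <= u -> measurable_fun setT (X u : TG -> R).
  move=> u0 _ B mB; rewrite setTI; apply: sub_sigma_algebra; exists u.
    by rewrite /= in_itv/= andbT.
  by exists B => //; rewrite setTI.
have mXX i : measurable_fun setT (fun w : TG => X (t i.+1) w - X (t i) w).
  by apply: measurable_funB; exact: mX.
rewrite (_ : mkset _ = \bigcap_(i in `I_M)
    ((fun w : TG => X (t i.+1) w - X (t i) w) @^-1` A i)); last by apply/seteqP; split.
suff : measurable (\bigcap_(i in `I_M)
    ((fun w : TG => X (t i.+1) w - X (t i) w) @^-1` A i)) by [].
apply: bigcap_measurableType => i _.
by rewrite -[X in measurable X]setTI; exact: mXX.
Qed.

Lemma brownian_increments_prob (B : R -> T -> R) M (A : nat -> set R) :
  brownian_motion P B -> (0 < M)%N -> (forall i, measurable (A i)) ->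
  P [set w | forall i, (i < M)%N -> A i (B (i.+1%:R / M%:R) w - B (i%:R / M%:R) w)] =
  (\prod_(i < M) normal_prob 0%R (Num.sqrt M%:R)^-1 (A i))%E.
Proof.
move=> bm M0 mA; have MR : 0 < M%:R :> R by rewrite ltr0n.
pose t i : R := i%:R / M%:R.
have t0 : 0 <= t 0%N by rewrite /t mul0r.
have tS : nondecreasing_seq t.
  by move=> i j ij; rewrite /t ler_pM2r ?invr_gt0// ler_nat.
rewrite (_ : mkset _ = \bigcap_(i : 'I_M) (B (t i.+1) \- B (t i)) @^-1` A i); last first.
  by apply/seteqP; split => [w h i _|w h i iM]; [exact: h|exact: (h (Ordinal iM) I)].
rewrite (bm_independent_increments bm t0 tS); last by move=> i; exact: mA.
apply: eq_bigr => i _.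
have ti : 0 <= t i by rewrite /t divr_ge0.
have tii : t i < t i.+1 by rewrite /t ltr_pM2r ?invr_gt0// ltr_nat.
rewrite (bm_gaussian_increments bm ti tii (mA i)).
suff -> : Num.sqrt (t i.+1 - t i) = (Num.sqrt M%:R)^-1 by [].
rewrite -sqrtrV ?ler0n//; congr Num.sqrt.
by rewrite /t -mulrBl -natr1 addrC addKr mul1r.
Qed.

Variable W : R -> T -> 'rV[R]_2.
Hypothesis hW : planar_brownian_motion P W.
Variable M : nat.
Hypothesis M0 : (0 < M)%N.

Definition increments (w : T) : seqR R := fun i =>
  if (i < M)%N then W (i.+1%:R / M%:R) w 0 0 - W (i%:R / M%:R) w 0 0
  else if (i < M + M)%N then
    W ((i - M).+1%:R / M%:R) w 0 1 - W ((i - M)%:R / M%:R) w 0 1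
  else 0.

Lemma measurable_increments : measurable_fun setT increments.
Proof.
have [h0 h1 _] := hW.
have t0 j : 0 <= j%:R / M%:R :> R by rewrite divr_ge0.
apply: measurable_seqP => i; rewrite /increments.
case: (i < M)%N; last case: (i < M + M)%N; last exact: measurable_cst.
- by apply: measurable_funB; [exact: (bm_measurable h0)|exact: (bm_measurable h0)].
- by apply: measurable_funB; [exact: (bm_measurable h1)|exact: (bm_measurable h1)].
Qed.

Lemma walk_increments0 w j : (j <= M)%N -> walk (increments w) 0 j = W (j%:R / M%:R) w 0 0.
Proof.
have [h0 _ _] := hW.
elim: j => [_|j IH jM]; first by rewrite /walk big_ord0 mul0r (bm_start h0).
by rewrite walkS IH 1?ltnW// /increments add0n jM addrCA subrr addr0.
Qed.

Lemma walk_increments1 w j : (j <= M)%N -> walk (increments w) M j = W (j%:R / M%:R) w 0 1.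
Proof.
have [_ h1 _] := hW.
elim: j => [_|j IH jM]; first by rewrite /walk big_ord0 mul0r (bm_start h1).
rewrite walkS IH 1?ltnW// /increments ltnNge leq_addr/= ltn_add2l jM.
by rewrite addnC addnK addrCA subrr addr0.
Qed.

Lemma skeleton_increments w : skeleton M (increments w) = path_grid (W^~ w) M.
Proof.
have pt j : (j <= M)%N -> skel_point M (increments w) j = W (j%:R / M%:R) w.
  move=> jM; rewrite /skel_point walk_increments0// walk_increments1//.
  apply/rowP => i; have [->|->] : i = 0 \/ i = 1.
    by case: i => -[|[|//]] i2; [left|right]; exact: val_inj.
  - by rewrite mkpoint0.
  - by rewrite mkpoint1.
by apply/seteqP; split => _ [j jM <-]; exists j => //; rewrite pt.
Qed.

Definition increments_rv : {mfun T >-> seqR R} := mfun_Sub (mem_set measurable_increments).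
Definition increments_law : probability (seqR R) R := distribution P increments_rv.

(** The two coordinates are independent as processes, and each has independent
    increments. *)
Lemma increments_law_iid : iid_normal (M + M) (Num.sqrt M%:R)^-1 increments_law.
Proof.
have [h0 h1 hi] := hW.
split=> [A mA|i Mi]; last first.
  rewrite -[LHS]/(P (increments @^-1` [set x | x i != 0])) (_ : _ @^-1` _ = set0) ?measure0//; apply/seteqP; split => // w /=.
  by rewrite /increments !ltnNge (leq_trans (leq_addr _ _) Mi) Mi/= eqxx.
rewrite big_split_ord/=.
rewrite -(brownian_increments_prob h0 M0 mA) -(brownian_increments_prob h1 M0 (A := fun i => A (M + i)%N))//.
rewrite -hi; last 2 first.
- by apply: increments_process_event => // i; rewrite divr_ge0.
- by apply: (@increments_process_event (fun t w => W t w 0 1) (fun i => i%:R / M%:R) M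
    (fun i => A (M + i)%N)) => // i; rewrite divr_ge0.
rewrite -[LHS]/(P (increments @^-1` cyl (M + M) A)); congr (P _).
apply/seteqP; split => w /=.
  move=> h; split => i iM.
    by have := h i (leq_trans iM (leq_addr _ _)); rewrite /increments iM.
  have := h (M + i)%N; rewrite ltn_add2l => /(_ iM).
  by rewrite /increments ltnNge leq_addr/= ltn_add2l iM addnC addnK.
move=> [ha hb] i iM; rewrite /increments; case: ifPn => [|iM']; first exact: ha.
rewrite iM; have := hb (i - M)%N; rewrite -leqNgt in iM'.
by rewrite subnKC// ltn_subLR//; exact.
Qed.

End brownian_increments.

(** * Second moments of limits *)
Section second_moments.
Context d (T : measurableType d) (R : realType) (P : probability T R).

Lemma measurable_second_moment (X : T -> R) (m : R) : measurable_fun setT X ->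
  measurable_fun setT (fun w => ((X w - m) ^+ 2)%:E).
Proof.
move=> mX; apply/measurable_EFinP; apply: measurable_funX.
exact: measurable_funB.
Qed.

Section limit.
Variables (X : nat -> T -> R) (Y : T -> R) (c U : R).
Hypotheses (mX : forall k, measurable_fun setT (X k)) (X0 : forall k w, 0 <= X k w).
Hypotheses (XY : forall k w, X k w <= Y w) (cvgX : forall w, X ^~ w @ \oo --> Y w).
Hypothesis XU : forall k, (\int[P]_w ((X k w - c) ^+ 2)%:E <= U%:E)%E.

Lemma measurable_limit : measurable_fun setT Y.
Proof. by apply: (measurable_fun_cvg mX) => w _; exact: cvgX. Qed.

Let cvg_sqr m w : ((X k w - m) ^+ 2)%:E @[k --> \oo] --> ((Y w - m) ^+ 2)%:E.
Proof.
apply: cvg_EFin; first exact: nearW.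
rewrite expr2; under eq_fun do rewrite expr2.
have h : (X k w - m) @[k --> \oo] --> Y w - m by apply: cvgB => //; exact: cvg_cst.
exact: cvgM.
Qed.

(** Fatou's lemma. *)
Lemma second_moment_limit_le : (\int[P]_w ((Y w - c) ^+ 2)%:E <= U%:E)%E.
Proof.
have := @fatou _ _ _ P setT measurableT (fun k w => ((X k w - c) ^+ 2)%:E)
  (fun k => measurable_second_moment c (mX k)) (fun k w _ => ltac:(by rewrite lee_fin sqr_ge0)).
under eq_integral do rewrite (is_cvg_limn_einfE (cvgP _ (@cvg_sqr c _))) (cvg_lim _ (@cvg_sqr c _))//.
move=> /le_trans; apply; rewrite limn_einf_lim; apply: lime_le; first exact: is_cvg_einfs.
apply: nearW => k; apply: le_trans (XU k).
by apply: ereal_inf_lbound; exists k => /=.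
Qed.

(** Dominated convergence: the bound on the second moment of Y around c makes the
    dominating function 4 (Y - c) ^ 2 + 4 c ^ 2 + 2 m ^ 2 integrable. *)
Lemma second_moment_limit_ge (m L : R) :
  (forall k, L%:E <= \int[P]_w ((X k w - m) ^+ 2)%:E)%E ->
  (L%:E <= \int[P]_w ((Y w - m) ^+ 2)%:E)%E.
Proof.
move=> hL; have mY := measurable_limit.
pose g w : R := 4 * (Y w - c) ^+ 2 + (4 * c ^+ 2 + 2 * m ^+ 2).
have c0 : 0 <= 4 * c ^+ 2 + 2 * m ^+ 2 by have := sqr_ge0 c; have := sqr_ge0 m; lra.
have mg : measurable_fun setT g.
  apply: measurable_funD => //; apply: measurable_funM => //.
  by apply: measurable_funX; exact: measurable_funB.
have g0 w : 0 <= g w by rewrite addr_ge0// mulr_ge0// sqr_ge0.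
have ig : P.-integrable setT (EFin \o g).
  apply/integrableP; split; first exact/measurable_EFinP.
  under eq_integral do rewrite /= ger0_norm//.
  rewrite ge0_integral_lin//; last 2 first.
  - by apply: measurable_funX; exact: measurable_funB.
  - by move=> w; rewrite sqr_ge0.
  rewrite integral_cst// [X in (_ + _ * X)%E]probability_setT mule1.
  apply: (@le_lt_trans _ _ (4%:E * U%:E + (4 * c ^+ 2 + 2 * m ^+ 2)%:E)%E).
    by rewrite leeD2r// lee_wpmul2l// second_moment_limit_le.
  by rewrite -EFinM -EFinD ltry.
have dom k w : setT w -> (`|((X k w - m) ^+ 2)%:E| <= (EFin \o g) w)%E.
  move=> _ /=; rewrite lee_fin ger0_norm ?sqr_ge0// /g.
  have h1 : X k w ^+ 2 <= Y w ^+ 2 by rewrite lerXn2r ?nnegrE// (le_trans _ (XY k w)).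
  by have h2 := sqr_ge0 (X k w + m); have h3 := sqr_ge0 (Y w - 2 * c); lra.
have h := @dominated_cvg _ _ _ P setT measurableT (fun k w => ((X k w - m) ^+ 2)%:E)
  (fun w => ((Y w - m) ^+ 2)%:E) (EFin \o g)
  (fun k => measurable_second_moment m (mX k)) (fun w _ => @cvg_sqr m w) (fun w _ => erefl) ig dom.
rewrite -(cvg_lim _ h)//; apply: lime_ge; first exact: (cvgP _ h).
exact: nearW.
Qed.

End limit.

(** The mean minimizes the second moment. The identity behind this is arranged,
    depending on the sign of m - c, as one between sums of nonnegative
    functions, so that it can be integrated without integrability conditions. *)
Lemma variance_le (Y : T -> R) (c U : R) : measurable_fun setT Y -> (forall w, 0 <= Y w) ->
  0 <= c -> (\int[P]_w ((Y w - c) ^+ 2)%:E <= U%:E)%E -> ('V_P[Y] <= U%:E)%E.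
Proof.
move=> mY Y0 c0 YU.
have mV (m : R) : measurable_fun setT (fun w => (Y w - m) ^+ 2).
  by apply: measurable_funX; exact: measurable_funB.
have V0 (m : R) w : 0 <= (Y w - m) ^+ 2 by rewrite sqr_ge0.
have intc (a : R) : (\int[P]_w a%:E = a%:E)%E.
  by rewrite integral_cst// [X in (_ * X)%E]probability_setT mule1.
have eY : ('E_P[Y] = \int[P]_w (Y w)%:E)%E by rewrite unlock.
have eV : ('V_P[Y] = \int[P]_w ((Y w - fine 'E_P[Y]%E) ^+ 2)%:E)%E.
  by rewrite /variance unlock unlock; apply: eq_integral => w _ /=.
have Yfin : (\int[P]_w (Y w)%:E)%E \is a fin_num.
  rewrite ge0_fin_numE; last by apply: integral_ge0 => w _; rewrite lee_fin.
  apply: (@le_lt_trans _ _ (\int[P]_w (1 * (Y w - c) ^+ 2 + (c + 1 / 4))%:E)%E).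
    apply: ge0_le_integral => //.
    - by move=> w _; rewrite lee_fin.
    - exact/measurable_EFinP.
    - by apply/measurable_EFinP; apply: measurable_funD => //; exact: measurable_funM.
    - move=> w _; rewrite lee_fin.
      by have := sqr_ge0 (Y w - c - 1 / 2); lra.
  rewrite ge0_integral_lin//; last by move=> w; lra.
  rewrite intc mul1e; apply: (le_lt_trans (leeD2r _ YU)).
  by rewrite -EFinD ltry.
have m0 : 0 <= fine 'E_P[Y]%E by rewrite fine_ge0// eY integral_ge0// => w _; rewrite lee_fin.
have mE : ((fine 'E_P[Y]%E)%:E = \int[P]_w (Y w)%:E)%E by rewrite eY fineK.
rewrite eV; move: m0 mE; move: (fine _) => m m0 mE.
move: YU.
have V'0 : (0 <= \int[P]_w ((Y w - c) ^+ 2)%:E)%E by apply: integral_ge0 => w _; rewrite lee_fin.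
have V''0 : (0 <= \int[P]_w ((Y w - m) ^+ 2)%:E)%E by apply: integral_ge0 => w _; rewrite lee_fin.
have [a0|a0] := leP c m.
- have e : (\int[P]_w (1 * (Y w - c) ^+ 2 + 2 * (m - c) * m)%:E =
      \int[P]_w (1 * (Y w - m) ^+ 2 + (2 * (m - c) * Y w + (m - c) ^+ 2))%:E)%E.
    by apply: eq_integral => w _; congr _%:E; ring.
  have b0 : 0 <= 2 * (m - c) by lra.
  move: e; rewrite ge0_integral_lin//; last by move=> w; exact: mulr_ge0.
  rewrite ge0_integral_lin//; last 2 first.
  - by apply: measurable_funD => //; exact: measurable_funM.
  - by move=> w; exact: (addr_ge0 (mulr_ge0 b0 (Y0 w)) (sqr_ge0 _)).
  rewrite ge0_integral_lin//; last by move=> w; exact: sqr_ge0.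
  rewrite !intc -mE !mul1e; move: V'0 V''0.
  case: (\int[P]_w ((Y w - c) ^+ 2)%:E)%E => [u| |] // u0.
  case: (\int[P]_w ((Y w - m) ^+ 2)%:E)%E => [v| |] // v0; rewrite -?EFinM -?EFinD// => -[e].
  by rewrite !lee_fin; have := sqr_ge0 (m - c); lra.
- have e : (\int[P]_w (1 * (Y w - c) ^+ 2 + 2 * (c - m) * Y w)%:E =
      \int[P]_w (1 * (Y w - m) ^+ 2 + (2 * (c - m) * m + (m - c) ^+ 2))%:E)%E.
    by apply: eq_integral => w _; congr _%:E; ring.
  have b0 : 0 <= 2 * (c - m) by lra.
  have b1 : 0 <= 2 * (c - m) * m + (m - c) ^+ 2 by exact: (addr_ge0 (mulr_ge0 b0 m0) (sqr_ge0 _)).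
  move: e; rewrite ge0_integral_lin//; last 2 first.
  - exact: measurable_funM.
  - by move=> w; exact: (mulr_ge0 b0 (Y0 w)).
  rewrite ge0_integral_lin// intc !mul1e.
  under [X in (_ + X)%E = _ -> _]eq_integral do rewrite EFinM.
  rewrite ge0_integralZl//; last 2 first.
  - exact/measurable_EFinP.
  - by move=> w _; rewrite lee_fin.
  rewrite -mE; move: V'0 V''0.
  case: (\int[P]_w ((Y w - c) ^+ 2)%:E)%E => [u| |] // u0.
  case: (\int[P]_w ((Y w - m) ^+ 2)%:E)%E => [v| |] // v0; rewrite -?EFinM -?EFinD// => -[e].
  by rewrite !lee_fin; have := sqr_ge0 (m - c); lra.
Qed.

End second_moments.

(** * The variance of the inradius *)
Lemma upper_numeric (R : realFieldType) (u : R) : u * (523 / 100) <= 1 ->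
  (46 / 100) ^+ 2 + u / (184 / 100) <= 315 / 10 ^+ 3 + 520 / 10 ^+ 6.
Proof. by move=> hu; lra. Qed.

Section skeleton_bounds.
Context (R : realType).

(** The value 0.46 of c nearly minimizes c ^ 2 + exp (- 8 c ^ 2) / (4 c). *)
Lemma skel_second_moment_le (M : nat) (P : probability (seqR R) R) : (0 < M)%N ->
  iid_normal (M + M) (Num.sqrt M%:R)^-1 P ->
  (\int[P]_x ((skel_inradius M x - 46 / 100) ^+ 2)%:E <=
    (315 / 10 ^+ 3 + 520 / 10 ^+ 6)%:E)%E.
Proof.
case: M => // M _ iidP.
have a0 : 0 < 184 / 100 :> R by lra.
have ac : 184 / 100 = 4 * (46 / 100) :> R by lra.
apply: (le_trans (skel_second_moment iidP a0 ac)); rewrite lee_fin.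
have -> : bell (184 / 100) = expR (- (16928 / 100 / 100)) :> R.
  by rewrite /bell; congr expR; lra.
have h1 := @expR_excess R; have h2 := expR_gt0 (- (16928 / 100 / 100) : R).
have h3 : expR (- (16928 / 100 / 100)) * expR (16928 / 100 / 100) = 1 :> R.
  by rewrite -expRD addNr expR0.
have h4 := ler_wpM2l (ltW h2) h1; rewrite h3 in h4.
exact: upper_numeric.
Qed.

Lemma skel_inradius_integrable (M : nat) (P : probability (seqR R) R) : (0 < M)%N ->
  iid_normal (M + M) (Num.sqrt M%:R)^-1 P ->
  (\int[P]_x (skel_inradius M x)%:E < +oo)%E.
Proof.
move=> M0 iidP; have mF := @measurable_skel_inradius R M.
have mV : measurable_fun setT (fun x : seqR R => (skel_inradius M x - 46 / 100) ^+ 2).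
  by apply: measurable_funX; exact: measurable_funB.
apply: (@le_lt_trans _ _ (\int[P]_x (1 * (skel_inradius M x - 46 / 100) ^+ 2 + 1)%:E)%E).
  apply: ge0_le_integral => //.
  - by move=> x _; rewrite lee_fin skel_inradius_ge0.
  - exact/measurable_EFinP.
  - by apply/measurable_EFinP; apply: measurable_funD => //; exact: measurable_funM.
  - move=> x _; rewrite lee_fin.
    by have := sqr_ge0 (skel_inradius M x - 46 / 100 - 1 / 2); lra.
rewrite ge0_integral_lin//; last by move=> x; rewrite sqr_ge0.
rewrite integral_cst// [X in (_ + _ * X)%E]probability_setT !mul1e.
apply: (le_lt_trans (leeD2r _ (skel_second_moment_le M0 iidP))).
by rewrite -EFinD ltry.
Qed.

(** The number of blocks is 2 n = 512. As it is even, the first n blocks of a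
    coordinate end at the midpoint of the path. *)
Lemma skel_second_moment_ge (n k : nat) (P : probability (seqR R) R) (m : R) :
  n%:R = 256 :> R ->
  iid_normal ((n + n) * k.+1 + (n + n) * k.+1) (Num.sqrt ((n + n) * k.+1)%:R)^-1 P ->
  ((27 / 10 / 10 ^+ 6)%:E <= \int[P]_x ((skel_inradius ((n + n) * k.+1) x - m) ^+ 2)%:E)%E.
Proof.
move=> n256 iidP.
have n0 : (0 < n)%N by rewrite -(ltr0n R) n256; lra.
have [m24|m24] := leP m (24 / 100).
  have [h hE] : exists h, (n * k.+1 = h.+1)%N by exists (n * k.+1).-1; rewrite prednK// muln_gt0 n0.
  move: iidP; rewrite mulnDl hE => iidP.
  exact: small_center_second_moment.
apply: large_center_second_moment => //.
- by rewrite natrD n256; lra.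
- exact: ltW.
- by apply: skel_inradius_integrable => //; rewrite muln_gt0 addn_gt0 n0.
Qed.

End skeleton_bounds.

Theorem theorem1p4 (d : measure_display) (T : measurableType d) (R : realType)
    (P : probability T R) (W : R -> T -> 'rV[R]_2)
    (r : T -> R)
    (hW : planar_brownian_motion P W)
    (hr : forall w, r w = inradius (convex_hull [set W s w | s in `[0, 1]])) :
  ((27 / 10 / 10 ^+ 6)%:E <= 'V_P[r] <= (315 / 10 ^+ 3 + 520 / 10 ^+ 6)%:E)%E.
Proof.
(* n is kept abstract to prevent the computation with a large unary number *)
have [n n256] : exists n, n%:R = 256 :> R by exists 256.
have n0 : (0 < n)%N by rewrite -(ltr0n R) n256; lra.
pose M k := ((n + n) * k.+1)%N.
have M0 k : (0 < M k)%N by rewrite muln_gt0 addn_gt0 n0.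
pose X k w := skel_inradius (M k) (increments W (M k) w).
have XE k w : X k w = inradius (convex_hull (path_grid (W^~ w) (M k))).
  by rewrite /X /skel_inradius (skeleton_increments hW (M k)).
have rE w : r w = inradius (convex_hull (path_range (W^~ w))) by rewrite hr.
have cW w i : {within `[0, +oo[, continuous (fun t : R => W t w 0 i)}.
  have [[_ _ _ _ c0] [_ _ _ _ c1] _] := hW.
  have [->|->] : i = 0 \/ i = 1; [|exact: c0|exact: c1].
  by case: i => -[|[|//]] i2; [left|right]; exact: val_inj.
have mX k : measurable_fun setT (X k).
  apply: (measurableT_comp (@measurable_skel_inradius R (M k))).
  exact: (measurable_increments hW (M k)).
have X0 k w : 0 <= X k w by exact: skel_inradius_ge0.
have Xr k w : X k w <= r w by rewrite XE rE; exact: path_grid_inradius_le.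
have cvgX w : X ^~ w @ \oo --> r w.
  apply/cvgrPdist_le => e e0.
  have [M1 hM1] := path_grid_inradius_ge (cW w) e0.
  near=> k.
  rewrite ger0_norm ?subr_ge0 ?Xr// lerBlDl XE rE.
  apply: hM1; near: k; exists M1 => // k /= Mk.
  rewrite (leq_ltn_trans Mk)// /M; apply: (@leq_trans (1 * k.+1)%N); first by rewrite mul1n.
  by rewrite leq_mul2r addn_gt0 n0 orbT.
have transfer k (m : R) : (\int[P]_w ((X k w - m) ^+ 2)%:E =
    \int[increments_law hW (M k)]_x ((skel_inradius (M k) x - m) ^+ 2)%:E)%E.
  rewrite /increments_law ge0_integral_distribution//.
  - by apply: measurable_second_moment; exact: measurable_skel_inradius.
  - by move=> x; rewrite lee_fin sqr_ge0.
have iid k := increments_law_iid hW (M0 k).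
have XU k : (\int[P]_w ((X k w - 46 / 100) ^+ 2)%:E <= (315 / 10 ^+ 3 + 520 / 10 ^+ 6)%:E)%E.
  by rewrite transfer; exact: (skel_second_moment_le (M0 k) (iid k)).
have mr := measurable_limit mX cvgX.
apply/andP; split.
  have -> : ('V_P[r] = \int[P]_w ((r w - fine 'E_P[r]%E) ^+ 2)%:E)%E.
    by rewrite /variance unlock unlock.
  apply: (second_moment_limit_ge mX X0 Xr cvgX XU) => k.
  by rewrite transfer; exact: (skel_second_moment_ge _ n256 (iid k)).
have r0 w : 0 <= r w by apply: le_trans (Xr 0 w); exact: X0.
apply: (variance_le mr r0) (second_moment_limit_le mX cvgX XU).
by lra.
Unshelve. all: by end_near. Qed.
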